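(* Let $L$ be a connected link diagram with a marked arc, and let $G$ be its Tait graph with a total order on its edges. Then the cohomology of the spanning tree complex $(CST(G),\partial_{ST})$ is isomorphic, as a bigraded abelian group, to the Khovanov homology $Kh(L)$.
   Context: **Tait graph.** $L$ is an oriented connected link diagram, checkerboard coloured, with $n_+$ positive and $n_-$ negative crossings and a dot (marked point) on a fixed arc. The Tait graph $G$ is the plane graph with one vertex per black region and one edge per crossing, joining the black regions meeting there. An edge is positive if the $A$-smoothing of its crossing joins the two black regions, negative if it separates them. The edges of $G$ are totally ordered. **Activities.** Let $T$ be a spanning tree. For $e\in T$, $cut(T,e)$ is the set of edges of $G$ reconnecting $T\setminus e$; for $e\notin T$, $cyc(T,e)$ is the edge set of the unique cycle in $T\cup e$. An edge $e\in T$ is internally live if it is the smallest element of $cut(T,e)$, else internally dead; $e\notin T$ is externally live if it is the smallest element of $cyc(T,e)$, else externally dead. The activity letter of a positive edge is $L,D,l,d$ if it is internally live, internally dead, externally live, externally dead respectively; for negative edges the letters are $\bar L,\bar D,\bar l,\bar d$. **Khovanov complex.** For a spanning subgraph $H\subseteq G$, $F(H)$ is the disjoint union, over connected components $C$ of $H$, of the sets of faces of the plane graph $C$ (equivalently the boundary circles of a regular neighbourhood of $H$). An enhanced spanning subgraph is a pair $(H,\epsilon)$ with $\epsilon:F(H)\to\{1,x\}$. Put $i(H,\epsilon)=\#\{\text{positive edges}\notin H\}+\#\{\text{negative edges}\in H\}-n_-$ and $j(H,\epsilon)=i(H,\epsilon)+|\epsilon^{-1}(1)|-|\epsilon^{-1}(x)|+n_+-n_-$.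 $CKh(L)$ is the free bigraded $\mathbb Z$-module on enhanced spanning subgraphs. Let $A(H)=\{\text{positive edges in }H\}\cup\{\text{negative edges not in }H\}$. For $e\in A(H)$ let $H'_e$ be $H$ with $e$ removed (if positive) or added (if negative); then two faces merge or one splits. Set $\partial_{Kh}(H,\epsilon)=\sum_{e\in A(H)}(-1)^{w(e)}\sum_{\epsilon'}(H'_e,\epsilon')$, where $w(e)=\#\{f<e: f\notin A(H)\}$ and $\epsilon'$ agrees with $\epsilon$ on unaffected faces and is given on affected ones by $m(1,1)=1$, $m(1,x)=m(x,1)=x$, $m(x,x)=0$ (merge) and $\Delta(1)=1\otimes x+x\otimes 1$, $\Delta(x)=x\otimes x$ (split). $Kh(L)$ is the homology of $(CKh(L),\partial_{Kh})$. **Subcomplexes for trees and the tree $G(T)$.** For a spanning tree $T$, the generators of $CKh(U(T))$ are the $(H,\epsilon)$ such that $H$ contains all internally dead and no externally dead edges of $T$ (the states of the twisted unknot $U(T)$ obtained from $L$ by smoothing the crossings of dead edges: $D,\bar d$ by $A$; $d,\bar D$ by $B$). Every generator of $CKh(L)$ lies in $CKh(U(T))$ for exactly one $T$. Let $H_c(T)$ consist of the internally dead and the externally live edges of $T$. $G(T)$ is the tree with vertex set $F(H_c(T))$ whose edges are the live edges of $T$, each joining the two faces that merge when that edge is toggled; its root $v_d$ is the face containing the dot. Spanning subgraphs $K$ of $G(T)$ correspond to the $H$ above: $H$ is $H_c(T)$ with the edges of $K$ toggled, and components of $K$ correspond to elements of $F(H)$. So generators are pairs $(K,\epsilon)$ with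 $\epsilon$ a labelling of components of $K$ by $1,x$. A live edge is a negative twist if its letter is $L$ or $\bar l$, and a positive twist if it is $\bar L$ or $l$. **The matching.** The matching on the generators for $G(T)$ is defined recursively. Let $e$ be the smallest edge incident to a degree-one vertex $v\neq v_d$ and let $v$ be that vertex. Each $(K,\epsilon)$ with $e\in K$, where $C_v$ is the component of $v$, is paired with $(K-e,\epsilon')$, where $\epsilon'(C_v-v)=\epsilon(C_v)$, $\epsilon'(\{v\})=x$ if $e$ is a negative twist and $\epsilon'(\{v\})=1$ if $e$ is a positive twist, and other labels are unchanged. The remaining generators have $v$ isolated with label $1$ (negative twist) or $x$ (positive twist); delete $v$ and apply the same rule to $G(T)\setminus v$. Exactly two generators $S_c^{T^+},S_c^{T^-}$ are left unmatched: $K$ has no edges, each vertex $v\ne v_d$ has label $1$ or $x$ according as the edge from $v$ towards $v_d$ is a negative or positive twist, and $v_d$ has label $1$ for $S_c^{T^+}$ and $x$ for $S_c^{T^-}$. $\mathcal M$ is the union over all $T$ of these matchings. **The spanning tree complex.** The Hasse diagram of $(CKh(L),\partial_{Kh})$ is the weighted directed graph on the generators with an edge $c\to c'$ of weight $[c:c']$ whenever the coefficient $[c:c']$ of $c'$ in $\partial_{Kh}c$ is nonzero. Let $\mathcal H_{\mathcal M}$ be obtained from it by replacing each matched edge $c\to c'$ by $c'\to c$ with weight $-1/[c:c']$. $\Gamma(c,c')$ is the sum over directed paths from $c$ to $c'$ in $\mathcal H_{\mathcal M}$ of the product of the edge weights. $CST(G)$ is the free $\mathbb Z$-module with two generators $T^+,T^-$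 per spanning tree, with bigradings $i(T^\pm)=i(S_c^{T^\pm})$, $j(T^\pm)=j(S_c^{T^\pm})$, and for signs $\sigma$, $\partial_{ST}(T^\sigma)=\sum_{T',\sigma':\, i(T'^{\sigma'})=i(T^\sigma)+1}\Gamma(S_c^{T^\sigma},S_c^{T'^{\sigma'}})\,T'^{\sigma'}$ (terms with $\sigma=-$, $\sigma'=+$ are zero). *)

(* Defs.v *)
From HB Require Import structures.
From mathcomp Require Import all_boot all_order all_algebra.
From mathcomp Require Import mathcomp_extra boolp classical_sets fsbigop.

Set Implicit Arguments.
Unset Strict Implicit.
Unset Printing Implicit Defensive.

Import GRing.Theory Num.Theory Quotient.
Local Open Scope ring_scope.

(** * Bigraded cochain complexes of finitely generated free abelian groups *)

(* [dcoef c c'] is the coefficient of [c'] in the differential of [c]. *)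
Record bicomplex := Bicomplex {
  gen : finType;
  ideg : gen -> int;
  jdeg : gen -> int;
  dcoef : gen -> gen -> int
}.

Section Cohomology.
Variable C : bicomplex.

Definition chain := {ffun gen C -> int}.

Definition diff (x : chain) : chain := [ffun c' => \sum_c x c * dcoef c c'].

Definition homogeneous (i j : int) (x : chain) : bool :=
  [forall c, (x c != 0) ==> (ideg c == i) && (jdeg c == j)].

Definition cochain_complex : Prop :=
  (forall x, diff (diff x) = 0) /\
  (forall i j x, homogeneous i j x -> homogeneous (i + 1) j (diff x)).

Definition is_cocycle (i j : int) : {pred chain} :=
  [pred x | homogeneous i j x && (diff x == 0)].

Lemma homogeneous0 i j : homogeneous i j 0.
Proof. by apply/forallP => c; rewrite ffunE eqxx. Qed.

Lemma homogeneousB i j x y :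
  homogeneous i j x -> homogeneous i j y -> homogeneous i j (x - y).
Proof.
move=> /forallP hx /forallP hy; apply/forallP => c; apply/implyP => xy0.
have /implyP hxc := hx c; have /implyP hyc := hy c.
have [x0|/hxc//] := eqVneq (x c) 0; apply: hyc.
by move: xy0; rewrite !ffunE x0 sub0r oppr_eq0.
Qed.

Lemma diffB x y : diff (x - y) = diff x - diff y.
Proof.
apply/ffunP => c; rewrite !ffunE -sumrB; apply: eq_bigr => d _.
by rewrite !ffunE mulrBl.
Qed.

Lemma diff0 : diff 0 = 0.
Proof. by have := diffB 0 0; rewrite !subrr. Qed.

Lemma is_cocycle_zmod_closed i j : zmod_closed (is_cocycle i j).
Proof.
split=> [|x y /andP[hx /eqP dx] /andP[hy /eqP dy]]; apply/andP; split.
- exact: homogeneous0.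
- by rewrite diff0.
- exact: homogeneousB.
- by rewrite diffB dx dy subrr.
Qed.

HB.instance Definition _ i j :=
  GRing.isZmodClosed.Build chain (is_cocycle i j) (is_cocycle_zmod_closed i j).

Record cocycle (i j : int) :=
  Cocycle { cocycle_val :> chain; _ : cocycle_val \in is_cocycle i j }.
HB.instance Definition _ i j := [isSub for @cocycle_val i j].
HB.instance Definition _ i j := [Choice of cocycle i j by <:].
HB.instance Definition _ i j := [SubChoice_isSubZmodule of cocycle i j by <:].

Definition is_coboundary (i j : int) : {pred cocycle i j} :=
  [pred z | `[< exists2 y : chain, homogeneous (i - 1) j y & val z = diff y >]].

Lemma is_coboundary_zmod_closed i j : zmod_closed (@is_coboundary i j).
Proof.
split=> [|z t /asboolP[x hx zx] /asboolP[y hy ty]]; apply/asboolP.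
  by exists 0; [exact: homogeneous0 | rewrite diff0].
by exists (x - y); [exact: homogeneousB | rewrite diffB -zx -ty].
Qed.

HB.instance Definition _ i j :=
  GRing.isZmodClosed.Build (cocycle i j) (@is_coboundary i j)
    (@is_coboundary_zmod_closed i j).

Definition cohomology (i j : int) : zmodType := {quot @is_coboundary i j}.

End Cohomology.

(** * Connected oriented link diagrams with a marked arc *)

(* The diagram is a combinatorial map on the sphere: four half-arcs [(c, k)] at
   every crossing, [k] increasing counterclockwise, with [(c, 0)] and [(c, 2)]
   on the lower strand and [(c, 1)] and [(c, 3)] on the upper one.  The dot is
   a two-valent vertex with half-arcs [inr true] and [inr false], so that the
   circle without crossings is a diagram too. *)
Definition half_arc (X : finType) : finType := (X * 'Z_4 + bool)%type.

Definition rot (X : finType) (d : half_arc X) : half_arc X :=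
  match d with inl (c, k) => inl (c, k + 1) | inr s => inr (~~ s) end.

Definition rot_inv (X : finType) (d : half_arc X) : half_arc X :=
  match d with inl (c, k) => inl (c, k - 1) | inr s => inr (~~ s) end.

Definition across (X : finType) (d : half_arc X) : half_arc X :=
  match d with inl (c, k) => inl (c, k + 2) | inr s => inr (~~ s) end.

(* The next half-arc, leaving a vertex, along the boundary of the region that
   lies to the left of the half-arc [d] leaving a vertex. *)
Definition left_next (X : finType) (arc : half_arc X -> half_arc X)
  (d : half_arc X) : half_arc X := rot_inv (arc d).

Definition region_of (X : finType) (arc : half_arc X -> half_arc X)
  (d : half_arc X) : {set half_arc X} := [set d' | fconnect (left_next arc) d d'].

(* [arc d] is the other half of the arc of [d]; [outgoing d] says that the
   orientation leaves the vertex along [d].  [diagram_planar] is Euler's formula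
   V - E + F = 2 with V = #|X| + 1 and E = 2 #|X| + 1. *)
Record link_diagram := LinkDiagram {
  crossing : finType;
  arc : half_arc crossing -> half_arc crossing;
  outgoing : pred (half_arc crossing);
  arcK : involutive arc;
  outgoing_arc : forall d, outgoing (arc d) = ~~ outgoing d;
  outgoing_across : forall d, outgoing (across d) = ~~ outgoing d;
  diagram_connected : forall d d',
    connect [rel u v | (v == arc u) || (v == rot u)] d d';
  diagram_planar :
    #|[set region_of arc d | d : half_arc crossing]| = (#|crossing| + 2)%N
}.

(* [black d] is the colour of the region to the left of [d], which at a crossing
   is the corner between [(c, k)] and [(c, k + 1)]. *)
Record checkerboard (L : link_diagram) := Checkerboard {
  black : pred (half_arc (crossing L));
  black_left_next : forall d, black (left_next (@arc L) d) = black d;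
  black_arc : forall d, black (arc d) = ~~ black d
}.

Section KhovanovComplex.
Variables (L : link_diagram) (b : checkerboard L).

Local Notation X := (crossing L).
Local Notation dart := (half_arc (crossing L)).

(* At a positive crossing the outgoing upper strand turns counterclockwise by a
   right angle onto the outgoing lower strand. *)
Definition positive_crossing (c : X) : bool :=
  outgoing (inl (c, 1) : dart) == outgoing (inl (c, 2) : dart).
Definition nplus : nat := #|[set c | positive_crossing c]|.
Definition nminus : nat := #|[set c | ~~ positive_crossing c]|.

(** ** The Tait graph *)

Definition region (d : dart) : {set dart} := region_of (@arc L) d.

Definition tait_vertices : {set {set dart}} :=
  [set region d | d : dart & black b d].

Definition black_corner (c : X) : 'Z_4 := if black b (inl (c, 0)) then 0 else 1.

Definition tait_ends (c : X) : {set dart} * {set dart} :=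
  (region (inl (c, black_corner c)), region (inl (c, black_corner c + 2))).

(* The A-smoothing joins the corners swept by the upper strand when it turns
   counterclockwise: the corner between half-arcs 1 and 2 and the one between
   half-arcs 3 and 0. *)
Definition positive_edge (c : X) : bool := black b (inl (c, 1)).

(** ** Enhanced spanning subgraphs *)

(* The boundary of a regular neighbourhood of the spanning subgraph [H] runs
   along the arcs of the diagram; at a crossing of [H] it goes around the white
   corners, at any other crossing around the black ones.  Its components are
   recorded as sets of half-arcs. *)
Definition turn (H : {set X}) (d : dart) : dart :=
  match d with
  | inl (c, k) =>
      if black b d (+) (c \in H) then inl (c, k + 1) else inl (c, k - 1)
  | inr s => inr (~~ s)
  end.

Definition circle (H : {set X}) (d : dart) : {set dart} :=
  [set d' | connect [rel u v | (v == arc u) || (v == turn H u)] d d'].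

Definition faces (H : {set X}) : {set {set dart}} := [set circle H d | d : dart].

(* The pair [(H, P)] stands for the enhanced spanning subgraph [(H, eps)] with
   [P] the set of faces labelled 1. *)
Definition enhanced : finType :=
  {c : {set X} * {set {set dart}} | c.2 \subset faces c.1}.

Definition sub (c : enhanced) : {set X} := (val c).1.
Definition ones (c : enhanced) : {set {set dart}} := (val c).2.

(* Labels: [true] is 1 and [false] is x. *)
Definition label (c : enhanced) (f : {set dart}) : bool := f \in ones c.

Definition i_grading (c : enhanced) : int :=
  #|[set e | positive_edge e & e \notin sub c]|%:Z
  + #|[set e | ~~ positive_edge e & e \in sub c]|%:Z - nminus%:Z.

Definition j_grading (c : enhanced) : int :=
  i_grading c + #|[set f in faces (sub c) | label c f]|%:Z
  - #|[set f in faces (sub c) | ~~ label c f]|%:Z + nplus%:Z - nminus%:Z.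

Definition toggle (H : {set X}) (e : X) : {set X} :=
  if e \in H then H :\ e else e |: H.

Definition A_edges (H : {set X}) : {set X} :=
  [set e | if positive_edge e then e \in H else e \notin H].

Definition merge_label (p q : bool) : option bool :=
  match p, q with
  | true, true => Some true
  | true, false | false, true => Some false
  | false, false => None
  end.

Definition split_label (p : bool) : seq (bool * bool) :=
  if p then [:: (true, false); (false, true)] else [:: (false, false)].

(* The affected faces are those belonging to only one of [F(H)], [F(H'_e)]. *)
Definition edge_map (c c' : enhanced) : bool :=
  let old := faces (sub c) :\: faces (sub c') in
  let new := faces (sub c') :\: faces (sub c) in
  [forall f in faces (sub c) :&: faces (sub c'), label c' f == label c f] &&
  ([exists f1, exists f2, exists f,
      [&& f1 != f2, old == [set f1; f2], new == [set f]
        & merge_label (label c f1) (label c f2) == Some (label c' f)]]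
   || [exists f, exists f1, exists f2,
      [&& f1 != f2, old == [set f], new == [set f1; f2]
        & (label c' f1, label c' f2) \in split_label (label c f)]]).

Section Ordered.
Variable le : rel X.

Definition kh_exponent (H : {set X}) (e : X) : nat :=
  #|[set f | [&& le f e, f != e & f \notin A_edges H]]|.

Definition kh_coef (c c' : enhanced) : int :=
  \sum_(e in A_edges (sub c) | (sub c' == toggle (sub c) e) && edge_map c c')
    (-1) ^+ kh_exponent (sub c) e.

Definition CKh : bicomplex := Bicomplex i_grading j_grading kh_coef.

(** ** Spanning trees and activities *)

Definition tait_adj (H : {set X}) : rel {set dart} :=
  [rel u v | [exists e in H, (tait_ends e == (u, v)) || (tait_ends e == (v, u))]].

Definition tait_connected (H : {set X}) : bool :=
  [forall u in tait_vertices, forall v in tait_vertices, connect (tait_adj H) u v].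

Definition tait_degree (H : {set X}) (v : {set dart}) : nat :=
  (\sum_(e in H) (((tait_ends e).1 == v) + ((tait_ends e).2 == v)))%N.

(* Edge sets of cycles, including loops and pairs of parallel edges. *)
Definition is_cycle (C : {set X}) : bool :=
  [&& C != finset.set0,
      [forall v, (tait_degree C v == 0%N) || (tait_degree C v == 2%N)]
    & [forall e in C, forall f in C,
         connect (tait_adj C) (tait_ends e).1 (tait_ends f).1]].

Definition spanning_tree (T : {set X}) : bool :=
  tait_connected T && [forall C : {set X}, (C \subset T) ==> ~~ is_cycle C].

Definition cut (T : {set X}) (e : X) : {set X} :=
  [set f | tait_connected (f |: (T :\ e))].

(* For a spanning tree [T] and [e \notin T] there is exactly one such [C]. *)
Definition cyc (T : {set X}) (e : X) : {set X} :=
  \bigcup_(C : {set X} | is_cycle C && (C \subset e |: T)) C.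

Definition live (T : {set X}) (e : X) : bool :=
  [forall f in (if e \in T then cut T e else cyc T e), le e f].

Definition live_edges (T : {set X}) : {set X} := [set e | live T e].

(* The letters [L] and barred [l]. *)
Definition negative_twist (T : {set X}) (e : X) : bool :=
  live T e && (if e \in T then positive_edge e else ~~ positive_edge e).

(* [c] is a generator of CKh(U(T)). *)
Definition in_unknot (T : {set X}) (c : enhanced) : bool :=
  [forall e, ~~ live T e ==> (if e \in T then e \in sub c else e \notin sub c)].

(** ** The rooted tree G(T) *)

(* The subgraph H_c(T). *)
Definition core (T : {set X}) : {set X} :=
  [set e | if e \in T then ~~ live T e else live T e].

Definition twist_ends (T : {set X}) (e : X) : {set {set dart}} :=
  faces (core T) :\: faces (toggle (core T) e).

Definition twist_adj (T K : {set X}) : rel {set dart} :=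
  [rel u v | [exists e in K, twist_ends T e == [set u; v]]].

Definition root (T : {set X}) : {set dart} := circle (core T) (inr true).

Definition twist_sub (T : {set X}) (c : enhanced) : {set X} :=
  [set e in live_edges T | (e \in sub c) != (e \in core T)].

(* The component of [v] in the spanning subgraph [K] of G(T), as a face of the
   subgraph corresponding to [K]: the union of the circles merged by [K]. *)
Definition component (T K : {set X}) (v : {set dart}) : {set dart} :=
  \bigcup_(u in faces (core T) | connect (twist_adj T K) v u) u.

(** ** The matching *)

(* [W] is the set of vertices of G(T) which are not deleted yet. *)
Definition leaf_edge (T : {set X}) (W : {set {set dart}}) (e : X)
    (v : {set dart}) : bool :=
  let E := [set f in live_edges T | twist_ends T f \subset W] in
  [&& v \in W, v != root T, e \in E, v \in twist_ends T e
    & #|[set f in E | v \in twist_ends T f]| == 1%N].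

Definition smallest_leaf_edge (T : {set X}) (W : {set {set dart}}) (e : X)
    (v : {set dart}) : bool :=
  leaf_edge T W e v &&
  [forall e', forall v', leaf_edge T W e' v' ==> le e e'].

Definition leaf_pair (T : {set X}) (e : X) (v : {set dart})
    (c c' : enhanced) : bool :=
  let Cv := component T (twist_sub T c) v in
  [&& e \in twist_sub T c,
      sub c' == toggle (sub c) e,
      label c' (Cv :\: v) == label c Cv,
      label c' v == ~~ negative_twist T e
    & [forall f in faces (sub c), (f != Cv) ==> (label c' f == label c f)]].

Definition leaf_unpaired (T : {set X}) (e : X) (v : {set dart})
    (c : enhanced) : bool :=
  (e \notin twist_sub T c) && (label c v == negative_twist T e).

(* Generators of G(T) without the deleted vertices are identified with the
   generators that are left unpaired by the deletion of those vertices. *)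
Inductive tree_matching (T : {set X}) :
    {set {set dart}} -> enhanced -> enhanced -> Prop :=
| MatchLeaf W e v c c' :
    smallest_leaf_edge T W e v -> leaf_pair T e v c c' ->
    tree_matching T W c c'
| MatchDelete W e v c c' :
    smallest_leaf_edge T W e v ->
    leaf_unpaired T e v c -> leaf_unpaired T e v c' ->
    tree_matching T (W :\ v) c c' ->
    tree_matching T W c c'.

Definition matched (c c' : enhanced) : Prop :=
  exists T : {set X}, [/\ spanning_tree T, in_unknot T c, in_unknot T c'
    & tree_matching T (faces (core T)) c c'].

(** ** The spanning tree complex *)

(* The weight of the edge from [c] to [c'] in the modified Hasse diagram, 0 if
   there is none.  If [c] and [c'] are matched, at most one of the coefficients
   of the differential between them is nonzero, and [0^-1 = 0]. *)
Definition weight (c c' : enhanced) : int :=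
  if `[< matched c c' \/ matched c' c >] then - (kh_coef c' c)^-1
  else kh_coef c c'.

Fixpoint path_weight (c : enhanced) (p : seq enhanced) : int :=
  if p is c' :: p' then weight c c' * path_weight c' p' else 1.

(* The sum ranges over all directed paths, without a bound on their length; the
   graph is acyclic, so that there are finitely many. *)
Definition Gamma (c c' : enhanced) : int :=
  \sum_(p \in [set p : seq enhanced |
      path [rel u v | weight u v != 0] c p /\ last c p = c']%classic)
    path_weight c p.

(* The edge of G(T) leading from [v] towards the root. *)
Definition towards_root (T : {set X}) (v : {set dart}) (e : X) : bool :=
  [&& e \in live_edges T, v \in twist_ends T e
    & ~~ connect (twist_adj T (live_edges T :\ e)) v (root T)].

Definition critical_ones (T : {set X}) (s : bool) : {set {set dart}} :=
  [set v in faces (core T) |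
    if v == root T then s
    else [exists e, towards_root T v e && negative_twist T e]].

Lemma critical_subproof (T : {set X}) (s : bool) :
  critical_ones T s \subset faces (core T).
Proof. by apply/fintype.subsetP => v; rewrite inE => /andP[]. Qed.

(* [true] is the sign + and [false] the sign -. *)
Definition critical (T : {set X}) (s : bool) : enhanced :=
  exist _ (core T, critical_ones T s) (critical_subproof T s).

Definition signed_tree : finType := ({T : {set X} | spanning_tree T} * bool)%type.

Definition critical_of (t : signed_tree) : enhanced := critical (val t.1) t.2.

Definition st_ideg (t : signed_tree) : int := i_grading (critical_of t).
Definition st_jdeg (t : signed_tree) : int := j_grading (critical_of t).

Definition st_coef (t t' : signed_tree) : int :=
  if st_ideg t' == st_ideg t + 1 then Gamma (critical_of t) (critical_of t')
  else 0.

Definition CST : bicomplex := Bicomplex st_ideg st_jdeg st_coef.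

End Ordered.
End KhovanovComplex.

(* Main.v *)
(** The unmatched generators form a complex computing the same homology because
    the matching is acyclic: the block of the differential going from sources to
    targets of matched edges is then invertible, and its Schur complement is the
    sum over the alternating paths, the only ones that raise the degree by one
    between unmatched generators.

    Every state has a partition of the half-arcs into circles, and toggling an
    edge either merges two circles or splits one.  Euler's formula identifies
    the spanning trees with the states having a single circle; an edge is live
    when its chord of that circle crosses no chord of a smaller edge.  Hence live
    edges are pairwise non-crossing, which makes G(T) a tree whose spanning
    subgraphs describe the circles of the states of U(T).  That every state lies
    in exactly one U(T) follows from tree exchange, looking at the largest edge
    in which two trees differ.  A differential from U(T) to another U(T') changes
    exactly that edge, from its A- to its B-smoothing, so that the A-smoothed
    edges of T, compared lexicographically from the largest edge down, decrease;
    inside U(T) acyclicity is checked leaf by leaf. *)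

From HB Require Import structures.
From mathcomp Require Import all_boot all_order all_algebra fingroup perm zify ring.
Require Import Defs.
Set Implicit Arguments.
Unset Strict Implicit.
Unset Printing Implicit Defensive.
Import Order.TTheory GRing.Theory Num.Theory.
Local Open Scope ring_scope.

(** * Circles of a state *)

Section Circles.
Variables (L : link_diagram) (b : checkerboard L).
Local Notation X := (crossing L).
Local Notation dart := (half_arc (crossing L)).
Implicit Types (H : {set X}) (e : X) (d : dart).

(** The set of faces changes from state to state, so the proof works with half-arcs instead: a
    labelling is a function on half-arcs constant on circles, and the effect of toggling [e] is
    decided by whether [dart0 e] and [dart2 e] lie on one circle. The checkerboard colours make
    every toggle change the number of circles by exactly one; planarity enters through Euler's
    formula. That the Khovanov differential squares to zero is itself to be proved. It is checked on
    monomials with one variable for each half-arc, where merges are quotient maps, splits are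
    multiplications, and both orders of two toggles can be compared. The matching comes as an
    inductive relation, tree by tree, and [Gamma] as a sum over paths of any length. Both are first
    rewritten, as an involution with a rank that falls along gradient paths, and as finite sums.
    Matched coefficients are 1 or -1, hence their own inverses, so the Morse argument works over the
    integers. With [h] the inverse block, the projection [1 - h d - d h] has as image a subcomplex
    on which restriction to critical generators is bijective; this yields both the vanishing of the
    squared differential of CST and the isomorphism. *)

Definition same_circle H : rel dart :=
  connect [rel u v | (v == arc u) || (v == turn b H u)].

(** In either smoothing each of the two strands at a crossing has one end at an even half-arc, so
    half-arcs 0 and 2 represent the two strands whatever the state is. *)
Definition dart0 e : dart := inl (e, 0).
Definition dart2 e : dart := inl (e, 1 + 1).
Definition joined H e : bool := same_circle H (dart0 e) (dart2 e).

Lemma Z4_cases (P : 'Z_4 -> Prop) :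
  P 0 -> P 1 -> P (1 + 1) -> P (1 + 1 + 1) -> forall k, P k.
Proof.
move=> P0 P1 P2 P3 [[|[|[|[|//]]]] hk].
- by have -> : Ordinal hk = 0 by exact: val_inj.
- by have -> : Ordinal hk = 1 by exact: val_inj.
- by have -> : Ordinal hk = 1 + 1 by exact: val_inj.
- by have -> : Ordinal hk = 1 + 1 + 1 by exact: val_inj.
Qed.

Lemma black_rot_inv d : black b (rot_inv d) = ~~ black b d.
Proof. by rewrite -{1}(arcK d) -black_arc -(black_left_next b (arc d)) /left_next. Qed.

Lemma rot_invK : cancel (@rot_inv X) (@rot X).
Proof. by case=> [[c k]|s] /=; rewrite ?subrK ?negbK. Qed.

Lemma rotK : cancel (@rot X) (@rot_inv X).
Proof. by case=> [[c k]|s] /=; rewrite ?addrK ?negbK. Qed.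

Lemma black_rot d : black b (rot d) = ~~ black b d.
Proof. by rewrite -{2}[d]rotK black_rot_inv negbK. Qed.

Lemma black_succ e k : black b (inl (e, k + 1)) = ~~ black b (inl (e, k)).
Proof. exact: (black_rot (inl (e, k))). Qed.

Lemma black_pred e k : black b (inl (e, k - 1)) = ~~ black b (inl (e, k)).
Proof. exact: (black_rot_inv (inl (e, k))). Qed.

Lemma black_turn H d : black b (turn b H d) = ~~ black b d.
Proof.
case: d => [[c k]|s] /=; last exact: (black_rot (inr s)).
by case: ifP => _; rewrite ?black_succ ?black_pred.
Qed.

Lemma turnK H : involutive (turn b H).
Proof.
case=> [[c k]|s] /=; last by rewrite negbK.
case: ifP => h /=; rewrite ?black_succ ?black_pred addNb h /=.
  by rewrite addrK.
by rewrite subrK.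
Qed.

Lemma same_refl H d : same_circle H d d.
Proof. exact: connect0. Qed.

Lemma same_sym H d d' : same_circle H d d' = same_circle H d' d.
Proof.
rewrite /same_circle; apply: sym_connect_sym => {}d {}d' /=.
by congr orb; apply/eqP/eqP => ->; rewrite ?arcK ?turnK.
Qed.

Lemma same_trans H : transitive (same_circle H).
Proof. exact: connect_trans. Qed.

Lemma same_arc H d : same_circle H d (arc d).
Proof. by apply: connect1; rewrite /= eqxx. Qed.

Lemma same_turn H d : same_circle H d (turn b H d).
Proof. by apply: connect1; rewrite /= eqxx orbT. Qed.

Lemma same_circle_sub H (R : rel dart) :
  reflexive R -> transitive R ->
  (forall d, R d (arc d)) -> (forall d, R d (turn b H d)) ->
  forall d d', same_circle H d d' -> R d d'.
Proof.
move=> Rr Rt Ra Rtu d d' /connectP[p]; elim: p d => [|y p IH] d /=.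
  by move=> _ ->; exact: Rr.
move=> /andP[/orP[]/eqP -> hp] hl; apply: Rt (IH _ hp hl); by [exact: Ra|exact: Rtu].
Qed.

Lemma mem_circle H d d' : (d' \in circle b H d) = same_circle H d d'.
Proof. by rewrite /circle inE. Qed.

Lemma eq_circle H d d' : (circle b H d == circle b H d') = same_circle H d d'.
Proof.
apply/eqP/idP => [E|h]; first by rewrite -mem_circle E mem_circle same_refl.
apply/setP => z; rewrite !mem_circle; apply/idP/idP; last exact: same_trans.
by apply: same_trans; rewrite same_sym.
Qed.

Lemma circle_in_faces H d : circle b H d \in faces b H.
Proof. exact: imset_f. Qed.

Lemma in_toggle H e f : (f \in toggle H e) = ((f == e) (+) (f \in H)).
Proof.
rewrite /toggle; case: ifP => h; rewrite !inE; first by case: eqP => // ->; rewrite h.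
by case: eqP => // ->; rewrite h.
Qed.

Lemma toggleK e : involutive (@toggle L ^~ e).
Proof. by move=> H; apply/setP => g; rewrite !in_toggle addbA addbb. Qed.

Lemma toggleC H e f : toggle (toggle H e) f = toggle (toggle H f) e.
Proof. by apply/setP => g; rewrite !in_toggle addbCA. Qed.

Section Step.
Variables (H : {set X}) (col : bool).

(** Both [arc] and [turn] reverse the colour, so two steps at a time traverse the half-arcs of
    colour [col] on a circle as one cycle. The other half-arcs are fixed to make this a permutation
    of all of them. *)
Definition step d := if black b d == col then turn b H (arc d) else d.

Lemma black_step d : black b (step d) = black b d.
Proof. by rewrite /step; case: ifP => // _; rewrite black_turn black_arc negbK. Qed.

Lemma step_inj : injective step.
Proof.
move=> d d' E; have := congr1 (black b) E; rewrite !black_step => cE.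
move: E; rewrite /step cE; case: ifP => // _ /(inv_inj (@turnK H)).
exact: (inv_inj (@arcK L)).
Qed.

Definition step_perm : {perm dart} := perm step_inj.

Lemma porbit_same d d' : black b d = col -> black b d' = col ->
  (d' \in porbit step_perm d) = same_circle H d d'.
Proof.
move=> cd cd'; apply/idP/idP.
  case/porbitP => n ->; elim: n => [|n IH]; first by rewrite expg0 perm1 same_refl.
  rewrite expgSr permM permE; apply: same_trans IH _.
  set z := fun_of_perm _ _; rewrite /step; case: ifP => _; last exact: same_refl.
  exact: same_trans (same_arc H z) (same_turn H (arc z)).
(* Moving half-arcs of the wrong colour across their arc extends the orbit relation to all
   half-arcs, where it can be compared with [same_circle]. *)
pose rep z := if black b z == col then z else arc z.
pose R := [rel u v | porbit step_perm (rep u) == porbit step_perm (rep v)].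
move=> h; suff : R d d'.
  by rewrite /= /rep cd cd' eqxx => /eqP ->; rewrite porbit_id.
have next z : porbit step_perm z = porbit step_perm (step z).
  by have := porbit_perm step_perm 1 z; rewrite expg1 permE => ->.
apply: (same_circle_sub (R := R)) h => [z|y x z|z|z]; rewrite /=.
- by [].
- by move=> /eqP ->.
- rewrite /rep black_arc; case: (black b z) => //=; case: col => //=; by rewrite arcK.
- rewrite /rep black_turn; case: (eqVneq (black b z) col) => hz.
    have -> : (~~ black b z == col) = false by rewrite -hz; case: black.
    by rewrite [X in _ == X]next /step black_arc black_turn negbK hz eqxx arcK turnK.
  have hz' : ~~ black b z == col by move: hz; case: black; case: col.
  by rewrite hz' next /step black_arc hz' arcK.
Qed.
End Step.

Lemma black_dart2 e : black b (dart2 e) = black b (dart0 e).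
Proof. by rewrite /dart2 -[1 + 1 : 'Z_4]add0r addrA !black_succ negbK. Qed.

(** If [d] has the colour of [dart0 e], then [arc d] has the other one. If [arc d] is at [e], it is
    half-arc 1 or 3 and both turns end at 0 or 2; toggling takes the other of these. *)
Lemma step_toggle H e col : black b (dart0 e) = col ->
  step_perm (toggle H e) col = (step_perm H col * tperm (dart0 e) (dart2 e))%g.
Proof.
move=> ce; apply/permP => d; rewrite permM [LHS]permE [step_perm H col d]permE /= /step.
case: ifP => [/eqP hd|hd].
  have ha : black b (arc d) = ~~ col by rewrite black_arc hd.
  case E : (arc d) => [[c k]|s] /=; last by rewrite tpermD.
  have [cE|cE] := eqVneq c e; last first.
    rewrite in_toggle (negPf cE) /= tpermD //; case: ifP => _; 
      by apply/eqP => -[] /esym /eqP; rewrite (negPf cE).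
  rewrite in_toggle cE eqxx /= addbN /=.
  have : ~~ odd k = false.
    move: ha; rewrite E cE -ce /dart0; elim/Z4_cases: k {E} => //.
      by move=> /esym; case: black.
    by rewrite -/(dart2 e) black_dart2 => /esym; case: black.
  have Z4 : 1 + 1 + 1 + 1 = 0 :> 'Z_4 by exact: val_inj.
  elim/Z4_cases: k {E} => // _; rewrite ?subrr ?addrK ?Z4.
    by case: (_ (+) _); rewrite /= ?(tpermR (dart0 e)) ?(tpermL (dart0 e)).
  by case: (_ (+) _); rewrite /= ?(tpermR (dart0 e)) ?(tpermL (dart0 e)).
by rewrite tpermD //; apply/eqP => E; move: hd; rewrite -E ?black_dart2 ce eqxx.
Qed.

(* Toggling an edge composes the rotation of the half-arcs of one colour with a
   transposition, which changes the number of its cycles by one. *)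
Lemma joined_toggle H e : joined (toggle H e) e = ~~ joined H e.
Proof.
pose col := black b (dart0 e); pose x := dart0 e; pose y := dart2 e.
have ne : x != y by apply/eqP => -[].
rewrite /joined !(@same_sym _ x) -/y.
have cy : black b y = col := black_dart2 e.
rewrite -!(porbit_same (col := col) _ cy) //.
rewrite step_toggle //; set s := step_perm H col; set t := tperm x y.
have E : porbit (s * t)%g y = porbit (t * s^-1)%g y.
  by rewrite -[in RHS]porbitV invMg invgK tpermV.
rewrite E -(porbitV s); set s' := s^-1%g.
(* The same count is applied to [s'] and to [t * s']. Multiplying twice by the transposition
   restores the number of cycles, so one multiplication splits and the other merges, and the two
   memberships differ. *)
have h1 := porbits_mul_tperm s' x y; have h2 := porbits_mul_tperm (t * s')%g x y.
move: h2; rewrite /= mulgA tperm2 mul1g -/t; move: h1; rewrite /= -/t ne /=.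
set A := #|_|; set B := #|_|.
case: (x \in _); case: (x \in _) => //= h1 h2; exfalso; lia.
Qed.
End Circles.

(** * Merging two classes of an equivalence relation *)

Section Classes.
Variable T : finType.
Implicit Types (R : rel T) (A : {pred T}) (a b x y : T).

Definition classes R A : {set {set T}} := [set [set y | R x y] | x in A].

Lemma equiv_sym R : equivalence_rel R -> symmetric R.
Proof.
move=> /equivalence_relP[Rr Rt] x y.
by apply/idP/idP => h; rewrite -(Rt _ _ h) Rr.
Qed.

Lemma eq_class R x y : equivalence_rel R ->
  ([set z | R x z] == [set z | R y z]) = R x y.
Proof.
move=> /equivalence_relP[Rr Rt]; apply/eqP/idP => [/setP/(_ y)|/Rt E].
  by rewrite !inE Rr.
by apply/setP => z; rewrite !inE E.
Qed.

Definition joinrel R a b : rel T :=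
  fun x y => R x y || (R a x || R b x) && (R a y || R b y).

Lemma joinrel_equiv R a b : equivalence_rel R -> equivalence_rel (joinrel R a b).
Proof.
move=> ER; have /equivalence_relP[Rr Rt] := ER.
have Rs := equiv_sym ER.
apply/equivalence_relP; split=> [x|x y]; first by rewrite /joinrel /= Rr.
rewrite /joinrel => h z; case/orP: h => [h|/andP[hx hy]].
  by rewrite (Rs a x) (Rs b x) !(Rt _ _ h) (Rs y a) (Rs y b).
rewrite hx hy /=; case hz: (R a z || R b z); first by rewrite !orbT.
rewrite !orbF; apply/idP/idP => h; move: hz; rewrite (Rs a) (Rs b) -!(Rt _ _ h).
  by rewrite (Rs x a) (Rs x b) hx.
by rewrite (Rs y a) (Rs y b) hy.
Qed.

Lemma card_classes_join R A a b : equivalence_rel R -> a \in A -> b \in A ->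
  ~~ R a b -> #|classes R A| = #|classes (joinrel R a b) A|.+1.
Proof.
move=> ER aA bA nab; have /equivalence_relP[Rr Rt] := ER.
have Rs := equiv_sym ER.
have EJ := joinrel_equiv a b ER.
rewrite (cardsD1 [set z | R b z]) imset_f //=; congr _.+1.
(* With the class of [b] left out, [g] sends the class of [a] to the merged class and fixes the
   others; this is a bijection onto the classes of the joined relation. *)
pose g C := if C == [set z | R a z] then [set z | joinrel R a b a z] else C.
have gE x : ~~ R b x -> g [set z | R x z] = [set z | joinrel R a b x z].
  move=> nbx; rewrite /g eq_class // ; case: ifP => [xa|nxa].
    by apply/eqP; rewrite eq_class // /joinrel /= (Rs a x) xa.
  by apply/setP => z; rewrite !inE /joinrel /= (Rs a x) nxa (negPf nbx) /= orbF.
have inj : {in classes R A :\ [set z | R b z] &, injective g}.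
  move=> C C' /setD1P[hC /imsetP[x xA EC]] /setD1P[hC' /imsetP[x' x'A EC']].
  move: hC hC'; rewrite {}EC {}EC' !eq_class // ![R _ b]Rs => hx hx'.
  rewrite !gE // => /eqP; rewrite eq_class // /joinrel /= (negPf hx) (negPf hx') !orbF.
  by move=> h; apply/eqP; rewrite eq_class //; case/orP: h => // /andP[/Rt <-].
rewrite -(card_in_imset inj); apply: eq_card => C; apply/imsetP/imsetP.
  case=> D /setD1P[hD /imsetP[x xA ED]] ->; exists x => //.
  by rewrite ED gE // Rs; move: hD; rewrite ED eq_class.
case=> x xA ->; have [bx|nbx] := boolP (R b x).
  exists [set z | R a z]; first by rewrite !inE eq_class // nab imset_f.
  by rewrite gE ?[R b a]Rs //; apply/eqP; rewrite eq_class // /joinrel /= bx Rr !orbT.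
exists [set z | R x z]; last by rewrite gE.
by rewrite !inE eq_class // imset_f // Rs nbx.
Qed.

Lemma eq_classes R R' A : R =2 R' -> classes R A = classes R' A.
Proof. by move=> E; apply: eq_imset => x; apply/setP => y; rewrite !inE E. Qed.
End Classes.

(** * The circles before and after toggling an edge *)

Section ToggleFaces.
Variables (L : link_diagram) (b : checkerboard L).
Local Notation X := (crossing L).
Local Notation dart := (half_arc (crossing L)).
Implicit Types (H : {set X}) (e : X) (d : dart).
Local Notation same_circle := (same_circle b).
Local Notation joined := (joined b).

Lemma same_equiv H : equivalence_rel (same_circle H).
Proof.
apply/equivalence_relP; split=> [d|d d' h z]; first exact: same_refl.
by apply/idP/idP; apply: same_trans; rewrite // same_sym.
Qed.

Lemma same_corner H e (k : 'Z_4) :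
  same_circle H (dart0 e) (inl (e, k)) || same_circle H (dart2 e) (inl (e, k)).
Proof.
have h j : turn b H (inl (e, j)) \in [:: dart0 e; dart2 e] ->
    same_circle H (dart0 e) (inl (e, j)) || same_circle H (dart2 e) (inl (e, j)).
  have := same_turn b H (inl (e, j)); rewrite same_sym.
  by rewrite !inE => + /orP[]/eqP E; rewrite E => ->; rewrite ?orbT.
have Z4 : 1 + 1 + 1 + 1 = 0 :> 'Z_4 by exact: val_inj.
elim/Z4_cases: k; rewrite ?same_refl ?orbT //; apply: h; rewrite /= ?subrr ?addrK ?Z4;
  by case: ifP => _; rewrite !inE eqxx ?orbT.
Qed.

(** By [joined_toggle] all four half-arcs at [e] lie on one circle of the toggled state. Hence every
    turn of [H] at [e] stays within that circle, and no old connection is lost. *)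
Lemma same_toggle H e : ~~ joined H e ->
  same_circle (toggle H e) =2 joinrel (same_circle H) (dart0 e) (dart2 e).
Proof.
move=> nj d d'; have jt : joined (toggle H e) e by rewrite joined_toggle.
have EJ := joinrel_equiv (dart0 e) (dart2 e) (same_equiv H).
have /equivalence_relP[Jr Jt] := EJ.
have corner k : same_circle (toggle H e) (dart0 e) (inl (e, k)).
  by case/orP: (same_corner (toggle H e) e k) => //; apply: same_trans.
have turn_out K c k : c != e -> turn b (toggle K e) (inl (c, k)) = turn b K (inl (c, k)).
  by move=> ce; rewrite /= in_toggle (negPf ce).
have sub z z' : same_circle H z z' -> same_circle (toggle H e) z z'.
  apply: same_circle_sub; [exact: same_refl|exact: same_trans|exact: same_arc|].
  case=> [[c k]|s]; last exact: (same_turn b (toggle H e) (inr s)).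
  have [->|ce] := eqVneq c e; last by rewrite -turn_out //; apply: same_turn.
  apply: (same_trans (y := dart0 e)); first by rewrite same_sym.
  by rewrite /=; case: ifP.
apply/idP/idP.
  apply: same_circle_sub => [z|y x z|z|z].
  - by rewrite Jr.
  - by move=> /Jt ->.
  - by rewrite /joinrel /= same_arc.
  - case: z => [[c k]|s]; last by rewrite /joinrel /= (same_turn b H (inr s)).
    have [->|ce] := eqVneq c e; last by rewrite turn_out // /joinrel /= (same_turn b H (inl (c, k))).
    by rewrite /joinrel /=; case: ifP => _; rewrite !same_corner orbT.
have h z : same_circle H (dart0 e) z || same_circle H (dart2 e) z ->
    same_circle (toggle H e) (dart0 e) z.
  by case/orP => /sub // /(same_trans jt).
case/orP => [/sub //|/andP[/h + /h]]; rewrite same_sym; exact: same_trans.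
Qed.

Lemma facesE H : faces b H = classes (same_circle H) predT.
Proof. by []. Qed.

Lemma card_faces_toggle H e : ~~ joined H e -> #|faces b H| = #|faces b (toggle H e)|.+1.
Proof.
move=> nj; rewrite !facesE (eq_classes _ (same_toggle nj)).
by rewrite -card_classes_join //; exact: same_equiv.
Qed.

Lemma card_faces_toggle_joined H e :
  joined H e -> #|faces b (toggle H e)| = #|faces b H|.+1.
Proof.
move=> j; rewrite -{2}[H](toggleK e) -card_faces_toggle ?joined_toggle ?j //.
Qed.
End ToggleFaces.

(** * Euler's formula *)

Lemma subset_ind (T : finType) (P : {set T} -> Prop) (A : {set T}) :
  P A -> (forall (S : {set T}) x, A \subset S -> x \notin S -> P S -> P (x |: S)) ->
  forall B : {set T}, A \subset B -> P B.
Proof.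
move=> PA Pind B; elim: {B}#|B :\: A| {-2}B (erefl #|B :\: A|) => [|n IH] B hn AB.
  have /eqP := hn; rewrite cards_eq0 setD_eq0 => BA.
  by have -> : B = A by apply/eqP; rewrite eqEsubset BA.
have /card_gt0P[x /setDP[xB xA]] : (0 < #|B :\: A|)%N by rewrite hn.
have AS : A \subset B :\ x by rewrite subsetD1 AB.
rewrite -(setD1K xB); apply: Pind; rewrite ?setD11 //; apply: IH => //.
by move: hn; rewrite (cardsD1 x) inE xA xB setDDl setUC -setDDl => -[].
Qed.

Lemma card_imset_eq_ker (T A B : finType) (f : T -> A) (g : T -> B) :
  (forall x y, (f x == f y) = (g x == g y)) ->
  #|[set f x | x : T]| = #|[set g x | x : T]|.
Proof.
move=> h; suff le (A' B' : finType) (f' : T -> A') (g' : T -> B') :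
    (forall x y, (f' x == f' y) = (g' x == g' y)) ->
    (#|[set g' x | x : T]| <= #|[set f' x | x : T]|)%N.
  by apply/eqP; rewrite eqn_leq !le.
move=> {h} h; have [x0 _|T0] := pickP T; last first.
  rewrite (_ : [set g' x | x : T] = finset.set0) ?cards0 //.
  by apply/setP => y; rewrite inE; apply/imsetP => -[x]; have := T0 x.
pose k a := g' (odflt x0 [pick x | f' x == a]).
have kE x : k (f' x) = g' x.
  rewrite /k; case: pickP => [y|/(_ x)]; last by rewrite eqxx.
  by rewrite h => /eqP.
rewrite -(eq_imset _ kE) imset_comp; exact: leq_imset_card.
Qed.

Lemma Z4_addK (k : 'Z_4) : k + (1 + 1) + (1 + 1) = k.
Proof. by apply: val_inj; elim/Z4_cases: k. Qed.

Lemma Z4_pred (k : 'Z_4) : k + (1 + 1) + 1 = k - 1.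
Proof. by apply: val_inj; elim/Z4_cases: k. Qed.

(** * Black regions and the components of spanning subgraphs *)

Section Regions.
Variables (L : link_diagram) (b : checkerboard L).
Local Notation X := (crossing L).
Local Notation dart := (half_arc (crossing L)).
Implicit Types (H K S : {set X}) (e : X) (d : dart).
Local Notation V := (tait_vertices b).

Definition tait_conn H : rel {set dart} := connect (tait_adj b H).
Definition end1 e := (tait_ends b e).1.
Definition end2 e := (tait_ends b e).2.

(** Exactly one of the two sides of an arc is black; taking that one gives a function of the arc
    rather than of the half-arc. *)
Definition black_region d : {set dart} := if black b d then region d else region (arc d).

Lemma left_next_inj : injective (left_next (@arc L)).
Proof. by move=> d d' /(can_inj (@rot_invK L))/(inv_inj (@arcK L)). Qed.

Lemma mem_region d d' : (d' \in region d) = fconnect (left_next (@arc L)) d d'.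
Proof. by rewrite /region /region_of inE. Qed.

Lemma eq_region d d' : (region d == region d') = fconnect (left_next (@arc L)) d d'.
Proof.
have fs := fconnect_sym left_next_inj.
apply/eqP/idP => [E|h]; first by rewrite -mem_region E mem_region connect0.
apply/setP => z; rewrite !mem_region; apply/idP/idP; last exact: connect_trans.
by apply: connect_trans; rewrite fs.
Qed.

Lemma region_left_next d : region (left_next (@arc L) d) = region d.
Proof. by apply/eqP; rewrite eq_sym eq_region fconnect1. Qed.

Lemma black_region_arc d : black_region (arc d) = black_region d.
Proof. by rewrite /black_region black_arc arcK; case: black. Qed.

Lemma black_region_rot d : black b d -> black_region (rot d) = black_region d.
Proof.
move=> bd; rewrite /black_region black_rot bd /=.
by rewrite -region_left_next /left_next arcK rotK.
Qed.

Lemma black_regionE d : black b d -> black_region d = region d.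
Proof. by rewrite /black_region => ->. Qed.

Lemma black_region_in d : black_region d \in V.
Proof.
by rewrite /black_region; case: ifP => bd; apply: imset_f; rewrite inE ?black_arc ?bd.
Qed.

Lemma mem_verticesP v : reflect (exists2 d, black b d & v = black_region d) (v \in V).
Proof.
by apply: (iffP imsetP) => -[d bd ->]; exists d; move: bd; rewrite ?inE // => bd; rewrite ?black_regionE.
Qed.

Lemma black_corner_black e : black b (inl (e, black_corner b e)).
Proof.
rewrite /black_corner; case: ifP => // h.
by rewrite -[1]add0r black_succ h.
Qed.

Lemma end1E e : end1 e = black_region (inl (e, black_corner b e)).
Proof. by rewrite black_regionE ?black_corner_black. Qed.

Lemma end2E e : end2 e = black_region (inl (e, black_corner b e + (1 + 1))).
Proof.
rewrite black_regionE /end2 /tait_ends //=.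
by rewrite addrA !black_succ negbK black_corner_black.
Qed.

Lemma end1_in e : end1 e \in V. Proof. by rewrite end1E black_region_in. Qed.
Lemma end2_in e : end2 e \in V. Proof. by rewrite end2E black_region_in. Qed.

Lemma black_region_corner e (k : 'Z_4) : black b (inl (e, k)) ->
  (k = black_corner b e \/ k = black_corner b e + (1 + 1)).
Proof.
have b1 : black b (inl (e, 1)) = ~~ black b (inl (e, 0)) by rewrite -black_succ add0r.
rewrite /black_corner; case: ifP => h; elim/Z4_cases: k;
  rewrite ?black_succ ?b1 h //= => _; by [left|right; rewrite ?add0r ?addrA].
Qed.

Lemma tait_conn_sym H : symmetric (tait_conn H).
Proof.
apply: sym_connect_sym => u v /=; apply: eq_existsb => e; congr (_ && _).
by rewrite orbC.
Qed.

Lemma tait_conn_equiv H : equivalence_rel (tait_conn H).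
Proof.
apply/equivalence_relP; split=> [d|d d' h z]; first exact: connect0.
by apply/idP/idP; apply: connect_trans; rewrite // -/(tait_conn H _ _) tait_conn_sym.
Qed.

Lemma tait_conn_trans H : transitive (tait_conn H).
Proof. exact: connect_trans. Qed.

Lemma tait_conn_refl H v : tait_conn H v v.
Proof. exact: connect0. Qed.

Lemma tait_conn_edge H e : e \in H -> tait_conn H (end1 e) (end2 e).
Proof.
move=> eH; apply: connect1 => /=; apply/existsP; exists e.
by rewrite eH /end1 /end2 -surjective_pairing eqxx.
Qed.

Lemma tait_conn_sub H (R : rel {set dart}) : equivalence_rel R ->
  (forall e, e \in H -> R (end1 e) (end2 e)) ->
  forall u v, tait_conn H u v -> R u v.
Proof.
move=> ER; have /equivalence_relP[Rr Rt] := ER => h u v /connectP[p].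
elim: p u => [|y p IH] u /=; first by move=> _ ->; rewrite Rr.
move=> /andP[/existsP[e /andP[eH E]] hp] hl; suff -> : R u v = R y v by exact: IH.
have := h e eH; rewrite /end1 /end2.
case/orP: E => /eqP -> /= /Rt -> //.
Qed.

Lemma tait_connS H K u v : H \subset K -> tait_conn H u v -> tait_conn K u v.
Proof.
move=> /fintype.subsetP HK; apply: tait_conn_sub; first exact: tait_conn_equiv.
by move=> e /HK; exact: tait_conn_edge.
Qed.

Lemma tait_conn_add H e :
  tait_conn (e |: H) =2 joinrel (tait_conn H) (end1 e) (end2 e).
Proof.
move=> u v; apply/idP/idP.
  apply: tait_conn_sub; first exact/joinrel_equiv/tait_conn_equiv.
  move=> f /setU1P[->|fH]; first by rewrite /joinrel !tait_conn_refl !orbT.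
  by rewrite /joinrel tait_conn_edge.
have ee : tait_conn (e |: H) (end1 e) (end2 e) by rewrite tait_conn_edge ?setU11.
have sub x y : tait_conn H x y -> tait_conn (e |: H) x y by apply/tait_connS/subsetU1.
have h z : tait_conn H (end1 e) z || tait_conn H (end2 e) z ->
    tait_conn (e |: H) (end1 e) z.
  by case/orP => /sub // /(tait_conn_trans ee).
case/orP => [/sub //|/andP[/h + /h]]; rewrite tait_conn_sym; exact: tait_conn_trans.
Qed.

Definition ncomps H := #|classes (tait_conn H) (mem V)|.

Lemma ncomps_add H e : ncomps H =
  (ncomps (e |: H) + ~~ tait_conn H (end1 e) (end2 e))%N.
Proof.
rewrite /ncomps (eq_classes _ (tait_conn_add H e)); case: (boolP (tait_conn H (end1 e) (end2 e))) => [c|nc] /=.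
  rewrite addn0; congr #|pred_of_set _|; apply: eq_classes => u v.
  have /equivalence_relP[_ Rt] := tait_conn_equiv H.
  rewrite /joinrel -!(Rt _ _ c) !orbb; case: (boolP (_ && _)); rewrite ?orbF //.
  by case/andP; rewrite tait_conn_sym => /tait_conn_trans h /h ->.
rewrite addn1; apply: card_classes_join; rewrite ?end1_in ?end2_in //.
exact: tait_conn_equiv.
Qed.

Lemma V_neq0 : exists v, v \in V.
Proof. by exists (black_region (inr true)); exact: black_region_in. Qed.

Lemma ncomps_gt0 H : (0 < ncomps H)%N.
Proof.
have [v vV] := V_neq0; apply/card_gt0P; exists [set w | tait_conn H v w].
exact: imset_f.
Qed.

Lemma ncomps1P H : reflect (forall u v, u \in V -> v \in V -> tait_conn H u v)
  (ncomps H == 1%N).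
Proof.
have EC := tait_conn_equiv H.
apply: (iffP cards1P) => [[C EC'] u v uV vV|h].
  have h z : z \in V -> [set w | tait_conn H z w] = C.
    move=> zV; apply/set1P; rewrite -EC'.
    exact: (imset_f (fun z => [set w | tait_conn H z w])).
  by rewrite -(eq_class _ _ EC) !h.
have [v vV] := V_neq0; exists [set w | tait_conn H v w].
have vc : [set w | tait_conn H v w] \in classes (tait_conn H) (mem V) by exact: (imset_f (fun z => [set w | tait_conn H z w])).
apply/eqP; rewrite eqEsubset sub1set vc andbT.
apply/fintype.subsetP => C /imsetP[u uV ->]; apply/set1P/eqP.
by rewrite eq_class // h.
Qed.

Lemma tait_connectedE H : tait_connected b H = (ncomps H == 1%N).
Proof.
apply/forall_inP/ncomps1P => h u; last by move=> uV; apply/forall_inP => v; apply: h.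
by move=> v uV vV; have /forall_inP := h u uV; exact.
Qed.

Lemma ncomps0 : ncomps finset.set0 = #|V|.
Proof.
rewrite /ncomps card_in_imset // => u v _ _ /eqP.
rewrite eq_class; last exact: tait_conn_equiv.
case/connectP => -[|y p] /=; first by [].
by case/andP => /existsP[e]; rewrite inE.
Qed.

Lemma ncompsS H K : H \subset K -> (ncomps K <= ncomps H)%N.
Proof.
move: K; apply: subset_ind => // S e _ _; apply: leq_trans.
by rewrite [X in (_ <= X)%N](ncomps_add S e) leq_addr.
Qed.

Lemma card_vertices_le H : (#|V| <= ncomps H + #|H|)%N.
Proof.
move: H; suff: forall H, finset.set0 \subset H -> (#|V| <= ncomps H + #|H|)%N.
  by move=> h H; apply: h; rewrite sub0set.
apply: subset_ind => [|S e _ eS]; first by rewrite ncomps0 leq_addr.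
rewrite cardsU1 eS [ncomps S](ncomps_add S e); case: tait_conn => /=; lia.
Qed.

(** A circle runs along the boundary of one component of [H]: an arc keeps its black side, and a
    turn at a crossing changes the black region only when the edge of that crossing lies in [H]. *)
Lemma same_circle_conn H d d' : same_circle b H d d' ->
  tait_conn H (black_region d) (black_region d').
Proof.
apply: (@same_circle_sub _ _ _ [rel d d' | tait_conn H (black_region d) (black_region d')]).
- by move=> z; apply: tait_conn_refl.
- by move=> y x z; apply: tait_conn_trans.
- by move=> z /=; rewrite black_region_arc tait_conn_refl.
move=> z /=.
have aux k c : black b (inl (c, k)) -> tait_conn H (black_region (inl (c, k)))
    (black_region (if c \in H then inl (c, k - 1) else inl (c, k + 1))).
  move=> bk; case: ifP => cH; last first.
    by rewrite (@black_region_rot (inl (c, k))) // tait_conn_refl.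
  have <- : rot (inl (c, k + (1 + 1))) = inl (c, k - 1) :> dart by rewrite /= Z4_pred.
  rewrite black_region_rot; last by rewrite addrA !black_succ negbK.
  have := tait_conn_edge cH; rewrite end1E end2E.
  case: (black_region_corner bk) => -> //; rewrite tait_conn_sym.
  by rewrite Z4_addK.
case: z => [[c k]|s] /=; last first.
  have [bs|bs] := boolP (black b (inr s)).
    by rewrite -[inr (~~ s)]/(rot (inr s)) black_region_rot // tait_conn_refl.
  rewrite -[X in black_region (inr X)]negbK -[inr (~~ ~~ s)]/(rot (inr (~~ s))).
  rewrite black_region_rot ?tait_conn_refl //.
  by rewrite -[inr _]/(rot (inr s)) black_rot.
have [bk|bk] := boolP (black b (inl (c, k))) => /=.
  by have := aux k c bk; case: (c \in H).
rewrite tait_conn_sym; case cH: (c \in H).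
  by have := aux (k + 1) c; rewrite cH black_succ addrK; apply.
by have := aux (k - 1) c; rewrite cH black_pred subrK; apply.
Qed.

Lemma tait_conn0 u v : tait_conn finset.set0 u v -> u = v.
Proof. by case/connectP => -[|y p] //= /andP[/existsP[e]]; rewrite inE. Qed.

(** Without edges every turn goes around a black corner, so on black half-arcs [turn] after [arc] is
    [left_next], and each circle bounds one black region. *)
Lemma card_faces0 : #|faces b finset.set0| = #|V|.
Proof.
have h d d' : same_circle b finset.set0 d d' = (black_region d == black_region d').
  apply/idP/eqP => [/same_circle_conn/tait_conn0 //|].
  have key z : exists2 z', black b z' & same_circle b finset.set0 z z' /\
      black_region z = region z'.
    case bz: (black b z); first by exists z; rewrite ?same_refl ?black_regionE.
    by exists (arc z); rewrite ?black_arc ?bz // same_arc /black_region bz.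
  have [z bz [dz ->]] := key d; have [z' bz' [dz' ->]] := key d'.
  move=> /eqP; rewrite eq_region => hz; apply: (same_trans dz).
  rewrite same_sym; apply: (same_trans dz'); rewrite same_sym.
  case/connectP: hz => p; elim: p z bz {dz} => [|y p IH] z bz /=.
    by move=> _ ->; rewrite same_refl.
  case/andP => /eqP zy hp hl.
  have by_ : black b y by rewrite -zy black_left_next.
  apply: same_trans (IH y by_ hp hl); rewrite -zy /left_next.
  apply: same_trans (same_arc _ _ z) _.
  have : black b (arc z) = false by rewrite black_arc bz.
  case: (arc z) => [[c k]|s] bk; last exact: (same_turn b _ (inr s)).
  by have := same_turn b finset.set0 (inl (c, k)); rewrite /= bk inE.
have -> : V = [set black_region d | d : dart].
  apply/setP => v; apply/mem_verticesP/imsetP => -[d]; first by move=> _ ->; exists d.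
  move=> _ ->; case bd: (black b d); first by exists d.
  by exists (arc d); rewrite ?black_arc ?bd // black_region_arc.
apply: card_imset_eq_ker => d d'.
by rewrite -h; apply: (eq_class d d' (same_equiv b finset.set0)).
Qed.
End Regions.

(** * The full edge set and the Euler characteristic *)

Section Euler.
Variables (L : link_diagram) (b : checkerboard L).
Local Notation X := (crossing L).
Local Notation dart := (half_arc (crossing L)).
Implicit Types (H K S : {set X}) (e : X) (d : dart).
Local Notation V := (tait_vertices b).

(** Exchanging the colours turns a state into the one with the complementary edge set. The faces of
    the full edge set are thus the boundaries of the white regions, which [diagram_planar] counts
    together with the black ones. *)
Definition white_checkerboard : checkerboard L :=
  @Checkerboard L (fun d => ~~ black b d)
    (fun d => congr1 negb (black_left_next b d)) (fun d => congr1 negb (black_arc b d)).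

Lemma faces_white : faces white_checkerboard finset.set0 = faces b [set: X].
Proof.
apply: eq_imset => d; apply/setP => d'; rewrite !inE; apply: eq_connect => u v /=.
congr (_ || (_ == _)); case: u => [[c k]|s] //=.
by rewrite !inE addbF addbT.
Qed.

Lemma card_facesT : (#|faces b [set: X]| + #|V|)%N = (#|X| + 2)%N.
Proof.
rewrite -faces_white card_faces0 -diagram_planar.
rewrite -cardsUI [X in (_ + X)%N](_ : _ = 0%N) ?addn0; last first.
  apply/eqP; rewrite cards_eq0 -subset0; apply/fintype.subsetP => v.
  rewrite inE => /andP[/imsetP[d + ->] /imsetP[d' +]].
  rewrite !inE => /negPf bd bd' /eqP; rewrite eq_region => h.
  suff : black b d' = black b d by rewrite bd bd'.
  case/connectP: h => p; elim: p d {bd} => [|y p IH] d /=; first by move=> _ ->.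
  by case/andP=> /eqP <- hp /(IH _ hp) ->; rewrite black_left_next.
apply: eq_card => v; rewrite inE; apply/orP/imsetP.
  by case=> /imsetP[d _ ->]; exists d.
case=> d _ ->; case bd: (black b d); [right|left]; apply: imset_f; by rewrite inE /= bd.
Qed.

Lemma ncompsT : ncomps b [set: X] = 1%N.
Proof.
apply/eqP/ncomps1P => u v /mem_verticesP[d _ ->] /mem_verticesP[d' _ ->].
case/connectP: (diagram_connected d d') => p.
elim: p d => [|y p IH] d /=; first by move=> _ ->; apply: tait_conn_refl.
case/andP => hy hp /(IH _ hp); apply: tait_conn_trans.
case/orP: hy => /eqP ->; first by rewrite black_region_arc tait_conn_refl.
have [bd|bd] := boolP (black b d); first by rewrite black_region_rot ?tait_conn_refl.
case: d bd {hp} => [[c k]|s] bd.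
  apply: (tait_conn_trans (y := black_region b (inl (c, k - 1)))).
    have bk : black b (inl (c, k - 1)) by rewrite black_pred.
    have := black_region_rot bk; rewrite /= subrK => ->; exact: tait_conn_refl.
  have := tait_conn_edge b (finset.in_setT c); rewrite end1E end2E.
  have bk : black b (inl (c, k - 1)) by rewrite black_pred.
  have <- : rot (rot (inl (c, k - 1))) = rot (inl (c, k)) :> dart by rewrite /= subrK.
  rewrite /= -addrA.
  case: (black_region_corner bk) => -> //; rewrite tait_conn_sym.
  by rewrite Z4_addK.
rewrite -[X in black_region b X](@rotK L (inr s)).
rewrite -[rot (inr s)]/(rot_inv (inr s)).
have := black_region_rot (b := b) (d := rot_inv (inr s)); rewrite black_rot_inv => ->//.
exact: tait_conn_refl.
Qed.

Lemma joined_conn H e : joined b H e -> tait_conn b H (end1 b e) (end2 b e).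
Proof.
move=> j; rewrite end1E end2E.
have h k : same_circle b H (dart0 e) (inl (e, k)).
  by case/orP: (same_corner b H e k) => //; apply: same_trans.
by apply: same_circle_conn; apply: same_trans (h _); rewrite same_sym.
Qed.

(* Adding an edge can only decrease [faces + vertices - 2 components - edges];
   planarity says that this quantity is zero on the empty and on the full edge
   set. *)
Lemma euler_step H e : e \notin H ->
  (#|faces b (e |: H)| + #|V| + (2 * ncomps b H + #|H|) <=
   2 * ncomps b (e |: H) + #|e |: H| + (#|faces b H| + #|V|))%N.
Proof.
move=> eH; rewrite cardsU1 eH [ncomps b H](ncomps_add b H e).
have tE : toggle H e = e |: H by rewrite /toggle (negPf eH).
(* The quantity could rise only if [e] split a circle and merged two components at once, which
   [joined_conn] excludes. *)
have [j|nj] := boolP (joined b H e).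
  have := card_faces_toggle_joined j; rewrite tE joined_conn //= => ->; lia.
have := card_faces_toggle nj; rewrite tE => ->; case: tait_conn => /=; lia.
Qed.

Lemma euler H : (#|faces b H| + #|V| = 2 * ncomps b H + #|H|)%N.
Proof.
have mono (A B : {set X}) : A \subset B ->
  (#|faces b B| + #|V| + (2 * ncomps b A + #|A|) <=
   2 * ncomps b B + #|B| + (#|faces b A| + #|V|))%N.
  move: B; apply: subset_ind => [|S e _ eS]; first by rewrite addnC.
  have := euler_step eS; lia.
have h0 := mono finset.set0 H (sub0set H); have h1 := mono H [set: X] (finset.subsetT H).
move: h0 h1; rewrite card_facesT ncompsT cardsT cards0 card_faces0 ncomps0; lia.
Qed.
End Euler.

(** * Spanning trees and exchange *)

Section Trees.
Variables (L : link_diagram) (b : checkerboard L).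
Local Notation X := (crossing L).
Local Notation dart := (half_arc (crossing L)).
Implicit Types (H K S T C P : {set X}) (e f : X).
Local Notation V := (tait_vertices b).
Local Notation conn := (tait_conn b).
Local Notation end1 := (end1 b).
Local Notation end2 := (end2 b).

Lemma tait_degreeU1 P e v : e \notin P ->
  tait_degree b (e |: P) v = (((end1 e == v) + (end2 e == v)) + tait_degree b P v)%N.
Proof. by move=> eP; rewrite /tait_degree big_setU1. Qed.

Lemma tait_degree_gt0 P e v : e \in P -> (end1 e == v) || (end2 e == v) ->
  (0 < tait_degree b P v)%N.
Proof.
move=> eP h; rewrite /tait_degree (bigD1 e) //= -/(end1 e) -/(end2 e).
by case/orP: h => ->; rewrite ?addn1 ?addnS // addSn.
Qed.

(** The degree at [x] counts [x] once as the end and once as the start of a step; closing the path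
    by one more edge then gives degrees 0 and 2. *)
Lemma path_edges S u p : path (tait_adj b S) u p -> uniq (u :: p) ->
  exists P, [/\ P \subset S,
    forall x, tait_degree b P x = ((x \in p) + (x \in belast u p))%N
  & forall e, e \in P -> conn P u (end1 e)].
Proof.
elim: p u => [|y p IH] u /=.
  move=> _ _; exists finset.set0; split; [exact: sub0set| |by move=> e; rewrite inE].
  by move=> x; rewrite /tait_degree big_set0.
case/andP => /existsP[g /andP[gS gE]] hp /and3P[uyp yp up].
have [|P [PS Pd Pc]] := IH y hp; first by rewrite /= yp.
move: uyp; rewrite inE negb_or => /andP[uy unp].
have gP : g \notin P.
  apply/negP => gP; have := @tait_degree_gt0 P g u gP; rewrite Pd.
  have -> : (end1 g == u) || (end2 g == u).
    by rewrite /end1 /end2; case/orP: gE => /eqP -> /=; rewrite eqxx ?orbT.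
  have ub : u \notin belast y p.
    by apply/negP => /mem_belast; rewrite inE (negPf uy) (negPf unp).
  by rewrite (negPf unp) (negPf ub) => /(_ isT).
have ge x : ((end1 g == x) + (end2 g == x) = (x == u) + (x == y))%N.
  rewrite /end1 /end2 ![x == _]eq_sym.
  by case/orP: gE => /eqP -> /=; rewrite // addnC.
exists (g |: P); split.
- by rewrite subUset sub1set gS.
- move=> x; rewrite tait_degreeU1 // Pd ge !inE.
  have ub : u \notin belast y p.
    by apply/negP => /mem_belast; rewrite inE (negPf uy) (negPf unp).
  have [->|xy] := eqVneq x y.
    by rewrite (negPf yp) [y == u]eq_sym (negPf uy).
  have [->|xu] := eqVneq x u; last by [].
  by rewrite (negPf ub) (negPf unp).
have guy : conn (g |: P) u y.
  have := tait_conn_edge b (setU11 g P); rewrite /end1 /end2.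
  by case/orP: gE => /eqP -> //=; rewrite tait_conn_sym.
move=> e /setU1P[->|eP].
  have : (end1 g == u) || (end1 g == y).
    by rewrite /end1; case/orP: gE => /eqP -> /=; rewrite eqxx ?orbT.
  by case/orP => /eqP -> //; apply: tait_conn_refl.
by apply: tait_conn_trans guy _; apply: tait_connS (Pc e eP); apply: subsetU1.
Qed.

Lemma cycle_of_conn S e : e \notin S -> conn S (end1 e) (end2 e) ->
  exists C, [/\ is_cycle b C, e \in C & C \subset e |: S].
Proof.
move=> eS /connectP[p0 hp0 hl0]; case/shortenP: hp0 hl0 => p hp up _ hl.
have [P [PS Pd Pc]] := path_edges hp up.
have eP : e \notin P by apply: contra eS; apply/fintype.subsetP.
exists (e |: P); split; rewrite ?setU11 ?setUS //.
apply/and3P; split.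
- by apply/set0Pn; exists e; rewrite setU11.
- apply/forallP => x; rewrite tait_degreeU1 // Pd hl.
  (* Membership in [p] plus equality with [end1 e], and membership in [belast] plus equality with
     the last vertex, both count [x] on the path, so they are equal and at most 1; the degree is
     their sum. *)
  have := lastI (end1 e) p => E.
  have : count_mem x (end1 e :: p) = count_mem x (rcons (belast (end1 e) p) (last (end1 e) p)).
    by rewrite -E.
  have ub : uniq (rcons (belast (end1 e) p) (last (end1 e) p)) by rewrite -E.
  move: ub; rewrite rcons_uniq -cats1 count_cat /= => /andP[nl ub].
  case/andP: up => ne up.
  rewrite !count_uniq_mem // addn0 => hc.
  have : (count_mem x (end1 e :: p) <= 1)%N by rewrite count_uniq_mem ?leq_b1 //= ne.
  rewrite /= count_uniq_mem //.
  by case: (x \in p) hc; case: (x \in belast _ _); case: (_ == x); case: (_ == x).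
have base f : f \in e |: P -> conn (e |: P) (end1 e) (end1 f).
  move=> /setU1P[->|fP]; first exact: tait_conn_refl.
  by apply: tait_connS (Pc f fP); apply: subsetU1.
apply/forall_inP => f fC; apply/forall_inP => g gC.
have := base g gC; apply: tait_conn_trans; rewrite tait_conn_sym; exact: base.
Qed.

(* Otherwise the degrees in the component of one end of [e] in [C :\ e] would
   add up to an odd number. *)
Lemma cycle_conn C e : is_cycle b C -> e \in C -> conn (C :\ e) (end1 e) (end2 e).
Proof.
move=> /and3P[_ /forallP Cd _] eC; apply/negPn/negP => nc.
pose Z := [set x | conn (C :\ e) (end1 e) x].
have sumZ (F : {set dart} -> nat) : (forall x, ~~ odd (F x)) -> ~~ odd (\sum_(x in Z) F x).
  by move=> hF; elim/big_ind: _ => // x y /negPf hx /negPf hy; rewrite oddD hx hy.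
have h1 : (\sum_(x in Z) tait_degree b (C :\ e) x =
    \sum_(f in C :\ e) ((end1 f \in Z) + (end2 f \in Z)))%N.
  rewrite /tait_degree exchange_big /=; apply: eq_bigr => f _; rewrite big_split /=.
  have sZ z : (\sum_(x in Z) (z == x) = (z \in Z))%N.
    rewrite big_mkcond (bigD1 z) //= eqxx big1 ?addn0; first by case: (z \in Z).
    by move=> y /negPf; rewrite eq_sym => ->; case: ifP.
  by rewrite !sZ.
have h2 : ~~ odd (\sum_(x in Z) tait_degree b (C :\ e) x).
  rewrite h1; elim/big_ind: _ => // [x y /negPf hx /negPf hy|f fC].
    by rewrite oddD hx hy.
  have -> : (end2 f \in Z) = (end1 f \in Z).
    have ff := tait_conn_edge b fC; rewrite !inE.
    apply/idP/idP => h; last exact: tait_conn_trans ff.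
    by apply: tait_conn_trans h _; rewrite tait_conn_sym.
  by rewrite addnn odd_double.
have h3 : (\sum_(x in Z) tait_degree b C x = \sum_(x in Z) tait_degree b (C :\ e) x + 1)%N.
  rewrite -{1}(setD1K eC).
  under eq_bigr => x _ do rewrite tait_degreeU1 ?setD11 // addnC.
  rewrite big_split /=; congr addn.
  rewrite (bigD1 (end1 e)) ?inE ?tait_conn_refl //= eqxx.
  have -> : (end2 e == end1 e) = false.
    by apply/negP => /eqP E; move: nc; rewrite E tait_conn_refl.
  rewrite big1 // => x /andP[xZ /negPf]; rewrite eq_sym => ->.
  by case: eqP => // E; move: nc xZ; rewrite inE E => /negPf ->.
have : ~~ odd (\sum_(x in Z) tait_degree b C x).
  by apply: sumZ => x; case/orP: (Cd x) => /eqP ->.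
by rewrite h3 oddD (negPf h2).
Qed.

Lemma ncomps_forest T : (forall C, C \subset T -> ~~ is_cycle b C) ->
  (ncomps b T + #|T| = #|V|)%N.
Proof.
move=> acyc; suff: forall S, finset.set0 \subset S -> S \subset T ->
    (ncomps b S + #|S| = #|V|)%N by apply; rewrite ?sub0set.
apply: subset_ind => [_|S e _ eS IH eT]; first by rewrite ncomps0 cards0 addn0.
have ST : S \subset T by apply: fintype.subset_trans eT; apply: subsetU1.
have nc : ~~ conn S (end1 e) (end2 e).
  apply/negP => /(cycle_of_conn eS)[C [Cc _ Ce]].
  by move: (acyc C (fintype.subset_trans Ce eT)); rewrite Cc.
by have := IH ST; rewrite (ncomps_add b S e) nc cardsU1 eS; lia.
Qed.

Lemma spanning_tree_count T :
  spanning_tree b T = (ncomps b T == 1%N) && (#|T|.+1 == #|V|).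
Proof.
rewrite /spanning_tree tait_connectedE; case: eqP => //= k1.
apply/forall_inP/eqP => [h|h C CT].
  by have := ncomps_forest h; rewrite k1.
apply/negP => Cc; have /and3P[/set0Pn[e eC] _ _] := Cc.
have eT := fintype.subsetP CT e eC.
have := card_vertices_le b (T :\ e); rewrite (ncomps_add b (T :\ e) e) setD1K // k1.
rewrite (tait_connS _ (cycle_conn Cc eC)) ?setSD //.
by move: h; rewrite (cardsD1 e T) eT /=; lia.
Qed.

(** With [n] components, one face means [|V| = 2 n + |T| - 1] by Euler's formula; since
    [|V| <= n + |T|] and [n >= 1], this forces [n = 1] and [|T| + 1 = |V|]. *)
Lemma spanning_tree_faces T : spanning_tree b T = (#|faces b T| == 1%N).
Proof.
rewrite spanning_tree_count; have := euler b T; have := ncomps_gt0 b T.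
have := card_vertices_le b T; set V' := #|V|; set n := ncomps _ _; set F := #|faces _ _|.
set t := #|T|; move=> h1 h2 h3; apply/idP/idP => [/andP[/eqP ? /eqP ?]|/eqP ?].
  apply/eqP; lia.
apply/andP; split; apply/eqP; lia.
Qed.

Lemma tree_card T T' : spanning_tree b T -> spanning_tree b T' -> #|T| = #|T'|.
Proof.
by rewrite !spanning_tree_count => /andP[_ /eqP h] /andP[_ /eqP h']; apply: succn_inj; rewrite h.
Qed.

(** Written with toggles, the exchange treats an edge of [T] and an edge outside [T] alike, which
    makes internal and external activity one notion. *)
Definition swap T e f := toggle (toggle T e) f.

Lemma card_toggle T e : #|toggle T e| = (if e \in T then #|T|.-1 else #|T|.+1).
Proof.
rewrite /toggle; case: ifP => eT; last by rewrite cardsU1 eT.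
by rewrite [in RHS](cardsD1 e) eT.
Qed.

Lemma card_swap T e f : (e \in T) != (f \in T) -> #|swap T e f| = #|T|.
Proof.
move=> ef; rewrite /swap !card_toggle in_toggle.
have /negPf -> /= : f != e by apply: contraNneq ef => ->.
by move: ef (cardsD1 e T); case: (e \in T); case: (f \in T) => //= _ ->.
Qed.

Lemma swap_opposite T e f : e != f -> spanning_tree b T -> spanning_tree b (swap T e f) ->
  (e \in T) != (f \in T).
Proof.
move=> ef hT hS; have := tree_card hT hS; rewrite /swap !card_toggle in_toggle.
rewrite eq_sym (negPf ef) /=.
have := cardsD1 e T; have := cardsD1 f (T :\ e); rewrite !inE eq_sym ef.
by case: (e \in T); case: (f \in T) => //=; lia.
Qed.

Lemma tree_swap_conn T e f : spanning_tree b T -> (e \in T) != (f \in T) ->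
  spanning_tree b (swap T e f) = (ncomps b (swap T e f) == 1%N).
Proof.
rewrite !spanning_tree_count => /andP[_ /eqP h] ef.
by rewrite card_swap // h eqxx andbT.
Qed.

Lemma swap_add T e f : e \in T -> f \notin T -> swap T e f = f |: (T :\ e).
Proof.
move=> eT fT; rewrite /swap /toggle eT !inE (negPf fT) andbF //.
Qed.

Lemma swap_remove T e f : e \in T -> f \notin T -> swap T f e = f |: (T :\ e).
Proof. by move=> eT fT; rewrite /swap toggleC -/(swap _ _ _) swap_add. Qed.

Lemma tree_acyclic T C : spanning_tree b T -> is_cycle b C -> C \subset T -> False.
Proof.
by move=> /andP[_ /forall_inP h] Cc CT; have := h C CT; rewrite Cc.
Qed.

Lemma tree_conn T u v : spanning_tree b T -> u \in V -> v \in V -> conn T u v.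
Proof.
by rewrite spanning_tree_count => /andP[/ncomps1P h _]; apply: h.
Qed.

Lemma ncomps_remove T e : spanning_tree b T -> e \in T -> ncomps b (T :\ e) = 2%N.
Proof.
move=> hT eT; have := hT; rewrite spanning_tree_count => /andP[/eqP k1 /eqP h].
have := card_vertices_le b (T :\ e); have := ncomps_add b (T :\ e) e.
rewrite setD1K // k1; move: h; rewrite (cardsD1 e) eT.
by case: (conn _ _ _) => /=; lia.
Qed.

Lemma swap_add_tree T e f : spanning_tree b T -> e \in T -> f \notin T ->
  spanning_tree b (swap T e f) = ~~ conn (T :\ e) (end1 f) (end2 f).
Proof.
move=> hT eT fT; rewrite tree_swap_conn ?eT ?(negPf fT) // swap_add //.
have := ncomps_add b (T :\ e) f; rewrite ncomps_remove //.
by case: (conn _ _ _) => /= h; apply/eqP; lia.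
Qed.

(** Apart from [e] itself, both [cut T e] and [cyc T e] consist of the edges whose exchange with [e]
    gives a spanning tree. *)
Lemma liveP (le : rel X) T e : spanning_tree b T -> reflexive le ->
  reflect (forall f, (e \in T) != (f \in T) -> spanning_tree b (swap T e f) -> le e f)
    (live b le T e).
Proof.
move=> hT ler; rewrite /live; have [eT|eT] := boolP (e \in T).
  apply: (iffP forall_inP) => [h f ef hS|h f].
    have fT : f \notin T by move: ef; case: (f \in T).
    apply: h; rewrite inE tait_connectedE.
    by rewrite -swap_add // -tree_swap_conn // eT (negPf fT).
  rewrite inE tait_connectedE; have [-> //|fe] := eqVneq f e.
  have [fT|fT] := boolP (f \in T).
    have -> : f |: T :\ e = T :\ e by apply/setUidPr; rewrite sub1set !inE fe.
    by rewrite ncomps_remove.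
  rewrite -swap_add // -tree_swap_conn ?eT ?(negPf fT) //; exact: h.
apply: (iffP forall_inP) => [h f ef hS|h f].
  have fT : f \in T by move: ef; case: (f \in T).
  move: hS; rewrite swap_remove // => hS.
  have ff : f \notin e |: T :\ f.
    by rewrite !inE eqxx /= orbF; apply: contraNneq eT => <-.
  have [C [Cc fC CS]] := cycle_of_conn ff (tree_conn hS (end1_in b f) (end2_in b f)).
  apply: h; apply/bigcupP; exists C => //; rewrite Cc /=.
  apply: fintype.subset_trans CS _.
  by rewrite setUCA setD1K.
case/bigcupP => C /andP[Cc CS] fC.
have [-> //|fe] := eqVneq f e.
have fT : f \in T by move: (fintype.subsetP CS f fC); rewrite !inE (negPf fe).
apply: h; first by rewrite fT.
rewrite tree_swap_conn ?fT ?(negPf eT) // swap_remove //.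
have c : conn (e |: T :\ f) (end1 f) (end2 f).
  apply: tait_connS (cycle_conn Cc fC).
  apply/fintype.subsetP => g; rewrite !inE => /andP[gf /(fintype.subsetP CS)].
  by rewrite !inE gf.
have := ncomps_add b (e |: T :\ f) f; rewrite c addn0 => ->.
rewrite setUCA setD1K //.
have := ncompsS b (subsetU1 e T); have := ncomps_gt0 b (e |: T).
by have := hT; rewrite spanning_tree_count => /andP[/eqP -> _]; rewrite eqn_leq => -> ->.
Qed.

(** If [e] is in [T], some edge of the connected [T'] joins the two components of [T :\ e].
    Otherwise the cycle closed by [e] in [T] is not contained in the acyclic [T'], and [f] is an
    edge of it outside [T']. *)
Lemma tree_exchange T T' e : spanning_tree b T -> spanning_tree b T' ->
  (e \in T) != (e \in T') ->
  exists f, [/\ (f \in T) != (f \in T'), (e \in T) != (f \in T) & spanning_tree b (swap T e f)].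
Proof.
move=> hT hT'; have [eT eT'|eT eT'] := boolP (e \in T).
  have [f fT' nc] : exists2 f, f \in T' & ~~ conn (T :\ e) (end1 f) (end2 f).
    apply/exists_inP; rewrite -negb_forall_in; apply/negP => /forall_inP h.
    have : ncomps b (T :\ e) == 1%N.
      apply/ncomps1P => u v uV vV.
      by apply: tait_conn_sub (tree_conn hT' uV vV) => //; exact: tait_conn_equiv.
    by rewrite ncomps_remove.
  have fT : f \notin T.
    apply/negP => fT; have fe : f == e; last by move: eT'; rewrite -(eqP fe) fT'.
    by apply: contraR nc => fe; apply: tait_conn_edge; rewrite !inE fe.
  by exists f; rewrite fT' (negPf fT) swap_add_tree.
have {}eT' : e \in T' by move: eT'; case: (e \in T').
have [C [Cc eC CS]] := cycle_of_conn eT (tree_conn hT (end1_in b e) (end2_in b e)).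
have [f fC fT'] : exists2 f, f \in C & f \notin T'.
  by apply/exists_inP; rewrite -negb_forall_in; apply/negP => /forall_inP /fintype.subsetP/(tree_acyclic hT' Cc).
have fe : f != e by apply: contraNneq fT' => ->.
have fT : f \in T by move: (fintype.subsetP CS f fC); rewrite !inE (negPf fe).
exists f; rewrite fT (negPf fT') swap_remove //; split => //.
have c : conn (e |: T :\ f) (end1 f) (end2 f).
  apply: tait_connS (cycle_conn Cc fC).
  apply/fintype.subsetP => g; rewrite !inE => /andP[gf /(fintype.subsetP CS)].
  by rewrite !inE gf.
rewrite -swap_remove // tree_swap_conn ?fT ?(negPf eT) // swap_remove //.
have := ncomps_add b (e |: T :\ f) f; rewrite c addn0 => ->.
rewrite setUCA setD1K //.
have := ncompsS b (subsetU1 e T); have := ncomps_gt0 b (e |: T).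
by have := hT; rewrite spanning_tree_count => /andP[/eqP -> _]; rewrite eqn_leq => -> ->.
Qed.
End Trees.

(** * The Khovanov differential *)

Section Labels.
Variables (L : link_diagram) (b : checkerboard L).
Local Notation X := (crossing L).
Local Notation dart := (half_arc (crossing L)).
Implicit Types (H K : {set X}) (e f : X) (d : dart) (s : seq dart) (c : enhanced b).
Local Notation same := (same_circle b).
Local Notation joined := (joined b).

(** Labels read off at half-arcs allow generators with different faces to be compared point by
    point. *)
Definition lab c d : bool := label c (circle b (sub c) d).

Lemma lab_same c d d' : same (sub c) d d' -> lab c d = lab c d'.
Proof. by rewrite -eq_circle /lab => /eqP ->. Qed.

Lemma enhanced_ext c c' : sub c = sub c' -> lab c =1 lab c' -> c = c'.
Proof.
move=> E h; apply: val_inj; rewrite [val c]surjective_pairing [val c']surjective_pairing.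
congr (_, _) => //; apply/setP => C.
have sO (x : enhanced b) : (val x).2 \subset faces b (sub x) by exact: (valP x).
have [/imsetP[d _ ->]|nC] := boolP (C \in faces b (sub c)).
  by have := h d; rewrite /lab /label /ones -E.
transitivity false; [|apply/esym]; apply/negbTE; apply: contra nC.
  exact: (fintype.subsetP (sO c)).
by rewrite E; exact: (fintype.subsetP (sO c')).
Qed.

Lemma mk_enhanced_subproof H (p : pred dart) :
  [set circle b H d | d : dart & p d] \subset faces b H.
Proof. by apply/fintype.subsetP => C /imsetP[d _ ->]; exact: circle_in_faces. Qed.

Definition mk_enhanced H (p : pred dart) : enhanced b :=
  exist _ (H, [set circle b H d | d : dart & p d]) (mk_enhanced_subproof H p).

Lemma lab_mk H (p : pred dart) : (forall d d', same H d d' -> p d = p d') ->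
  lab (mk_enhanced H p) =1 p.
Proof.
move=> hp d; apply/imsetP/idP => [[d' pd' /eqP]|pd]; last by exists d; rewrite ?inE.
rewrite eq_circle => /hp ->; by move: pd'; rewrite inE.
Qed.

Definition at_crossing H e d := same H (dart0 e) d || same H (dart2 e) d.

Lemma same_sub_toggle H e d d' : ~~ joined H e -> same H d d' -> same (toggle H e) d d'.
Proof. by move=> nj h; rewrite same_toggle // /joinrel h. Qed.

Lemma circle_toggle_at H e d : ~~ joined H e -> at_crossing H e d ->
  circle b H d \notin faces b (toggle H e) /\ 
  circle b (toggle H e) d = circle b (toggle H e) (dart0 e).
Proof.
move=> nj h; have jt : joined (toggle H e) e by rewrite joined_toggle.
have d0 : same (toggle H e) d (dart0 e).
  rewrite same_sym; case/orP: h => /(same_sub_toggle nj) //; exact: same_trans.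
split; last by apply/eqP; rewrite eq_circle.
apply/negP => /imsetP[z _ E].
have dz : same (toggle H e) z d by rewrite -mem_circle -E mem_circle same_refl.
have h0 : dart0 e \in circle b (toggle H e) z by rewrite mem_circle (same_trans dz).
have h2 : dart2 e \in circle b (toggle H e) z.
  by rewrite mem_circle (same_trans dz) // (same_trans d0).
case/negP: nj; rewrite -E !mem_circle in h0 h2.
by apply: same_trans h2; rewrite same_sym.
Qed.

Lemma circle_toggle_out H e d : ~~ joined H e -> ~~ at_crossing H e d ->
  circle b (toggle H e) d = circle b H d.
Proof.
move=> nj /negPf h; apply/setP => z; rewrite !mem_circle same_toggle // /joinrel.
by rewrite -/(at_crossing H e d) h orbF.
Qed.

Lemma at_crossing_toggle H e d : ~~ joined H e ->
  same (toggle H e) (dart0 e) d = at_crossing H e d.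
Proof.
move=> nj; rewrite same_toggle // /joinrel same_refl /= -/(at_crossing H e d).
by rewrite /at_crossing; case: (same H _ d).
Qed.

Lemma faces_setD H e : ~~ joined H e ->
  faces b H :\: faces b (toggle H e) = [set circle b H (dart0 e); circle b H (dart2 e)].
Proof.
move=> nj; apply/setP => C; rewrite !inE; apply/andP/orP.
  move=> [nC /imsetP[d _ E]]; move: nC; rewrite {C}E !eq_circle ![same H d _]same_sym.
  have [h|h] := boolP (at_crossing H e d); first by move=> _; apply/orP.
  by rewrite -(circle_toggle_out nj h) circle_in_faces.
have h0 : at_crossing H e (dart0 e) by rewrite /at_crossing same_refl.
have h2 : at_crossing H e (dart2 e) by rewrite /at_crossing same_refl orbT.
by case=> /eqP ->; rewrite circle_in_faces; split=> //;
  [case: (circle_toggle_at nj h0)|case: (circle_toggle_at nj h2)].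
Qed.

Lemma faces_setD_joined H e : ~~ joined H e ->
  faces b (toggle H e) :\: faces b H = [set circle b (toggle H e) (dart0 e)].
Proof.
move=> nj; apply/setP => C; rewrite !inE; apply/andP/eqP.
  move=> [nC /imsetP[d _ E]]; move: nC; rewrite {C}E.
  have [h|h] := boolP (at_crossing H e d); last by rewrite circle_toggle_out // circle_in_faces.
  by case: (circle_toggle_at nj h).
move=> ->; rewrite circle_in_faces; split=> //; apply/imsetP => -[z _ E].
have h0 : dart0 e \in circle b H z by rewrite -E mem_circle same_refl.
have h2 : dart2 e \in circle b H z by rewrite -E mem_circle -/(joined _ e) joined_toggle.
case/negP: nj; rewrite !mem_circle in h0 h2.
by apply: same_trans h2; rewrite same_sym.
Qed.

Lemma faces_setI_P H e (P : {set dart} -> bool) : ~~ joined H e ->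
  [forall C in faces b H :&: faces b (toggle H e), P C] =
  [forall d, ~~ at_crossing H e d ==> P (circle b H d)].
Proof.
move=> nj; apply/forall_inP/forallP => [h d|h C].
  apply/implyP => hd; apply: h.
  by rewrite inE circle_in_faces -(circle_toggle_out nj hd) circle_in_faces.
rewrite inE => /andP[/imsetP[d _ ->] hd]; have /implyP := h d; apply.
by apply/negP => /(circle_toggle_at nj)[]; rewrite hd.
Qed.

Lemma set2_eq (T : finType) (x y x' y' : T) : x != y -> x' != y' ->
  ([set x; y] == [set x'; y']) = (x == x') && (y == y') || (x == y') && (y == x').
Proof.
move=> xy xy'; apply/eqP/orP => [E|[]/andP[/eqP -> /eqP ->] //]; last by rewrite setUC.
have := set21 x y; have := set22 x y; rewrite E !inE.
case/orP => /eqP ? /orP[]/eqP ?; subst; rewrite ?eqxx in xy * ; auto.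
Qed.

Lemma set1_set2 (T : finType) (x x' y' : T) : x' != y' -> ([set x] == [set x'; y']) = false.
Proof.
move=> xy; apply/eqP => E; have := cards2 x' y'; by rewrite -E cards1 xy.
Qed.

Lemma merge_labelC p q : merge_label p q = merge_label q p.
Proof. by case: p; case: q. Qed.

Lemma edge_map_merge c c' e : sub c' = toggle (sub c) e -> ~~ joined (sub c) e ->
  edge_map c c' =
  [forall d, ~~ at_crossing (sub c) e d ==> (lab c' d == lab c d)] &&
  (merge_label (lab c (dart0 e)) (lab c (dart2 e)) == Some (lab c' (dart0 e))).
Proof.
move=> E nj; rewrite /edge_map /= E faces_setI_P // faces_setD // faces_setD_joined //.
have ne : circle b (sub c) (dart0 e) != circle b (sub c) (dart2 e) by rewrite eq_circle.
congr (_ && _).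
  apply: eq_forallb => d; case: (boolP (at_crossing _ _ _)) => //= hd.
  by rewrite /lab E (circle_toggle_out nj hd).
rewrite [X in _ || X](_ : _ = false) ?orbF; last first.
  apply/negbTE/existsPn => f; apply/existsPn => f1; apply/existsPn => f2.
  by apply/negP => /and4P[_ /eqP/esym/eqP]; rewrite set1_set2.
apply/existsP/eqP => [[f1 /existsP[f2 /existsP[f /and4P[nf]]]]|h].
  rewrite set2_eq // => + /eqP/set1_inj <- /eqP.
  case/orP => /andP[/eqP <- /eqP <-]; rewrite /lab E // => <-; exact: merge_labelC.
exists (circle b (sub c) (dart0 e)); apply/existsP; exists (circle b (sub c) (dart2 e)).
apply/existsP; exists (circle b (toggle (sub c) e) (dart0 e)).
by rewrite ne !eqxx /=; move: h; rewrite /lab E => ->.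
Qed.

Lemma edge_map_split c c' e : sub c' = toggle (sub c) e -> joined (sub c) e ->
  edge_map c c' =
  [forall d, ~~ at_crossing (sub c') e d ==> (lab c' d == lab c d)] &&
  ((lab c' (dart0 e), lab c' (dart2 e)) \in split_label (lab c (dart0 e))).
Proof.
move=> E j; have nj : ~~ joined (sub c') e by rewrite E joined_toggle j.
have E' : sub c = toggle (sub c') e by rewrite E toggleK.
have FE : faces b (sub c) = faces b (toggle (sub c') e) by rewrite -E'.
rewrite /edge_map /= FE setIC faces_setI_P // ?faces_setD // ?faces_setD_joined //.
have ne : circle b (sub c') (dart0 e) != circle b (sub c') (dart2 e) by rewrite eq_circle.
congr (_ && _).
  apply: eq_forallb => d; case: (boolP (at_crossing _ _ _)) => //= hd.
  by rewrite /lab E' (circle_toggle_out nj hd).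
rewrite [X in X || _](_ : _ = false) /=; last first.
  apply/negbTE/existsPn => f; apply/existsPn => f1; apply/existsPn => f2.
  by apply/negP => /and4P[nf + _ _]; rewrite set1_set2.
have symm p q r : ((p, q) \in split_label r) = ((q, p) \in split_label r).
  by case: p; case: q; case: r.
apply/existsP/idP => [[f /existsP[f1 /existsP[f2 /and4P[nf]]]]|h].
  move=> /eqP/set1_inj <-; rewrite set2_eq //.
  by case/orP => /andP[/eqP <- /eqP <-]; rewrite /lab E' // symm.
exists (circle b (toggle (sub c') e) (dart0 e)).
apply/existsP; exists (circle b (sub c') (dart0 e)).
apply/existsP; exists (circle b (sub c') (dart2 e)).
by rewrite ne !eqxx /=; move: h; rewrite /lab E'.
Qed.

Lemma toggle_inj H e f : toggle H e = toggle H f -> e = f.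
Proof.
move/setP/(_ e); rewrite !in_toggle eqxx; case: eqP => //= _.
by case: (e \in H).
Qed.
End Labels.

(** * Generators as monomials, and the order of two toggles *)

Section Monomials.
Variables (L : link_diagram) (b : checkerboard L).
Local Notation X := (crossing L).
Local Notation dart := (half_arc (crossing L)).
Implicit Types (H K : {set X}) (e f : X) (d : dart) (s : seq dart) (c : enhanced b).
Local Notation same := (same_circle b).
Local Notation joined := (joined b).

Definition indep H s : bool := pairwise (fun d d' => ~~ same H d d') s.
Arguments indep : simpl never.
Definition untouched H s : pred dart := fun d => ~~ has (same H d) s.

(* [monomial H s c] is the coefficient of [c] in the product of the variables
   [x_d], [d] in [s], in the ring generated by one variable for each half-arc
   with [x_d = x_d'] if [d] and [d'] lie on the same circle of [H] and with
   [x_d ^ 2 = 0].  Merges are quotient maps between such rings, and splits are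
   multiplications by a sum of two variables. *)
Definition monomial H s c : bool :=
  [&& indep H s, sub c == H & [forall d, lab c d == untouched H s d]].

Definition edge_coef e c c' : bool := (sub c' == toggle (sub c) e) && edge_map c c'.

Lemma untouched_same H s d d' : same H d d' -> untouched H s d = untouched H s d'.
Proof.
move=> h; have /equivalence_relP[_ Rt] := same_equiv b H.
by rewrite /untouched (eq_has (Rt _ _ h)).
Qed.

Definition mk_monomial H s := mk_enhanced b H (untouched H s).

Lemma monomialE H s c : monomial H s c = indep H s && (c == mk_monomial H s).
Proof.
have labm : lab (mk_monomial H s) =1 untouched H s.
  by apply: lab_mk => d d'; exact: untouched_same.
rewrite /monomial; congr (_ && _); apply/andP/eqP => [[/eqP E /forallP h]|->].
  by apply: enhanced_ext => [//|d]; rewrite labm; apply/eqP.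
by split=> //; apply/forallP => d; rewrite labm.
Qed.

Lemma sum_monomial H s (F : enhanced b -> nat) :
  (\sum_c monomial H s c * F c = indep H s * F (mk_monomial H s))%N.
Proof.
rewrite (bigD1 (mk_monomial H s)) //= monomialE eqxx andbT big1 ?addn0 //.
by move=> c /negPf nc; rewrite monomialE nc andbF.
Qed.

Lemma has_toggle H e s d : ~~ joined H e ->
  has (same (toggle H e) d) s =
  has (same H d) s || at_crossing b H e d && has (at_crossing b H e) s.
Proof.
move=> nj; elim: s => [|x s IH] /=; first by rewrite andbF.
rewrite IH same_toggle // /joinrel -/(at_crossing b H e d) -/(at_crossing b H e x).
by do 2!case: (at_crossing _ _ _ _); do 2!case: (has _ _); case: (same _ _ _).
Qed.

Lemma has_at_crossing H e s :
  has (at_crossing b H e) s = has (same H (dart0 e)) s || has (same H (dart2 e)) s.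
Proof. by rewrite -has_predU. Qed.

Lemma indep_cons H d s : indep H (d :: s) = ~~ has (same H d) s && indep H s.
Proof. by rewrite /indep /=; congr (_ && _); exact: all_predC. Qed.

Lemma indep_toggle H e s : ~~ joined H e ->
  indep (toggle H e) s =
  indep H s && ~~ (has (same H (dart0 e)) s && has (same H (dart2 e)) s).
Proof.
move=> nj; elim: s => [//|x s IH]; rewrite !indep_cons {}IH has_toggle // has_at_crossing.
have /equivalence_relP[_ Rt] := same_equiv b H.
rewrite /= /at_crossing; case h0 : (same H (dart0 e) x); case h2 : (same H (dart2 e) x) => /=.
- by case/negP: nj; apply: same_trans h0 _; rewrite same_sym.
- rewrite -(eq_has (Rt _ _ h0)).
  by do 2!case: (has _ s); case: (indep H s).
- rewrite -(eq_has (Rt _ _ h2)).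
  by do 2!case: (has _ s); case: (indep H s).
- by rewrite orbF andbA.
Qed.

Lemma monomial_merge H e s c : ~~ joined H e ->
  (\sum_c0 monomial H s c0 * edge_coef e c0 c = monomial (toggle H e) s c)%N.
Proof.
move=> nj; rewrite sum_monomial; set c0 := mk_monomial H s.
have labm : lab c0 =1 untouched H s by apply: lab_mk => d d'; exact: untouched_same.
rewrite /edge_coef /monomial; have sH : sub c0 = H by [].
case: eqP => [Ec|] /=; last by rewrite muln0 !andbF.
rewrite (edge_map_merge (e := e)) // sH !labm mulnb; congr nat_of_bool.
rewrite indep_toggle //; case: (indep H s) => //=.
have uE d : untouched (toggle H e) s d = untouched H s d &&
   ~~ (at_crossing b H e d && has (at_crossing b H e) s).
  by rewrite /untouched has_toggle // negb_or.
have u0 : untouched (toggle H e) s (dart0 e) =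
    ~~ has (same H (dart0 e)) s && ~~ has (same H (dart2 e)) s.
  rewrite uE /at_crossing same_refl /= -/(at_crossing b H e) has_at_crossing negb_or.
  by rewrite /untouched; case: (has _ s).
have -> : (merge_label (untouched H s (dart0 e)) (untouched H s (dart2 e)) ==
   Some (lab c (dart0 e))) =
   ~~ (has (same H (dart0 e)) s && has (same H (dart2 e)) s) &&
   (lab c (dart0 e) == untouched (toggle H e) s (dart0 e)).
  rewrite u0 /untouched; case: (has _ s); case: (has _ s); case: (lab _ _) => //.
rewrite andbCA; congr (_ && _).
apply/andP/forallP => [[/forallP h0 /eqP h1] d|h].
  have [hd|hd] := boolP (at_crossing b H e d).
    have hd' : same (toggle H e) (dart0 e) d by rewrite at_crossing_toggle.
    by rewrite -(untouched_same s hd') -h1 (@lab_same _ _ c _ (dart0 e)) // Ec same_sym.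
  by have := h0 d; rewrite hd /= labm uE (negPf hd) andbT.
split=> //; apply/forallP => d; apply/implyP => hd.
by rewrite labm (eqP (h d)) uE (negPf hd) andbT.
Qed.

(** If [s] has no variable on the split circle, the two terms are those of [Delta(1)]. If it has
    one, it is on one of the two new circles: the product with the variable of that circle vanishes
    and the other is the single term of [Delta(x)]. *)
Lemma monomial_split H e s c : joined H e ->
  (\sum_c0 monomial H s c0 * edge_coef e c0 c =
   monomial (toggle H e) (dart0 e :: s) c + monomial (toggle H e) (dart2 e :: s) c)%N.
Proof.
move=> j; rewrite sum_monomial; set c0 := mk_monomial H s.
have labm : lab c0 =1 untouched H s by apply: lab_mk => d d'; exact: untouched_same.
rewrite /edge_coef /monomial; have sH : sub c0 = H by [].
case: eqP => [Ec|] /=; last by rewrite muln0 !andbF.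
set K := toggle H e in Ec *; have KH : H = toggle K e by rewrite toggleK.
have nj : ~~ joined K e by rewrite joined_toggle j.
rewrite (edge_map_split (e := e)) // labm mulnb.
rewrite !indep_cons [X in indep X]KH indep_toggle //.
have uE d : untouched H s d = untouched K s d &&
   ~~ (at_crossing b K e d && has (at_crossing b K e) s).
  by rewrite /untouched KH has_toggle // negb_or.
have u0 : untouched H s (dart0 e) =
    ~~ has (same K (dart0 e)) s && ~~ has (same K (dart2 e)) s.
  rewrite uE /at_crossing same_refl /= -/(at_crossing b K e) has_at_crossing negb_or.
  by rewrite /untouched; case: (has _ s).
have n02 : same K (dart0 e) (dart2 e) = false by apply/negbTE.
have n20 : same K (dart2 e) (dart0 e) = false by rewrite same_sym.
pose P := [forall d, ~~ at_crossing b K e d ==> (lab c d == untouched K s d)].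
have condE d1 : (d1 = dart0 e \/ d1 = dart2 e) ->
  [forall d, lab c d == untouched K (d1 :: s) d] =
  [&& P, lab c (dart0 e) == untouched K (d1 :: s) (dart0 e) &
     lab c (dart2 e) == untouched K (d1 :: s) (dart2 e)].
  move=> hd1; apply/forallP/and3P => [h|[/forallP h0 /eqP h1 /eqP h2] d].
    split=> //; apply/forallP => d; apply/implyP => hd; rewrite (eqP (h d)).
    rewrite /untouched /=; have -> // : same K d d1 = false.
    by apply: contraNF hd; rewrite same_sym /at_crossing; case: hd1 => -> ->; rewrite ?orbT.
  have [/orP[] hd|hd] := boolP (at_crossing b K e d).
  - by rewrite -(untouched_same _ hd) -h1 (@lab_same _ _ c _ (dart0 e)) // Ec same_sym.
  - by rewrite -(untouched_same _ hd) -h2 (@lab_same _ _ c _ (dart2 e)) // Ec same_sym.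
  have := h0 d; rewrite hd /= => /eqP ->; rewrite /untouched /=.
  have -> // : same K d d1 = false.
  by apply: contraNF hd; rewrite same_sym /at_crossing; case: hd1 => -> ->; rewrite ?orbT.
rewrite !condE; [|by right|by left].
have -> : [forall d, ~~ at_crossing b (sub c) e d ==> (lab c d == lab c0 d)] = P.
  rewrite Ec; apply: eq_forallb => d; case hd: (at_crossing b K e d) => //=.
  by rewrite labm uE hd andbT.
rewrite u0 /untouched /= !same_refl n02 n20 /=.
move: (P) => p; case: (indep K s); case: p => //=; rewrite ?andbF //.
case: (has _ s); case: (has _ s); case: (lab c (dart0 e)); by case: (lab c (dart2 e)).
Qed.

Lemma monomial_swap H d d' s c : monomial H (d :: d' :: s) c = monomial H (d' :: d :: s) c.
Proof.
rewrite /monomial !indep_cons /= [same H d' d]same_sym !negb_or.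
have -> : [forall z, lab c z == untouched H (d :: d' :: s) z] =
          [forall z, lab c z == untouched H (d' :: d :: s) z].
  by apply: eq_forallb => z; rewrite /untouched /= orbCA.
congr (_ && _); by case: (same H d d'); do 2!case: (has _ s); case: indep.
Qed.

Lemma monomial_same H d d' s c : same H d d' -> monomial H (d :: s) c = monomial H (d' :: s) c.
Proof.
move=> h; have /equivalence_relP[_ Rt] := same_equiv b H.
rewrite /monomial !indep_cons (eq_has (Rt _ _ h)); congr [&& _, _ & _].
apply: eq_forallb => z; rewrite /untouched /=.
by rewrite ![same H z _]same_sym (Rt _ _ h).
Qed.

(** One variable is taken for each circle labelled x, at the canonical root of its connectivity
    class. *)
Lemma monomial_surj c : exists s, monomial (sub c) s =1 pred1 c.
Proof.
pose E := [rel u v | (v == arc u) || (v == turn b (sub c) u)] : rel dart.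
have sE : connect_sym E by move=> x y; exact: (same_sym b (sub c)).
pose s := [seq d <- enum dart | ~~ lab c d && (d == fingraph.root E d)].
have hasE d : untouched (sub c) s d = lab c d.
  apply/hasPn/idP => [h|h x].
    apply/negPn/negP => nl; have hr : same (sub c) d (fingraph.root E d) by exact: connect_root.
    have := h (fingraph.root E d); rewrite mem_filter mem_enum -(lab_same hr) nl root_root // eqxx.
    by rewrite hr => /(_ isT).
  rewrite mem_filter => /andP[/andP[nl _] _]; apply: contraNN nl => dx.
  by rewrite -(lab_same dx).
have ind : indep (sub c) s.
  rewrite /indep; apply/(pairwiseP (inr true : dart)) => i j hi hj ij.
  apply/negP => h; have us : uniq s by rewrite filter_uniq // enum_uniq.
  have := mem_nth (inr true) hi; have := mem_nth (inr true) hj.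
  rewrite !mem_filter => /andP[/andP[_ /eqP rj] _] /andP[/andP[_ /eqP ri] _].
  have : nth (inr true) s i == nth (inr true) s j.
    by rewrite ri rj (fingraph.root_connect sE).
  by rewrite nth_uniq // ltn_eqF.
exists s => c'; rewrite monomialE ind /=; congr (_ == _).
apply: enhanced_ext => // d; rewrite lab_mk => [|x y]; last exact: untouched_same.
by rewrite hasE.
Qed.

Definition double_coef e f c c' : nat := \sum_c1 edge_coef e c c1 * edge_coef f c1 c'.

Lemma joined_separated K f x y : ~~ joined K f -> same (toggle K f) x y -> ~~ same K x y ->
  same K x (dart0 f) && same K y (dart2 f) || same K x (dart2 f) && same K y (dart0 f).
Proof.
move=> nj; rewrite same_toggle // /joinrel => /orP[->//|]; rewrite ![same K _ (dart0 f)]same_sym.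
rewrite ![same K _ (dart2 f)]same_sym.
case/andP => /orP[] hx /orP[] hy nxy; rewrite ?hx ?hy ?orbT //;
  by case/negP: nxy; rewrite same_sym in hx; apply: same_trans hx _.
Qed.

(** Here [h] and [k] are the numbers of circles before and after both toggles, [f] and [g] those in
    between for the two orders, and a bit is set when its toggle splits. The number of splits is
    therefore the same in both orders. *)
Lemma double_toggle_parity (x1 x2 y1 y2 : bool) (h f g k : nat) :
  (k + ~~ y2 = g + y2)%N -> (g + ~~ y1 = h + y1)%N ->
  (k + ~~ x2 = f + x2)%N -> (f + ~~ x1 = h + x1)%N ->
  (x1 (+) x2 = y1 (+) y2) /\ (x1 && x2 = y1 && y2).
Proof. by case: x1; case: x2; case: y1; case: y2 => //=; lia. Qed.

(** Applied to a monomial, a split at [e] multiplies by the sum of the variables of [dart0 e] and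
    [dart2 e], and such multiplications commute. If the only split occurs at [e] in one order and at
    [f] in the other, the half-arcs of [e] and [f] pair up on circles of the final state, so the two
    sums of variables agree. *)
Lemma double_coefC e f c c' : e != f -> double_coef e f c c' = double_coef f e c c'.
Proof.
move=> ef; have [s hs] := monomial_surj c; pose H := sub c.
have dE g h : double_coef g h c c' =
    (\sum_c1 (\sum_c0 monomial H s c0 * edge_coef g c0 c1) * edge_coef h c1 c')%N.
  apply: eq_bigr => c1 _; congr muln.
  rewrite (bigD1 c) //= hs /= eqxx mul1n big1 ?addn0 // => i /negPf ni.
  by rewrite hs /= ni.
pose M g h := (if joined H g then
   \sum_c1 (monomial (toggle H g) (dart0 g :: s) c1 * edge_coef h c1 c') +
   \sum_c1 (monomial (toggle H g) (dart2 g :: s) c1 * edge_coef h c1 c')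
  else \sum_c1 monomial (toggle H g) s c1 * edge_coef h c1 c')%N.
have dM g h : double_coef g h c c' = M g h.
  rewrite dE /M; case: ifPn => hg.
    by rewrite -big_split; apply: eq_bigr => c1 _; rewrite monomial_split // mulnDl.
  by apply: eq_bigr => c1 _; rewrite monomial_merge.
rewrite !dM /M; set He := toggle H e; set Hf := toggle H f.
have Hef : toggle Hf e = toggle He f by rewrite toggleC.
have cnt K g : (#|faces b (toggle K g)| + ~~ joined K g = #|faces b K| + joined K g)%N.
  have [jg|jg] := boolP (joined K g); last by rewrite (card_faces_toggle jg) addn0 addn1.
  by rewrite addn0 addn1 card_faces_toggle_joined.
have par : joined H e (+) joined He f = joined H f (+) joined Hf e /\
    joined H e && joined He f = joined H f && joined Hf e.
  have := cnt H e; have := cnt He f; have := cnt H f; have := cnt Hf e.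
  rewrite Hef -/He -/Hf; exact: double_toggle_parity.
set H2 := toggle He f.
have sub2 g K x y : ~~ joined K g -> same K x y -> same (toggle K g) x y.
  exact: same_sub_toggle.
case je : (joined H e); case jf : (joined H f); move: par; rewrite je jf;
  case je2 : (joined He f); case jf2 : (joined Hf e) => -[] //= _ _;
  rewrite ?(monomial_split _ _ je2) ?(monomial_split _ _ jf2)
    ?(monomial_merge _ _ (negbT je2)) ?(monomial_merge _ _ (negbT jf2)) ?Hef -/H2 //.

- rewrite [monomial _ (dart0 f :: dart0 e :: _) _]monomial_swap.
  rewrite [monomial _ (dart2 f :: dart0 e :: _) _]monomial_swap.
  rewrite [monomial _ (dart0 f :: dart2 e :: _) _]monomial_swap.
  by rewrite [monomial _ (dart2 f :: dart2 e :: _) _]monomial_swap addnACA.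
- have nje : ~~ joined He e by rewrite joined_toggle je.
  have jf' : same (toggle He e) (dart0 f) (dart2 f) by rewrite toggleK; exact: jf.
  have jH2 : same H2 (dart0 f) (dart2 f).
    by have := joined_toggle b He f; rewrite je2.
  have key := joined_separated nje jf' (negbT je2).
  have sub22 x y : same He x y -> same H2 x y by apply: sub2; rewrite je2.
  case/orP: key => /andP[/sub22 k0 /sub22 k2].
    by rewrite (monomial_same _ _ k0) (monomial_same _ _ k2).
  by rewrite (monomial_same _ _ k0) (monomial_same _ _ k2) addnC.
- have njf : ~~ joined H2 f by rewrite joined_toggle je2.
  have nje : ~~ same H2 (dart0 e) (dart2 e).
    by rewrite -/(joined H2 e) /H2 -Hef joined_toggle jf2.
  have je' : same (toggle H2 f) (dart0 e) (dart2 e).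
    by rewrite toggleK -/(joined He e) joined_toggle je.
  case/orP: (joined_separated njf je' nje) => /andP[k0 k2].
    by rewrite (monomial_same _ _ k0) (monomial_same _ _ k2).
  by rewrite (monomial_same _ _ k0) (monomial_same _ _ k2) addnC.
Qed.
End Monomials.

(** * Signs and gradings of the differential *)

Section KhovanovComplex.
Variables (L : link_diagram) (b : checkerboard L).
Variables (le : rel (crossing L)) (le_total : total le) (le_antisym : antisymmetric le).
Local Notation X := (crossing L).
Implicit Types (H K : {set X}) (e f : X) (c : enhanced b).

Lemma kh_coefE c c' : kh_coef le c c' =
  \sum_(e in A_edges b (sub c)) (-1) ^+ kh_exponent b le (sub c) e * (edge_coef e c c')%:R.
Proof.
rewrite /kh_coef big_mkcondr; apply: eq_bigr => e _; rewrite /edge_coef.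
by case: (_ && _); rewrite ?mulr1 ?mulr0.
Qed.

Lemma kh_coef_toggle c c' e : sub c' = toggle (sub c) e -> kh_coef le c c' =
  (-1) ^+ kh_exponent b le (sub c) e * ((e \in A_edges b (sub c)) && edge_map c c')%:R.
Proof.
move=> E; rewrite kh_coefE big_mkcond (bigD1 e) //= big1 ?addr0 => [|f fe].
  by case: (e \in _); rewrite ?mulr0 // /edge_coef E eqxx.
rewrite /edge_coef; case: ifP => // _; case: eqP; rewrite /= ?mulr0 // E => /toggle_inj E'.
by rewrite E' eqxx in fe.
Qed.

Lemma kh_coef_neq0 c c' : kh_coef le c c' != 0 ->
  exists e, [/\ sub c' = toggle (sub c) e, e \in A_edges b (sub c) & edge_map c c'].
Proof.
move=> h; have [/existsP[e /and3P[/eqP h1 h2 h3]]|] :=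
  boolP [exists e, [&& sub c' == toggle (sub c) e, e \in A_edges b (sub c) & edge_map c c']].
  by exists e.
move/existsPn => hn; move: h; rewrite kh_coefE big1 ?eqxx // => e eA.
have := hn e; rewrite eA /edge_coef /=; case: (_ && _) => // _; exact: mulr0.
Qed.

Lemma in_A_toggle H e f :
  (f \in A_edges b (toggle H e)) = ((f == e) (+) (f \in A_edges b H)).
Proof.
rewrite !inE in_toggle; case: eqP => // ->; by case: ifP.
Qed.

(** Once toggled, [e] is no longer in [A_edges] and counts for every larger edge. This is where the
    anticommutation of two toggles comes from. *)
Lemma kh_exponent_toggle H e f : e \in A_edges b H -> f != e ->
  kh_exponent b le (toggle H e) f = (kh_exponent b le H f + le e f)%N.
Proof.
move=> eA fe; rewrite /kh_exponent.
set A := [set g | _]; set B := [set g | _].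
have -> : A = (if le e f then e |: B else B).
  have eB : e \in B = false by rewrite in_set eA /= !andbF.
  apply/setP => g; have [->|ge] := eqVneq g e.
    rewrite in_set in_A_toggle eqxx eA [e == f]eq_sym fe andbT.
    by case: (le e f); rewrite ?setU11 ?eB.
  rewrite in_set in_A_toggle (negPf ge) /=; case: (le e f); rewrite ?in_setU1 ?(negPf ge);
    by rewrite /= [g \in B]in_set.
case: ifP => _; last by rewrite addn0.
by rewrite cardsU1 in_set eA /= !andbF addnC.
Qed.

Lemma kh_dd c c' : \sum_c1 kh_coef le c c1 * kh_coef le c1 c' = 0.
Proof.
pose A := A_edges b (sub c); pose w := kh_exponent b le (sub c).
(* [t e f] collects the contributions of toggling [e] and then [f]. It is antisymmetric:
   [double_coef] is symmetric, and exactly one of [le e f] and [le f e] holds for distinct edges. *)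
pose t e f : int := if [&& e != f, e \in A & f \in A] then
  (-1) ^+ (w e + w f + le e f) * (double_coef e f c c')%:R else 0.
have -> : \sum_c1 kh_coef le c c1 * kh_coef le c1 c' = \sum_e \sum_f t e f.
  transitivity (\sum_c1 \sum_(e in A) \sum_f if (e != f) && (f \in A) then
     (-1) ^+ (w e + w f + le e f) * (edge_coef e c c1 * edge_coef f c1 c')%:R else 0 : int).
    apply: eq_bigr => c1 _; rewrite [kh_coef le c c1]kh_coefE mulr_suml.
    apply: eq_bigr => e eA; rewrite [kh_coef le c1 c']kh_coefE big_mkcond mulr_sumr.
    rewrite /edge_coef; case: eqP => [E|_] /=; last first.
      by rewrite big1 => [|f _]; rewrite ?mulr0 ?mul0r // big1 // => f _; rewrite mul0n mulr0 if_same.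
    apply: eq_bigr => f _; rewrite E in_A_toggle [f == e]eq_sym; case: eqVneq => [ef|ef] /=.
      by move: eA; rewrite -ef /A => ->; rewrite mulr0.
    case: ifP => fA; last by rewrite mulr0.
    by rewrite kh_exponent_toggle 1?eq_sym // natrM mulrACA !exprD !mulrA.
  rewrite exchange_big /= [LHS]big_mkcond; apply: eq_bigr => e _; case: ifP => eA; last first.
    by rewrite big1 // => f _; rewrite /t eA andbF.
  rewrite exchange_big /=; apply: eq_bigr => f _; rewrite /t eA /=.
  case: ifP => _; last by rewrite big1.
  by rewrite -mulr_sumr -natr_sum.
have anti e f : t e f = - t f e.
  rewrite /t [f == e]eq_sym [(f \in A) && _]andbC.
  case: ifP => [/and3P[ef _ _]|_]; last by rewrite oppr0.
  rewrite (double_coefC _ _ ef) -mulNr; congr (_ * _).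
  have := le_total e f; have := @le_antisym e f; rewrite [(w f + w e)%N]addnC !exprD.
  case: (le e f); case: (le f e) => //= h _.
  - by move: ef; rewrite h // eqxx.
  - by rewrite !mulr1 expr1 mulrN1.
  - by rewrite !mulr1 expr1 mulrN1 opprK.
set S := \sum_e _; have : S = - S.
  rewrite {1}/S exchange_big -sumrN; apply: eq_bigr => e _; rewrite -sumrN.
  by apply: eq_bigr => f _; exact: anti.
by move=> h; lia.
Qed.

Lemma i_gradingE c : i_grading c = #|~: A_edges b (sub c)|%:Z - (nminus L)%:Z.
Proof.
rewrite /i_grading -PoszD -cardsUI [X in (_ + X)%N](_ : _ = 0%N) ?addn0; last first.
  apply/eqP; rewrite cards_eq0; apply/eqP/setP => e; rewrite !inE.
  by case: (positive_edge b e); rewrite ?andbF.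
congr (Posz _ - _); apply: eq_card => e; rewrite !inE.
by case: (positive_edge b e); rewrite ?negbK ?orbF.
Qed.

Lemma i_grading_toggle c c' e : sub c' = toggle (sub c) e -> e \in A_edges b (sub c) ->
  i_grading c' = i_grading c + 1.
Proof.
move=> E eA; rewrite !i_gradingE E.
have -> : ~: A_edges b (toggle (sub c) e) = e |: ~: A_edges b (sub c).
  apply/setP => f; rewrite in_setC in_A_toggle !inE; case: eqP => [->|_] //=.
  by move: eA; rewrite inE => ->.
by rewrite cardsU1 in_setC eA addnC PoszD addrAC.
Qed.

Lemma j_gradingE c : j_grading c = i_grading c +
  \sum_(f in faces b (sub c)) (if label c f then 1 else -1) + (nplus L)%:Z - (nminus L)%:Z.
Proof.
rewrite /j_grading; congr (_ + _ - _); rewrite -addrA; congr (_ + _).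
have cnt (P : pred {set half_arc X}) :
    #|[set C in faces b (sub c) | P C]|%:Z = \sum_(C in faces b (sub c)) (P C)%:Z.
  rewrite -sum1dep_card big_mkcondr -natz natr_sum.
  by apply: eq_bigr => C _; case: (P C).
by rewrite !cnt -sumrB; apply: eq_bigr => C _; case: (label c C).
Qed.

Lemma kh_homogeneous c c' : kh_coef le c c' != 0 ->
  i_grading c' = i_grading c + 1 /\ j_grading c' = j_grading c.
Proof.
case/kh_coef_neq0 => e [E eA /andP[/forall_inP hI hE]].
have hi := i_grading_toggle E eA; split=> //.
rewrite !j_gradingE hi; congr (_ + _ - _).
set F := faces b (sub c) in hI hE *; set F' := faces b (sub c') in hI hE *.
rewrite [in RHS](big_setID F') [in LHS](big_setID F) /=.
have -> : \sum_(C in F' :&: F) (if label c' C then 1 else -1) =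
   \sum_(C in F :&: F') (if label c C then 1 else -1) :> int.
  by rewrite setIC; apply: eq_bigr => C hC; rewrite (eqP (hI C hC)).
(* On the affected circles every merge and every split lowers the sum of the labels, counted as 1
   and -1, by one; this offsets the rise of the homological degree. *)
suff : \sum_(C in F' :\: F) (if label c' C then 1 else -1) + 1 =
   \sum_(C in F :\: F') (if label c C then 1 else -1) :> int by move=> <-; ring.
case/orP: hE => /existsP[f1 /existsP[f2 /existsP[f /and4P[nf /eqP -> /eqP -> h]]]].
  rewrite big_set1 big_setU1 ?inE //= big_set1.
  by move: h; case: (label c f1); case: (label c f2); case: (label c' f).
rewrite big_set1 big_setU1 ?inE //= big_set1.
by move: h; case: (label c f1); case: (label c' f2); case: (label c' f).
Qed.
End KhovanovComplex.

(** * The tree G(T) and its leaf matching *)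

Section Unknot.
Variables (L : link_diagram) (b : checkerboard L).
Local Notation X := (crossing L).
Local Notation dart := (half_arc (crossing L)).
Implicit Types (H K S T U : {set X}) (e f g : X) (d : dart) (c : enhanced b).
Local Notation same := (same_circle b).
Local Notation joined := (joined b).

Definition symdiff U S : {set X} := [set e | (e \in U) (+) (e \in S)].

Lemma symdiffU1 U S f : f \notin S -> symdiff U (f |: S) = toggle (symdiff U S) f.
Proof.
move=> fS; apply/setP => e; rewrite in_toggle !inE.
by have [->|_] := eqVneq e f; rewrite ?(negPf fS) ?addbF ?addbT.
Qed.

Lemma symdiff0 U : symdiff U finset.set0 = U.
Proof. by apply/setP => e; rewrite !inE addbF. Qed.

(* For a state [U] with a single circle, the edges of [S] are pairwise
   non-crossing chords of that circle. *)
Definition noncrossing U S : Prop :=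
  (forall e, e \in S -> joined U e) /\
  (forall e f, e \in S -> f \in S -> e != f -> joined (toggle U f) e).

Lemma joined_trans K f x y : ~~ joined K f ->
  same K x (dart0 f) && same K y (dart2 f) || same K x (dart2 f) && same K y (dart0 f) ->
  same (toggle K f) x y.
Proof.
move=> nj; rewrite same_toggle // /joinrel ![same K _ x]same_sym ![same K _ y]same_sym.
by case/orP => /andP[-> ->]; rewrite ?orbT.
Qed.

(** This passes from pairs of chords to arbitrary subsets. If toggling both [f] and [g] separated
    the ends of [e], then [e], [f] and [g] would connect the same two circles; toggling [f] back
    would join the ends of [g], although toggling [g] alone separates them. *)
Lemma noncrossing_toggle U S f : noncrossing U S -> f \in S ->
  noncrossing (toggle U f) (S :\ f).
Proof.
move=> [hj hp] fS; split=> [e /setD1P[ef eS]|e g /setD1P[ef eS] /setD1P[gf gS] eg].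
  exact: hp.
set K := toggle (toggle U f) g.
have KE : K = toggle (toggle U g) f by rewrite toggleC.
have njg : ~~ joined K g by rewrite joined_toggle hp.
have njf : ~~ joined K f by rewrite KE joined_toggle hp // eq_sym.
apply/negPn/negP => nje.
have eg' : same (toggle K g) (dart0 e) (dart2 e) by rewrite toggleK; exact: hp.
have ef' : same (toggle K f) (dart0 e) (dart2 e) by rewrite KE toggleK; exact: hp.
have kg := joined_separated njg eg' nje; have kf := joined_separated njf ef' nje.
have : joined (toggle K f) g.
  apply: joined_trans => //.
  have tr x y z : same K x y -> same K x z -> same K y z.
    by rewrite same_sym; exact: same_trans.
  case/orP: kg => /andP[g0 g2]; case/orP: kf => /andP[f0 f2].
  - by rewrite (tr _ _ _ g0 f0) (tr _ _ _ g2 f2).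
  - by rewrite (tr _ _ _ g0 f0) (tr _ _ _ g2 f2) orbT.
  - by rewrite (tr _ _ _ g0 f0) (tr _ _ _ g2 f2) orbT.
  - by rewrite (tr _ _ _ g0 f0) (tr _ _ _ g2 f2).
by rewrite KE toggleK joined_toggle hj.
Qed.

Lemma noncrossing_symdiff U S S' : noncrossing U S -> S' \subset S ->
  noncrossing (symdiff U S') (S :\: S').
Proof.
move=> hS; have := sub0set S'; move: S'; apply: subset_ind => [_|S' f _ fS' IH].
  by rewrite symdiff0 finset.setD0.
rewrite subUset sub1set => /andP[fS S'S]; rewrite symdiffU1 // setUC -setDDl.
by apply: noncrossing_toggle; [exact: IH|rewrite inE fS'].
Qed.

Variable le : rel X.
Hypotheses (le_total : total le) (le_antisym : antisymmetric le) (le_trans : transitive le).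

Lemma le_refl : reflexive le.
Proof. by move=> e; have := le_total e e; rewrite orbb. Qed.

(** * The live edges of one spanning tree and the tree G(T) *)

Section Tree.
Variable T : {set X}.
Hypothesis hT : spanning_tree b T.

Local Notation live_edges := (live_edges b le T).
Local Notation core := (core b le T).

Lemma in_live e : (e \in live_edges) = live b le T e.
Proof. by rewrite inE. Qed.

Lemma same_tree d d' : same T d d'.
Proof.
have := hT; rewrite spanning_tree_faces => /cards1P[C EC].
have h z : circle b T z = C by apply/set1P; rewrite -EC circle_in_faces.
by rewrite -eq_circle !h.
Qed.

(** Toggling two crossing chords of the circle of [T] gives a single circle again, so the two edges
    can be exchanged; both being live, each would be at most the other. *)
Lemma live_noncrossing : noncrossing T live_edges.
Proof.
split=> [e _|e f]; first exact: same_tree.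
rewrite !in_live => /(liveP e hT le_refl) he /(liveP f hT le_refl) hf ef.
apply/negPn/negP => nj; have hS : spanning_tree b (swap T f e).
  have := card_faces_toggle nj; rewrite card_faces_toggle_joined; last exact: same_tree.
  by have := hT; rewrite !spanning_tree_faces => /eqP -> [<-].
have opp : (f \in T) != (e \in T) by apply: swap_opposite hS; rewrite // eq_sym.
have hS' : spanning_tree b (swap T e f) by rewrite /swap toggleC.
move: ef; have -> : e = f; last by rewrite eqxx.
by apply: le_antisym; rewrite he ?hf // eq_sym.
Qed.

Lemma coreE : core = symdiff T live_edges.
Proof. by apply/setP => e; rewrite !inE; case: (e \in T). Qed.

(* The subgraph of [G] corresponding to the spanning subgraph [K] of G(T). *)
Definition state K : {set X} := symdiff core K.

Lemma stateE K : K \subset live_edges -> state K = symdiff T (live_edges :\: K).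
Proof.
move=> /fintype.subsetP KL; apply/setP => e; rewrite /state coreE in_set [in RHS]in_set.
rewrite [e \in symdiff _ _]in_set in_setD -addbA; congr addb.
by case: (boolP (e \in K)) => [/KL ->|]; rewrite ?addbF.
Qed.

(** The state arises from [T] by toggling the live edges outside [K]. A chord that is not toggled
    keeps both ends on one circle; a toggled one has just split a circle between its ends. *)
Lemma joined_state K e : K \subset live_edges -> e \in live_edges ->
  joined (state K) e = (e \in K).
Proof.
move=> KL eL; rewrite stateE //.
have [eK|eK] := boolP (e \in K).
  have [h _] := noncrossing_symdiff live_noncrossing (finset.subsetDl live_edges K).
  by apply: h; rewrite in_setD eL in_setD eK.
have eD : e \in live_edges :\: K by rewrite in_setD eK eL.
have sub : live_edges :\: (e |: K) \subset live_edges by exact: finset.subsetDl.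
rewrite -(setD1K eD) symdiffU1 ?setD11 // setDDl [K :|: _]setUC joined_toggle.
have [h _] := noncrossing_symdiff live_noncrossing sub.
by rewrite h // in_setD eL in_setD setU11.
Qed.

Lemma stateU1 K e : e \notin K -> state (e |: K) = toggle (state K) e.
Proof. exact: symdiffU1. Qed.

Lemma state0 : state finset.set0 = core.
Proof. exact: symdiff0. Qed.

Lemma state_live : state live_edges = T.
Proof. by rewrite stateE // setDv symdiff0. Qed.

Lemma card_faces_state K : K \subset live_edges ->
  (#|faces b (state K)| + #|K| = #|live_edges|.+1)%N.
Proof.
move=> KL; have aux S : S \subset live_edges ->
    #|faces b (symdiff T S)| = #|S|.+1.
  have := sub0set S; move: S; apply: subset_ind => [_|S e _ eS IH].
    by rewrite symdiff0 cards0; have := hT; rewrite spanning_tree_faces => /eqP.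
  rewrite subUset sub1set => /andP[eL SL].
  have [h _] := noncrossing_symdiff live_noncrossing SL.
  rewrite symdiffU1 // card_faces_toggle_joined; last by apply: h; rewrite in_setD eS.
  by rewrite IH // cardsU1 eS.
rewrite stateE // aux ?finset.subsetDl // cardsD (setIidPr KL) addSn subnK //.
exact: subset_leq_card.
Qed.

Local Notation twist_ends := (twist_ends b le T).
Definition vertex d : {set dart} := circle b core d.
Definition gconn K := connect (twist_adj b le T K).

Lemma core_unjoined e : e \in live_edges -> ~~ joined core e.
Proof. by move=> eL; rewrite -state0 joined_state ?sub0set ?in_set0. Qed.

Lemma twist_endsE e : e \in live_edges ->
  twist_ends e = [set vertex (dart0 e); vertex (dart2 e)].
Proof. by move=> eL; apply: faces_setD; exact: core_unjoined. Qed.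

Lemma vertex_neq e : e \in live_edges -> vertex (dart0 e) != vertex (dart2 e).
Proof. by move=> eL; rewrite eq_circle; exact: core_unjoined. Qed.

Lemma gconn_sym K : symmetric (gconn K).
Proof.
apply: sym_connect_sym => u v /=; apply: eq_existsb => e; congr (_ && _).
by rewrite setUC.
Qed.

Lemma gconn_refl K v : gconn K v v.
Proof. exact: connect0. Qed.

Lemma gconn_trans K : transitive (gconn K).
Proof. exact: connect_trans. Qed.

Lemma gconn_edge K e : e \in K -> e \in live_edges ->
  gconn K (vertex (dart0 e)) (vertex (dart2 e)).
Proof.
move=> eK eL; apply: connect1; apply/existsP; exists e.
by rewrite eK twist_endsE ?eqxx.
Qed.

Lemma gconn_sub K (R : rel {set dart}) : reflexive R -> transitive R ->
  (forall e u v, e \in K -> twist_ends e = [set u; v] -> R u v) ->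
  forall u v, gconn K u v -> R u v.
Proof.
move=> Rr Rt h u v /connectP[p]; elim: p u => [|y p IH] u /=; first by move=> _ ->.
move=> /andP[/existsP[e /andP[eK /eqP E]] hp] hl.
exact: Rt (h e _ _ eK E) (IH _ hp hl).
Qed.

Lemma gconnS K S u v : K \subset S -> gconn K u v -> gconn S u v.
Proof.
move=> /fintype.subsetP KS; apply: gconn_sub.
- exact: gconn_refl.
- exact: gconn_trans.
- move=> e x y /KS eS E; apply: connect1; apply/existsP; exists e.
  by rewrite eS E eqxx.
Qed.

Lemma same_core_state K d d' : K \subset live_edges -> same core d d' -> same (state K) d d'.
Proof.
move=> KL; apply: same_circle_sub.
- exact: same_refl.
- exact: same_trans.
- exact: same_arc.
case=> [[c k]|s]; last exact: (same_turn b (state K) (inr s)).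
have [cK|cK] := boolP (c \in K); last first.
  have := same_turn b (state K) (inl (c, k)); rewrite /= [c \in state K]in_set (negPf cK).
  by rewrite addbF.
have j : joined (state K) c by rewrite joined_state // (fintype.subsetP KL).
have corner k' : same (state K) (dart0 c) (inl (c, k')).
  by case/orP: (same_corner b (state K) c k') => //; apply: same_trans.
apply: (same_trans (y := dart0 c)); first by rewrite same_sym.
by rewrite /=; case: ifP.
Qed.

Lemma same_state K d d' : K \subset live_edges ->
  same (state K) d d' = gconn K (vertex d) (vertex d').
Proof.
move=> KL; apply/idP/idP.
  apply: (same_circle_sub (R := [rel d d' | gconn K (vertex d) (vertex d')])).
  - by move=> z; apply: gconn_refl.
  - by move=> y x z; apply: gconn_trans.
  - move=> z /=; have -> : vertex (arc z) = vertex z; last exact: gconn_refl.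
    by apply/eqP; rewrite eq_circle same_sym same_arc.
  move=> z /=.
  case: z => [[c k]|s]; last first.
    have -> : vertex (turn b (state K) (inr s)) = vertex (inr s); last exact: gconn_refl.
    by apply/eqP; rewrite eq_circle same_sym (same_turn b core (inr s)).
  have [cK|cK] := boolP (c \in K); last first.
    have -> : vertex (turn b (state K) (inl (c, k))) = vertex (inl (c, k)).
      apply/eqP; rewrite eq_circle same_sym /= [c \in state K]in_set (negPf cK) addbF.
      exact: (same_turn b core (inl (c, k))).
    exact: gconn_refl.
  have cL := fintype.subsetP KL _ cK.
  have corner k' : gconn K (vertex (dart0 c)) (vertex (inl (c, k'))).
    have /orP[] := same_corner b core c k'; rewrite -eq_circle -!/(vertex _) => /eqP <-.
      exact: gconn_refl.
    exact: gconn_edge.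
  apply: (gconn_trans (y := vertex (dart0 c))); first by rewrite gconn_sym.
  by rewrite /=; case: ifP => _; exact: corner.
case/connectP => p; elim: p d => [|y p IH] d /=.
  by move=> _ /eqP; rewrite eq_sym eq_circle; exact: same_core_state.
case/andP => /existsP[e /andP[eK /eqP E]] hp hl.
have eL := fintype.subsetP KL _ eK.
have j : same (state K) (dart0 e) (dart2 e) by rewrite -/(joined _ e) joined_state.
have y_in : y \in twist_ends e by rewrite E set22.
have d_in : vertex d \in twist_ends e by rewrite E set21.
have [dy Ey] : exists2 dy, y = vertex dy & same (state K) (dart0 e) dy.
  move: y_in; rewrite twist_endsE // !inE => /orP[]/eqP ->; 
    [exists (dart0 e)|exists (dart2 e)] => //; exact: same_refl.
move=> d0; have dd : same (state K) d (dart0 e).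
  move: d_in; rewrite twist_endsE // !inE !eq_circle => /orP[] /(same_core_state KL) // h.
  by apply: same_trans h _; rewrite same_sym.
apply: same_trans dd _; apply: same_trans d0 _.
by rewrite Ey in hp hl; exact: IH hp hl.
Qed.

Lemma component_state K d : K \subset live_edges ->
  component b le T K (vertex d) = circle b (state K) d.
Proof.
move=> KL; apply/setP => z; rewrite mem_circle same_state //.
apply/bigcupP/idP => [[u /andP[/imsetP[y _ ->] hy]]|h].
  rewrite mem_circle => yz; have -> : vertex z = vertex y; last exact: hy.
  by apply/eqP; rewrite eq_circle same_sym.
by exists (vertex z); rewrite ?mem_circle ?same_refl // circle_in_faces.
Qed.

(** The state of all live edges is [T] itself, and its single circle makes G(T) connected. *)
Lemma gconn_live u v : u \in faces b core -> v \in faces b core -> gconn live_edges u v.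
Proof.
move=> /imsetP[d _ ->] /imsetP[d' _ ->]; rewrite -same_state // state_live.
exact: same_tree.
Qed.

(** * Subtrees of G(T) and their leaves *)

Local Notation root := (root b le T).

Definition inner_edges (W : {set {set dart}}) : {set X} :=
  [set f in live_edges | twist_ends f \subset W].

Definition good_set (W : {set {set dart}}) : Prop :=
  [/\ root \in W, W \subset faces b core, (#|inner_edges W|.+1 = #|W|)%N
    & forall v, v \in W -> gconn (inner_edges W) v root].

Implicit Types (W : {set {set dart}}) (v w : {set dart}).

Lemma inner_live W : inner_edges W \subset live_edges.
Proof. by apply/fintype.subsetP => e; rewrite inE => /andP[]. Qed.

Lemma mem_inner W e : (e \in inner_edges W) = (e \in live_edges) && (twist_ends e \subset W).
Proof. by rewrite inE. Qed.

Lemma twist_ends_faces e : e \in live_edges -> twist_ends e \subset faces b core.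
Proof.
move=> eL; rewrite twist_endsE //; apply/fintype.subsetP => v.
by rewrite !inE => /orP[]/eqP ->; exact: circle_in_faces.
Qed.

Lemma good_faces : good_set (faces b core).
Proof.
have E : inner_edges (faces b core) = live_edges.
  by apply/setP => e; rewrite mem_inner; apply/andb_idr/twist_ends_faces.
have rf : root \in faces b core by exact: circle_in_faces.
split=> //; rewrite ?E.
  by have := card_faces_state (sub0set live_edges); rewrite state0 cards0 addn0.
by move=> v vf; exact: gconn_live.
Qed.

Definition leaf_at W v := [set f in inner_edges W | v \in twist_ends f].

Lemma leaf_edgeE W e v : leaf_edge b le T W e v =
  [&& v \in W, v != root, e \in inner_edges W, v \in twist_ends e & #|leaf_at W v| == 1%N].
Proof. by []. Qed.

Lemma leaf_edge_uniq W e v f : leaf_edge b le T W e v -> f \in inner_edges W ->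
  v \in twist_ends f -> f = e.
Proof.
rewrite leaf_edgeE => /and5P[_ _ eE ve /cards1P[g Eg]] fE vf.
have : e \in leaf_at W v by rewrite inE eE.
have : f \in leaf_at W v by rewrite inE fE.
by rewrite Eg !inE => /eqP -> /eqP ->.
Qed.

Lemma card_twist_ends e : e \in live_edges -> #|twist_ends e| = 2%N.
Proof. by move=> eL; rewrite twist_endsE // cards2 vertex_neq. Qed.

Lemma gconn_step K u v : u != v -> gconn K u v ->
  exists2 e, e \in K & exists w, twist_ends e = [set u; w].
Proof.
move=> uv /connectP[[|y p] /=]; first by move=> _ E; rewrite E eqxx in uv.
by case/andP => /existsP[e /andP[eK /eqP E]] _ _; exists e => //; exists y.
Qed.

Lemma degree_gt0 W u v : u \in W -> v \in W -> u != v -> good_set W -> (0 < #|leaf_at W u|)%N.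
Proof.
move=> uW vW uv [_ _ _ hc].
have : gconn (inner_edges W) u v.
  by apply: gconn_trans (hc u uW) _; rewrite gconn_sym; exact: hc.
case/(gconn_step uv) => e eE [w E]; apply/card_gt0P; exists e.
by rewrite inE eE E set21.
Qed.

(** The degrees add up to [2 (|W| - 1)], while a root of positive degree and degrees at least 2
    elsewhere would give at least [2 |W| - 1]. *)
Lemma leaf_exists W : good_set W -> (1 < #|W|)%N -> exists e v, leaf_edge b le T W e v.
Proof.
move=> gW; have [rW _ hE hc] := gW.
rewrite (cardsD1 root) rW add1n ltnS => /card_gt0P[u /setD1P[ur uW]].
have sumE : (\sum_(v in W) #|leaf_at W v| = 2 * #|inner_edges W|)%N.
  transitivity (\sum_(v in W) \sum_(f in inner_edges W) (v \in twist_ends f))%N.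
    apply: eq_bigr => v _; rewrite -sum1dep_card big_mkcondr; apply: eq_bigr => f _.
    by case: (v \in _).
  rewrite exchange_big /= mulnC -sum_nat_const; apply: eq_bigr => f.
  rewrite mem_inner => /andP[fL fW]; rewrite -(card_twist_ends fL) -sum1_card.
  rewrite [RHS]big_mkcond [LHS]big_mkcond; apply: eq_bigr => v _.
  by have [vf|] := boolP (v \in twist_ends f); case: ifP => //; rewrite (fintype.subsetP fW).
have [/exists_inP[v /setD1P[vr vW] d1]|/exists_inPn no] :=
    boolP [exists v in W :\ root, #|leaf_at W v| == 1%N].
  have /cards1P[e Ee] := d1; have : e \in leaf_at W v by rewrite Ee set11.
  rewrite inE => /andP[eE ve]; exists e, v; by rewrite leaf_edgeE vW vr eE ve d1.
have d2 v : v \in W :\ root -> (1 < #|leaf_at W v|)%N.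
  move=> vD; have := no v vD; case/setD1P: vD => vr vW.
  have := degree_gt0 vW rW vr gW; case: #|_| => [//|[|]] //.
have r1 : (0 < #|leaf_at W root|)%N by apply: (degree_gt0 rW uW _ gW); rewrite eq_sym.
have : (\sum_(v in W :\ root) 2 <= \sum_(v in W :\ root) #|leaf_at W v|)%N.
  by apply: leq_sum => v /d2.
move: sumE; rewrite (big_setD1 root) //= sum_nat_const.
move: hE; rewrite (cardsD1 root W) rW /= add1n; set A := \sum_(_ in _ :\ _) _; move: A #|leaf_at W root| #|W :\ root| #|inner_edges W| r1; clear; lia.
Qed.

Lemma leaf_other W e v : leaf_edge b le T W e v ->
  exists d d', [/\ vertex d = v, vertex d' != v, twist_ends e = [set v; vertex d'],
    vertex d' \in W & (d = dart0 e /\ d' = dart2 e) \/ (d = dart2 e /\ d' = dart0 e)].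
Proof.
rewrite leaf_edgeE => /and5P[vW vr eE ve _]; move: eE; rewrite mem_inner => /andP[eL eW].
have E := twist_endsE eL; have ne := vertex_neq eL.
have h0 : vertex (dart0 e) \in W by apply: (fintype.subsetP eW); rewrite E set21.
have h2 : vertex (dart2 e) \in W by apply: (fintype.subsetP eW); rewrite E set22.
move: ve; rewrite E !inE => /orP[]/eqP ->.
  by exists (dart0 e), (dart2 e); split=> //; rewrite 1?eq_sym //; left.
by exists (dart2 e), (dart0 e); split=> //; [rewrite setUC|right].
Qed.

Lemma inner_delete W e v : leaf_edge b le T W e v ->
  inner_edges (W :\ v) = inner_edges W :\ e.
Proof.
move=> le_; apply/setP => f; rewrite in_setD1 !mem_inner subsetD1.
have [-> | fe] /= := eqVneq f e.
  by move: le_; rewrite leaf_edgeE => /and5P[_ _ _ -> _]; rewrite !andbF.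
apply/and3P/andP => [[-> -> _]//|[fL fW]]; split=> //; apply: contra fe => vf.
by apply/eqP; apply: leaf_edge_uniq le_ _ vf; rewrite mem_inner fL.
Qed.

(* Contract the leaf onto its neighbour. *)
Lemma good_delete W e v : good_set W -> leaf_edge b le T W e v -> good_set (W :\ v).
Proof.
move=> [rW Wf hE hc] le_; have := le_; rewrite leaf_edgeE => /and5P[vW vr eE ve _].
split; first by rewrite !inE eq_sym vr.
- exact: fintype.subset_trans (subD1set W v) Wf.
- by move: hE; rewrite (inner_delete le_) (cardsD1 e) eE (cardsD1 v W) vW => -[].
move=> u /setD1P[uv uW].
have [d [d' [dv d'v Ee d'W _]]] := leaf_other le_.
pose r x := if x == v then vertex d' else x.
suff : gconn (inner_edges (W :\ v)) (r u) (r root).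
  by rewrite /r (negPf uv) eq_sym (negPf vr).
apply: (gconn_sub (R := [rel x y | gconn (inner_edges (W :\ v)) (r x) (r y)])) (hc u uW).
- by move=> x; apply: gconn_refl.
- by move=> y x z; apply: gconn_trans.
move=> f x y fE Ef /=; have [fe|fe] := eqVneq f e.
  have : r x = r y; last by move=> ->; exact: gconn_refl.
  have Ef' : [set v; vertex d'] == [set x; y] by rewrite -Ee -fe Ef.
  have xy : x != y.
    apply/eqP => xy; have := cards2 v (vertex d').
    by rewrite (eqP Ef') xy setUid cards1 eq_sym d'v.
  move: Ef'.
  rewrite set2_eq //; last by rewrite eq_sym.
  rewrite /r.
  by case/orP => /andP[/eqP <- /eqP <-]; rewrite eqxx (negPf d'v).
have nv z : z \in twist_ends f -> r z = z.
  move=> zf; rewrite /r; case: eqP => // zv; case/eqP: fe.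
  by apply: leaf_edge_uniq le_ fE _; rewrite -zv.
rewrite !nv ?Ef ?set21 ?set22 //; apply: connect1; apply/existsP; exists f.
by rewrite (inner_delete le_) in_setD1 fe fE Ef eqxx.
Qed.

(** An edge both of whose ends were leaves other than the root would be cut off from the root. *)
Lemma leaf_vertex_uniq W e v w : good_set W ->
  leaf_edge b le T W e v -> leaf_edge b le T W e w -> v = w.
Proof.
move=> [rW Wf hE hc] lv lw; apply/eqP/negPn/negP => vw.
have := lv; rewrite leaf_edgeE => /and5P[vW vr eE ve _].
have := lw; rewrite leaf_edgeE => /and5P[wW wr _ we _].
have eL := fintype.subsetP (inner_live W) e eE.
suff : (v \in [set v; w]) ==> (root \in [set v; w]).
  by rewrite set21 !inE !(eq_sym root) (negPf vr) (negPf wr).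
apply: (gconn_sub (R := [rel x y | (x \in [set v; w]) ==> (y \in [set v; w])])) (hc v vW).
- by move=> x /=; rewrite implybb.
- by move=> y x z /= /implyP h1 /implyP h2; apply/implyP => /h1.
move=> f x y fE Ef /=; apply/implyP => hx.
have fe : f = e.
  move: hx; rewrite !inE => /orP[]/eqP xx;
    [apply: leaf_edge_uniq lv fE _|apply: leaf_edge_uniq lw fE _]; by rewrite Ef xx set21.
have vwS : [set v; w] \subset twist_ends e by rewrite subUset !sub1set ve.
have -> : [set v; w] = twist_ends e.
  by apply/eqP; rewrite eqEcard vwS card_twist_ends // cards2 vw.
by rewrite -fe Ef set22.
Qed.

Lemma smallest_leaf_exists W : good_set W -> (1 < #|W|)%N ->
  exists e v, smallest_leaf_edge b le T W e v.
Proof.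
move=> gW W1; have [e0 [v0 h0]] := leaf_exists gW W1.
pose P e := [exists v, leaf_edge b le T W e v].
pose r e := #|[set f | le f e]|.
have Pe0 : P e0 by apply/existsP; exists v0.
case: (arg_minnP r Pe0) => e /existsP[v he] hmin.
exists e, v; rewrite /smallest_leaf_edge he; apply/forallP => e'; apply/forallP => v'.
apply/implyP => he'; have /hmin : P e' by apply/existsP; exists v'.
case/orP: (le_total e e') => // h; rewrite /r => hr.
have sub : [set f | le f e'] \subset [set f | le f e].
  by apply/fintype.subsetP => f; rewrite !inE => fe; apply: le_trans fe h.
have /setP/(_ e) : [set f | le f e'] = [set f | le f e] by apply/eqP; rewrite eqEcard sub hr.
by rewrite !inE (le_refl e).
Qed.

Lemma smallest_leaf_uniq W e v e' v' : good_set W ->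
  smallest_leaf_edge b le T W e v -> smallest_leaf_edge b le T W e' v' -> e = e' /\ v = v'.
Proof.
move=> gW /andP[h /forallP m] /andP[h' /forallP m'].
have ee : e = e'.
  apply: le_antisym; have /forallP/(_ v')/implyP/(_ h') -> := m e'.
  by have /forallP/(_ v)/implyP/(_ h) -> := m' e.
by subst e'; split=> //; exact: leaf_vertex_uniq gW h h'.
Qed.

Definition crit_label v : bool := [exists e, towards_root b le T v e && negative_twist b le T e].

(** In all of G(T) the vertex [v] may have further edges, to vertices deleted before. They do not
    separate it from the root, which it reaches through [e] inside [W]. So the twist of the leaf
    edge determines the label of [v] in the critical generators. *)
Lemma towards_root_leaf W e v f : good_set W -> leaf_edge b le T W e v ->
  towards_root b le T v f = (f == e).
Proof.
move=> gW le_; have [rW' Wf' hE' hc'] := good_delete gW le_.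
have := le_; rewrite leaf_edgeE => /and5P[vW vr eE ve _].
have eL := fintype.subsetP (inner_live W) e eE.
have [d [d' [dv d'v Ee d'W dd]]] := leaf_other le_.
have w_root : gconn (inner_edges (W :\ v)) (vertex d') root by apply: hc'; rewrite !inE d'v.
rewrite /towards_root -/(gconn _ _ _); apply/and3P/eqP => [[fL vf nc]|->].
  apply/eqP/negPn/negP => fe; case/negP: nc.
  apply: (gconn_trans (y := vertex d')).
    by apply: connect1; apply/existsP; exists e; rewrite !inE eq_sym fe -in_live eL Ee eqxx.
  apply: gconnS w_root; apply/fintype.subsetP => g gE.
  rewrite in_setD1 (fintype.subsetP (inner_live _) _ gE) andbT.
  apply: contraTneq gE => ->; rewrite mem_inner negb_and subsetD1 vf andbF orbT //.
split=> //; apply/negP => h.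
have sub : inner_edges (W :\ v) \subset live_edges :\ e.
  by rewrite (inner_delete le_) setSD // inner_live.
have : gconn (live_edges :\ e) (vertex (dart0 e)) (vertex (dart2 e)).
  have h' : gconn (live_edges :\ e) v (vertex d').
    by apply: gconn_trans h _; rewrite gconn_sym; exact: gconnS w_root.
  by case: dd => -[<- <-]; rewrite dv // gconn_sym.
rewrite -same_state ?subD1set // -/(joined _ e) joined_state ?subD1set //.
by rewrite setD11.
Qed.

Lemma crit_leaf W e v : good_set W -> leaf_edge b le T W e v ->
  crit_label v = negative_twist b le T e.
Proof.
move=> gW le_; apply/existsP/idP => [[f]|h].
  by rewrite (towards_root_leaf f gW le_) => /andP[/eqP ->].
by exists e; rewrite (towards_root_leaf e gW le_) eqxx.
Qed.

(** * Generators of U(T) in terms of G(T) *)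

Local Notation twist_sub := (twist_sub le T).
Local Notation neg := (negative_twist b le T).

Lemma twist_sub_live c : twist_sub c \subset live_edges.
Proof. by apply/fintype.subsetP => e; rewrite inE => /andP[]. Qed.

Lemma mem_twist_sub c e : (e \in twist_sub c) =
  (e \in live_edges) && ((e \in sub c) (+) (e \in core)).
Proof. by rewrite in_set; case: (e \in sub c); case: (e \in core). Qed.

Lemma in_unknotP c : in_unknot le T c = (sub c == state (twist_sub c)).
Proof.
apply/forallP/eqP => [h|E e].
  apply/setP => e; rewrite [RHS]in_set mem_twist_sub.
  have := h e; rewrite coreE [e \in symdiff _ _]in_set in_live.
  by case: (live _ _ _ _) => /=; case: (e \in T); case: (e \in sub c).
apply/implyP => ne; have := congr1 (fun H : {set X} => e \in H) E.
rewrite [_ \in state _]in_set mem_twist_sub coreE [e \in symdiff _ _]in_set in_live (negPf ne) /=.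
by rewrite !addbF; case: (e \in T) => ->.
Qed.

Lemma twist_subE c K : K \subset live_edges -> sub c = state K -> twist_sub c = K.
Proof.
move=> KL E; apply/setP => e; rewrite mem_twist_sub E [_ \in state K]in_set.
rewrite addbC addKb; apply: andb_idl; exact: (fintype.subsetP KL).
Qed.

Lemma in_unknot_of_state c K : K \subset live_edges -> sub c = state K -> in_unknot le T c.
Proof. by move=> KL E; rewrite in_unknotP (twist_subE KL E) E. Qed.

Lemma isolated_circle c d : in_unknot le T c ->
  (forall f, f \in twist_sub c -> vertex d \notin twist_ends f) ->
  circle b (sub c) d = vertex d.
Proof.
rewrite in_unknotP => /eqP E h; rewrite E; apply/setP => z.
rewrite !mem_circle same_state ?twist_sub_live //.
rewrite -[RHS]eq_circle -!/(vertex _); apply/idP/eqP => [hg|->]; last exact: gconn_refl.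
apply/eqP/negPn/negP => /gconn_step/(_ hg)[e /h + [w Ee]].
by rewrite Ee set21.
Qed.

(** The generators left unpaired by the deletions leading to [W]: the deleted vertices are isolated
    and carry their critical labels. *)
Definition surviving W c : bool :=
  [&& in_unknot le T c, twist_sub c \subset inner_edges W
    & [forall v in faces b core, (v \notin W) ==> (label c v == crit_label v)]].

Lemma surviving_faces c : surviving (faces b core) c = in_unknot le T c.
Proof.
have E : inner_edges (faces b core) = live_edges.
  by apply/setP => e; rewrite mem_inner; apply/andb_idr/twist_ends_faces.
rewrite /surviving E twist_sub_live /=; case: in_unknot => //=.
by apply/forall_inP => v ->.
Qed.

Lemma mem_vertex d d' : (d' \in vertex d) = (vertex d == vertex d').
Proof. by rewrite mem_circle eq_circle. Qed.

(** The half-arc of [e] on the neighbour of the leaf. It stands for the part [C_v - v] of the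
    component, which keeps the label of [C_v]. *)
Definition far_dart e (v : {set dart}) : dart := if dart0 e \in v then dart2 e else dart0 e.

(* The partner of [c] under the matching along the leaf [v] with edge [e]. *)
Definition leaf_mate e v c : enhanced b :=
  mk_enhanced b (toggle (sub c) e) (fun d =>
    if d \in v then if e \in twist_sub c then ~~ neg e else lab c (far_dart e v)
    else lab c d).

(** * The pairs of a single leaf *)

Section Leaf.
Variables (W : {set {set dart}}) (e : X) (v : {set dart}).
Hypotheses (gW : good_set W) (leafW : leaf_edge b le T W e v).

Let eL : e \in live_edges.
Proof. by move: leafW; rewrite leaf_edgeE => /and5P[_ _ /(fintype.subsetP (inner_live W))]. Qed.

Let eE : e \in inner_edges W.
Proof. by move: leafW; rewrite leaf_edgeE => /and5P[]. Qed.

Let vW : v \in W.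
Proof. by move: leafW; rewrite leaf_edgeE => /and5P[]. Qed.

Lemma leaf_darts : exists d, [/\ vertex d = v, vertex (far_dart e v) != v &
  (d = dart0 e /\ far_dart e v = dart2 e) \/ (d = dart2 e /\ far_dart e v = dart0 e)].
Proof.
have [d [d' [dv d'v _ _ dd]]] := leaf_other leafW; exists d.
have m0 : (dart0 e \in v) = (vertex (dart0 e) == v) by rewrite -dv mem_vertex eq_sym.
rewrite /far_dart m0; case: dd => -[E E']; rewrite E E' in dv d'v *.
  by rewrite dv eqxx; split=> //; left.
by rewrite (negPf d'v); split=> //; right.
Qed.

Lemma leaf_mem d : (d \in v) = (vertex d == v).
Proof. by have [d0 [<- _ _]] := leaf_darts; rewrite mem_vertex eq_sym. Qed.

Lemma leaf_isolated c d : in_unknot le T c -> twist_sub c \subset inner_edges W ->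
  e \notin twist_sub c -> vertex d = v -> circle b (sub c) d = v.
Proof.
move=> uc KW eK dv; rewrite -dv; apply: isolated_circle => // f fK.
by apply: contraNN eK; rewrite dv => /(leaf_edge_uniq leafW (fintype.subsetP KW f fK)) <-.
Qed.

Lemma same_leaf c d d' : in_unknot le T c -> twist_sub c \subset inner_edges W ->
  e \notin twist_sub c -> same (sub c) d d' -> (d \in v) = (d' \in v).
Proof.
move=> uc KW eK h; rewrite !leaf_mem; wlog dv : d d' h / vertex d = v => [hw|].
  case: (eqVneq (vertex d) v) => [dv|ndv]; first by rewrite -(hw d d' h dv) dv eqxx.
  case: (eqVneq (vertex d') v) => // d'v; rewrite same_sym in h.
  by have := hw d' d h d'v; rewrite d'v eqxx (negPf ndv).
have := leaf_isolated uc KW eK dv; rewrite dv eqxx => E.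
have : d' \in circle b (sub c) d by rewrite mem_circle.
by rewrite E leaf_mem => ->.
Qed.

Lemma toggle_state c : in_unknot le T c -> toggle (sub c) e =
  state (if e \in twist_sub c then twist_sub c :\ e else e |: twist_sub c).
Proof.
rewrite in_unknotP => /eqP {1}->; case: ifPn => eK; last by rewrite stateU1.
by rewrite -{1}(setD1K eK) stateU1 ?setD11 // toggleK.
Qed.

Lemma toggle_unknot c c' : in_unknot le T c -> sub c' = toggle (sub c) e ->
  in_unknot le T c' /\ twist_sub c' =
    if e \in twist_sub c then twist_sub c :\ e else e |: twist_sub c.
Proof.
move=> uc; rewrite toggle_state //; set K := (if _ then _ else _) => E.
have KL : K \subset live_edges.
  rewrite /K; case: ifP => _; last by rewrite subUset sub1set eL twist_sub_live.
  by apply: fintype.subset_trans (twist_sub_live c); apply: subD1set.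
by split; [exact: in_unknot_of_state KL E | exact: twist_subE].
Qed.

Lemma toggle_inner c c' : in_unknot le T c -> sub c' = toggle (sub c) e ->
  twist_sub c \subset inner_edges W -> twist_sub c' \subset inner_edges W.
Proof.
move=> uc /(toggle_unknot uc)[_ ->] KW; case: ifP => _; last by rewrite subUset sub1set eE.
by apply: fintype.subset_trans KW; apply: subD1set.
Qed.

Lemma joined_sub c f : in_unknot le T c -> f \in live_edges ->
  joined (sub c) f = (f \in twist_sub c).
Proof. by rewrite in_unknotP => /eqP E fL; rewrite {1}E joined_state ?twist_sub_live. Qed.

Lemma joined_far c d : vertex d = v -> in_unknot le T c -> e \in twist_sub c ->
  same (sub c) d (far_dart e v).
Proof.
move=> dv uc eK; have j : joined (sub c) e by rewrite joined_sub.
have [d0 [d0v _ dd]] := leaf_darts.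
have h : same (sub c) d d0.
  move: uc; rewrite in_unknotP => /eqP ->; apply: same_core_state; first exact: twist_sub_live.
  by rewrite -eq_circle -!/(vertex _) dv d0v.
apply: same_trans h _; case: dd => -[-> ->] //; by rewrite same_sym.
Qed.

Lemma leaf_mate_sub c : sub (leaf_mate e v c) = toggle (sub c) e.
Proof. by []. Qed.

(** The point is that the labels prescribed for the half-arcs are constant on the circles of the
    toggled state, as [lab_mk] requires. *)
Lemma lab_leaf_mate c d : in_unknot le T c -> twist_sub c \subset inner_edges W ->
  lab (leaf_mate e v c) d =
    if d \in v then if e \in twist_sub c then ~~ neg e else lab c (far_dart e v)
    else lab c d.
Proof.
move=> uc KW; rewrite lab_mk // => {}d d' h.
have [uc' Kc'] := toggle_unknot uc (leaf_mate_sub c).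
have KW' := toggle_inner uc (leaf_mate_sub c) KW.
have [eK|eK] := boolP (e \in twist_sub c).
  have eK' : e \notin twist_sub (leaf_mate e v c) by rewrite Kc' eK setD11.
  rewrite (same_leaf uc' KW' eK' h); case: ifP => // _; apply: lab_same.
  rewrite -[sub c](toggleK e); apply: same_sub_toggle => //.
  by rewrite joined_toggle joined_sub // eK.
have nj : ~~ joined (sub c) e by rewrite joined_sub.
have [d0 [d0v fv dd]] := leaf_darts.
have nfv : far_dart e v \in v = false by rewrite leaf_mem (negPf fv).
have at_case z : at_crossing b (sub c) e z ->
    (if z \in v then lab c (far_dart e v) else lab c z) = lab c (far_dart e v).
  move=> hz; have : same (sub c) d0 z || same (sub c) (far_dart e v) z.
    by case: dd => -[-> ->]; rewrite // orbC.
  case/orP => hz'.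
    by rewrite -(same_leaf uc KW eK hz') leaf_mem d0v eqxx.
  by rewrite -(same_leaf uc KW eK hz') nfv (lab_same hz').
move: h; rewrite same_toggle // /joinrel => /orP[h|/andP[h h']]; last by rewrite !at_case.
by rewrite (same_leaf uc KW eK h) (lab_same h).
Qed.

Lemma unpairedE c : surviving W c -> leaf_unpaired le T e v c = surviving (W :\ v) c.
Proof.
move=> /and3P[uc KW /forall_inP hl]; rewrite /leaf_unpaired /surviving uc /=.
rewrite (inner_delete leafW) subsetD1 KW /=; congr (_ && _).
apply/eqP/forall_inP => [h u uf|h].
  apply/implyP; rewrite !inE negb_and negbK => /orP[/eqP ->|]; last exact/implyP/hl.
  by rewrite h (crit_leaf gW leafW).
have [_ /fintype.subsetP Wf _ _] := gW.
by have := h v (Wf v vW); rewrite !inE eqxx /= => /eqP ->; rewrite (crit_leaf gW leafW).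
Qed.

Lemma label_leaf c d : in_unknot le T c -> twist_sub c \subset inner_edges W ->
  e \notin twist_sub c -> vertex d = v -> label c v = lab c d.
Proof. by move=> uc KW eK dv; rewrite /lab (leaf_isolated uc KW eK dv). Qed.

Lemma surviving_leaf_mate c : surviving W c -> surviving W (leaf_mate e v c).
Proof.
move=> /and3P[uc KW hl].
have [uc' Kc'] := toggle_unknot uc (leaf_mate_sub c).
have KW' := toggle_inner uc (leaf_mate_sub c) KW.
apply/and3P; split=> //; apply/forall_inP => u uf; apply/implyP => uW.
have := forall_inP hl u uf; rewrite uW /= => /eqP <-.
have [d _ Ed] := imsetP uf; rewrite -/(vertex d) in Ed.
have iso (K : {set X}) : K \subset inner_edges W -> forall f, f \in K -> vertex d \notin twist_ends f.
  move=> KW0 f /(fintype.subsetP KW0); rewrite mem_inner => /andP[_ /fintype.subsetP fW].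
  by rewrite -Ed; apply: contra uW; exact: fW.
have E := isolated_circle uc (iso _ KW); have E' := isolated_circle uc' (iso _ KW').
have -> : label c u = lab c d by rewrite /lab E Ed.
have -> : label (leaf_mate e v c) u = lab (leaf_mate e v c) d by rewrite [RHS]/lab E' Ed.
rewrite lab_leaf_mate // leaf_mem ifN //.
by apply: contraNneq uW; rewrite Ed => ->.
Qed.

Lemma leaf_mate_twist c : in_unknot le T c ->
  (e \in twist_sub (leaf_mate e v c)) = (e \notin twist_sub c).
Proof.
move=> uc; have [_ ->] := toggle_unknot uc (leaf_mate_sub c).
by case: ifP => eK; rewrite ?setD11 ?setU11.
Qed.

Lemma leaf_mate_paired c : surviving W c -> ~~ leaf_unpaired le T e v (leaf_mate e v c).
Proof.
move=> sc; have /and3P[uc KW _] := sc.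
rewrite /leaf_unpaired leaf_mate_twist // negbK.
have [eK|//] := boolP (e \in twist_sub c).
have [d [dv _ _]] := leaf_darts.
have /and3P[uc' KW' _] := surviving_leaf_mate sc.
rewrite (label_leaf uc' KW' _ dv) ?leaf_mate_twist ?eK //.
by rewrite lab_leaf_mate // leaf_mem dv eqxx eK; case: (neg e).
Qed.

Lemma leaf_mateK c : surviving W c -> ~~ leaf_unpaired le T e v c ->
  leaf_mate e v (leaf_mate e v c) = c.
Proof.
move=> sc np; have /and3P[uc KW _] := sc.
have sc' := surviving_leaf_mate sc; have /and3P[uc' KW' _] := sc'.
apply: enhanced_ext => [|d]; first by rewrite !leaf_mate_sub toggleK.
have [d0 [d0v fv dd]] := leaf_darts.
have nfv : far_dart e v \in v = false by rewrite leaf_mem (negPf fv).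
rewrite lab_leaf_mate // leaf_mate_twist //; case: ifP => dv; last first.
  by rewrite lab_leaf_mate // dv.
have {}dv : vertex d = v by apply/eqP; rewrite -leaf_mem.
have [eK|eK] := boolP (e \in twist_sub c) => /=.
  by rewrite lab_leaf_mate // nfv; apply/esym/lab_same/joined_far.
move: np; rewrite /leaf_unpaired eK /= (label_leaf uc KW eK dv).
by case: (lab c d); case: (neg e).
Qed.

Section LeafEdge.
Variables (c c' : enhanced b).
Hypotheses (uc : in_unknot le T c) (KW : twist_sub c \subset inner_edges W)
  (eK : e \in twist_sub c) (E : sub c' = toggle (sub c) e).
Local Notation w := (far_dart e v).

Let uc' : in_unknot le T c'. Proof. by have [] := toggle_unknot uc E. Qed.
Let KW' : twist_sub c' \subset inner_edges W. Proof. exact: toggle_inner uc E KW. Qed.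
Let eK' : e \notin twist_sub c'.
Proof. by have [_ ->] := toggle_unknot uc E; rewrite eK setD11. Qed.

Let joined_c : same (sub c) (dart0 e) (dart2 e).
Proof. by rewrite -/(joined _ _) joined_sub. Qed.

Let unjoined_c' : ~~ joined (sub c') e.
Proof. by rewrite E joined_toggle joined_sub // eK. Qed.

Let at_same z : at_crossing b (sub c') e z = same (sub c) w z.
Proof.
have [d0 [_ _ dd]] := leaf_darts.
have /equivalence_relP[_ Rt] := same_equiv b (sub c).
by rewrite -at_crossing_toggle // E toggleK; case: dd => -[_ ->]; rewrite -?(Rt _ _ joined_c).
Qed.

Let atE z : at_crossing b (sub c') e z = (z \in v) || same (sub c') w z.
Proof.
have [d0 [d0v _ dd]] := leaf_darts.
have -> : (z \in v) = same (sub c') d0 z.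
  by rewrite -(leaf_isolated uc' KW' eK' d0v) mem_circle.
by rewrite /at_crossing; case: dd => -[-> ->]; rewrite // orbC.
Qed.

Let far_notin : w \in v = false.
Proof. by have [_ [_ fv _]] := leaf_darts; rewrite leaf_mem (negPf fv). Qed.

Let label_v z : z \in v -> label c' v = lab c' z.
Proof. by rewrite leaf_mem => /eqP zv; rewrite (label_leaf uc' KW' eK' zv). Qed.

Lemma leaf_labels :
  c' = leaf_mate e v c <-> [/\ label c' v = ~~ neg e, lab c' w = lab c w
    & forall z, ~~ at_crossing b (sub c') e z -> lab c' z = lab c z].
Proof.
have [d0 [d0v _ _]] := leaf_darts; have d0in : d0 \in v by rewrite leaf_mem d0v.
split=> [Ec|[h1 h2 h3]].
  have h z : lab c' z = if z \in v then ~~ neg e else lab c z.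
    by rewrite {1}Ec lab_leaf_mate // eK.
  split=> [||z]; first by rewrite (label_v d0in) h d0in.
    by rewrite h far_notin.
  by rewrite atE negb_or h => /andP[/negPf ->].
apply: enhanced_ext => [//|z]; rewrite lab_leaf_mate // eK.
case: ifP => zv; first by rewrite -(label_v zv).
have [az|] := boolP (at_crossing b (sub c') e z); last exact: h3.
have : same (sub c) w z by rewrite -at_same.
move=> /lab_same <-; rewrite -h2; apply/esym/lab_same.
by move: az; rewrite atE zv.
Qed.

Lemma leaf_pair_mate : leaf_pair le T e v c c' <-> c' = leaf_mate e v c.
Proof.
rewrite leaf_labels /leaf_pair eK E eqxx /=.
have [d0 [d0v _ _]] := leaf_darts; have d0in : d0 \in v by rewrite leaf_mem d0v.
have d0w : same (sub c) d0 w by exact: joined_far.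
have EC : component b le T (twist_sub c) v = circle b (sub c) w.
  rewrite -{1}d0v component_state ?twist_sub_live //.
  have := uc; rewrite in_unknotP => /eqP <-.
  by apply/eqP; rewrite eq_circle.
have ED : component b le T (twist_sub c) v :\: v = circle b (sub c') w.
  apply/setP => z; rewrite EC inE !mem_circle -at_same atE.
  case: (boolP (z \in v)) => //= zv; apply/esym/negP => /(same_leaf uc' KW' eK').
  by rewrite far_notin zv.
have out z : ~~ same (sub c) w z -> circle b (sub c) z = circle b (sub c') z.
  by move=> nz; rewrite -{1}[sub c](toggleK e) -E circle_toggle_out // at_same.
rewrite ED EC -!/(lab _ _); split=> [/and3P[/eqP h1 /eqP h2 /forall_inP h3]|[h1 h2 h3]].
  split=> // z; rewrite -E at_same => nz.
  have := h3 _ (circle_in_faces b (sub c) z); rewrite eq_circle same_sym nz /= {1}out //.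
  by move/eqP.
apply/and3P; split; rewrite ?h1 ?h2 //.
apply/forall_inP => f /imsetP[z _ ->]; apply/implyP; rewrite eq_circle same_sym => nz.
by rewrite {1}out // -/(lab c' z) h3 // -E at_same.
Qed.

(** For a negative twist, [Delta(a)] has exactly one term with the leaf labelled x, and its other
    label is [a]; for a positive twist the leaf is labelled by the unit and merging gives
    [m(1, a) = a]. The label of the leaf thus determines the partner. *)
Lemma leaf_edge_map :
  c' = leaf_mate e v c <->
  label c' v = ~~ neg e /\ (if neg e then edge_map c c' else edge_map c' c).
Proof.
have [d0 [d0v _ dd]] := leaf_darts; have d0in : d0 \in v by rewrite leaf_mem d0v.
have hw : lab c (dart0 e) = lab c w.
  by case: dd => -[_ ->] //; exact: lab_same.
have hw2 : lab c (dart2 e) = lab c w by rewrite -hw; apply/esym/lab_same.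
have E' : sub c = toggle (sub c') e by rewrite E toggleK.
have j : joined (sub c) e by rewrite joined_sub.
rewrite leaf_labels; case nE : (neg e) => /=.
  rewrite (edge_map_split E j) hw.
  have -> : ((lab c' (dart0 e), lab c' (dart2 e)) \in split_label (lab c w)) =
      ((label c' v, lab c' w) \in split_label (lab c w)).
    rewrite (label_v d0in); case: dd => -[-> ->] //.
    by case: (lab c _); case: (lab c' _); case: (lab c' _).
  split=> [[-> -> h]|[hv /andP[/forallP h1]]].
    split=> //; apply/andP; split; last by case: (lab c w).
    by apply/forallP => z; apply/implyP => /h ->.
  rewrite hv => h2; split=> //; first by move: h2; case: (lab c w); case: (lab c' w).
  by move=> z nz; apply/eqP/(implyP (h1 z)).
rewrite (edge_map_merge E' unjoined_c') hw.
have -> : merge_label (lab c' (dart0 e)) (lab c' (dart2 e)) = merge_label (label c' v) (lab c' w).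
  by rewrite (label_v d0in); case: dd => -[-> ->] //; exact: merge_labelC.
split=> [[-> -> h]|[hv /andP[/forallP h1]]].
  split=> //; apply/andP; split; last by case: (lab c w).
  by apply/forallP => z; apply/implyP => /h ->.
rewrite hv => h2; split=> //; first by move: h2; case: (lab c w); case: (lab c' w).
by move=> z nz; apply/esym/eqP/(implyP (h1 z)).
Qed.
End LeafEdge.

Lemma leaf_pairP c c' : surviving W c ->
  leaf_pair le T e v c c' <-> e \in twist_sub c /\ c' = leaf_mate e v c.
Proof.
move=> /and3P[uc KW _]; split=> [h|[eK Ec]].
  have /and3P[eK /eqP E _] := h; split=> //.
  exact/(leaf_pair_mate uc KW eK E).
by apply/(leaf_pair_mate uc KW eK); rewrite // Ec.
Qed.

Lemma in_A_edges c : in_unknot le T c ->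
  (e \in A_edges b (sub c)) = (neg e == (e \in twist_sub c)).
Proof.
rewrite in_unknotP => /eqP E; rewrite inE {1 2}E [e \in state _]in_set coreE.
rewrite [e \in symdiff _ _]in_set eL /negative_twist -in_live eL addbT.
by case: (positive_edge b e); case: (e \in T); case: (e \in twist_sub c).
Qed.

Lemma leaf_mate_coef c : surviving W c -> e \in twist_sub c ->
  (if neg e then kh_coef le c (leaf_mate e v c) else kh_coef le (leaf_mate e v c) c) ^+ 2 = 1.
Proof.
move=> sc eK; have /and3P[uc KW _] := sc.
have [_ hm] := (leaf_edge_map uc KW eK (leaf_mate_sub c)).1 erefl.
have [uc' Kc'] := toggle_unknot uc (leaf_mate_sub c).
have E' : sub c = toggle (sub (leaf_mate e v c)) e by rewrite leaf_mate_sub toggleK.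
case: ifP hm => nE hm.
  rewrite (kh_coef_toggle le (leaf_mate_sub c)) in_A_edges // nE eK hm /= mulr1.
  by rewrite sqrr_sign.
rewrite (kh_coef_toggle le E') in_A_edges // nE leaf_mate_twist // eK hm /= mulr1.
by rewrite sqrr_sign.
Qed.

Lemma kh_coef_leaf_label c c' : surviving W c -> surviving W c' -> kh_coef le c c' != 0 ->
  e \notin twist_sub c -> e \notin twist_sub c' -> label c v = label c' v.
Proof.
move=> /and3P[uc KW _] /and3P[uc' KW' _] /kh_coef_neq0[g [_ _ /andP[/forall_inP h _]]] eK eK'.
have [d0 [d0v _ _]] := leaf_darts.
apply/esym/eqP/h; rewrite inE -{1}(leaf_isolated uc KW eK d0v).
by rewrite -(leaf_isolated uc' KW' eK' d0v) !circle_in_faces.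
Qed.

Lemma kh_coef_leaf_toggle c c' : in_unknot le T c -> in_unknot le T c' ->
  kh_coef le c c' != 0 -> (e \in twist_sub c) != (e \in twist_sub c') ->
  [/\ sub c' = toggle (sub c) e, edge_map c c' & neg e = (e \in twist_sub c)].
Proof.
move=> uc uc' /kh_coef_neq0[g [Eg gA hg]] ne.
have eg : e = g.
  apply/eqP/negPn/negP => eg; case/negP: ne; apply/eqP.
  by rewrite !mem_twist_sub Eg in_toggle (negPf eg).
subst g; split=> //; move: gA; rewrite in_A_edges // => /eqP ->.
by [].
Qed.

Lemma kh_coef_leaf_mate c c' : surviving W c -> surviving W c' -> kh_coef le c c' != 0 ->
  ~~ leaf_unpaired le T e v c -> ~~ leaf_unpaired le T e v c' ->
  (e \in twist_sub c) != (e \in twist_sub c') -> c' = leaf_mate e v c.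
Proof.
move=> sc sc' h np np' ne; have /and3P[uc KW _] := sc; have /and3P[uc' KW' _] := sc'.
have [E hm nE] := kh_coef_leaf_toggle uc uc' h ne.
have [eK|eK] := boolP (e \in twist_sub c).
  apply/(leaf_edge_map uc KW eK E); rewrite nE eK; split=> //.
  move: ne np'; rewrite eK /leaf_unpaired; case: (e \in _) => //= _.
  by rewrite nE eK; case: label.
have eK' : e \in twist_sub c' by move: ne; rewrite (negPf eK); case: (e \in _).
rewrite -(leaf_mateK sc' np'); congr (leaf_mate _ _ _).
apply/esym/(leaf_edge_map uc' KW' eK'); first by rewrite E toggleK.
rewrite nE (negPf eK); split=> //.
by move: np; rewrite /leaf_unpaired eK nE (negPf eK); case: label.
Qed.
End Leaf.

(** * The matching of U(T) as an involution *)

Fixpoint leaf_seq (n : nat) W : seq (X * {set dart}) :=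
  if n is m.+1 then
    if [pick ev : X * {set dart} | smallest_leaf_edge b le T W ev.1 ev.2] is Some ev
    then ev :: leaf_seq m (W :\ ev.2) else [::]
  else [::].

(** Since the smallest leaf is unique, the deletions down to the root form a list. Induction on it
    replaces the recursion on G(T); the number in [leaf_seq] only bounds the recursion. *)
Inductive eliminates W : seq (X * {set dart}) -> Prop :=
| ElimRoot : W = [set root] -> eliminates W [::]
| ElimLeaf e v l : smallest_leaf_edge b le T W e v -> eliminates (W :\ v) l ->
    eliminates W ((e, v) :: l).

Lemma eliminates_leaf_seq n W : good_set W -> (#|W| <= n.+1)%N -> eliminates W (leaf_seq n W).
Proof.
have root1 W' : good_set W' -> (#|W'| <= 1)%N -> W' = [set root].
  move=> [rW _ _ _] h; apply/esym/eqP; by rewrite eqEcard sub1set rW cards1.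
elim: n W => [|n IH] W gW hn /=; first by apply: ElimRoot; exact: root1.
case: pickP => [[e v] /= hev|no].
  have /andP[leafW _] := hev; apply: ElimLeaf => //; apply: IH; first exact: good_delete leafW.
  move: hn; rewrite (cardsD1 v); move: leafW; rewrite leaf_edgeE => /and5P[-> _ _ _ _].
  by rewrite add1n ltnS.
apply: ElimRoot; apply: root1 => //; rewrite leqNgt; apply/negP => W1.
by have [e [v h]] := smallest_leaf_exists gW W1; have := no (e, v); rewrite /= h.
Qed.

Fixpoint seq_mate l c : enhanced b :=
  if l is (e, v) :: l' then
    if leaf_unpaired le T e v c then seq_mate l' c else leaf_mate e v c
  else c.

(* Decreases along gradient paths: for a negative twist [e], such a path can
   leave the pairs of the first leaf but not enter them, for a positive twist
   it is the other way round. *)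
Fixpoint seq_rank l c : nat :=
  if l is (e, v) :: l' then
    if leaf_unpaired le T e v c then (~~ neg e + seq_rank l' c)%N
    else if neg e then (2 ^ size l')%N else 0%N
  else 0%N.

Lemma leaf_of_smallest W e v : smallest_leaf_edge b le T W e v -> leaf_edge b le T W e v.
Proof. by case/andP. Qed.

Lemma unpaired_surviving W e v c : good_set W -> leaf_edge b le T W e v -> surviving W c ->
  leaf_unpaired le T e v c -> surviving (W :\ v) c.
Proof. by move=> gW lW sc; rewrite (unpairedE gW lW sc). Qed.

Lemma surviving_delete W e v c : good_set W -> leaf_edge b le T W e v ->
  surviving (W :\ v) c -> surviving W c /\ leaf_unpaired le T e v c.
Proof.
move=> gW lW sc; have /and3P[uc KW /forall_inP hl] := sc.
suff sW : surviving W c by split=> //; rewrite (unpairedE gW lW).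
apply/and3P; split=> //.
  by apply: fintype.subset_trans KW _; rewrite (inner_delete lW) subD1set.
apply/forall_inP => u uf; apply/implyP => uW; have := hl u uf.
by rewrite !inE (negPf uW) andbF.
Qed.

Lemma surviving_seq_mate W l c : good_set W -> eliminates W l -> surviving W c ->
  surviving W (seq_mate l c).
Proof.
move=> gW el; elim: el gW c => {W l} [W _|W e v l /leaf_of_smallest lW el IH] //= gW c sc.
case: ifP => up; last exact: surviving_leaf_mate.
have gD := good_delete gW lW; have sD := unpaired_surviving gW lW sc up.
by case: (surviving_delete gW lW (IH gD c sD)).
Qed.

Lemma seq_mateK W l c : good_set W -> eliminates W l -> surviving W c ->
  seq_mate l (seq_mate l c) = c.
Proof.
move=> gW el; elim: el gW c => {W l} [W _|W e v l /leaf_of_smallest lW el IH] //= gW c sc.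
case: (boolP (leaf_unpaired le T e v c)) => up; last by rewrite (negPf (leaf_mate_paired lW sc)) (leaf_mateK lW).
have gD := good_delete gW lW; have sD := unpaired_surviving gW lW sc up.
have [_ ->] := surviving_delete gW lW (surviving_seq_mate gD el sD).
exact: IH.
Qed.

Lemma seq_rank_mate W l c : good_set W -> eliminates W l -> surviving W c ->
  seq_rank l (seq_mate l c) = seq_rank l c.
Proof.
move=> gW el; elim: el gW c => {W l} [W _|W e v l /leaf_of_smallest lW el IH] //= gW c sc.
case: (boolP (leaf_unpaired le T e v c)) => up; last by rewrite (negPf (leaf_mate_paired lW sc)).
have gD := good_delete gW lW; have sD := unpaired_surviving gW lW sc up.
have [_ ->] := surviving_delete gW lW (surviving_seq_mate gD el sD).
by rewrite IH.
Qed.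

Lemma leaf_mate_neq e v c : leaf_mate e v c != c.
Proof.
apply/eqP => /(congr1 (fun c' => e \in sub c')); rewrite leaf_mate_sub in_toggle eqxx /=.
by case: (e \in sub c).
Qed.

Lemma seq_mate_coef W l c : good_set W -> eliminates W l -> surviving W c ->
  seq_mate l c != c ->
  kh_coef le c (seq_mate l c) ^+ 2 = 1 \/ kh_coef le (seq_mate l c) c ^+ 2 = 1.
Proof.
move=> gW el; elim: el gW c => {W l} [W _|W e v l /leaf_of_smallest lW el IH] //= gW c sc.
  by rewrite eqxx.
case: (boolP (leaf_unpaired le T e v c)) => up; first by apply: IH (good_delete gW lW) _ (unpaired_surviving gW lW sc up).
move=> _; have [eK|eK] := boolP (e \in twist_sub c).
  by have := leaf_mate_coef lW sc eK; case: ifP; [left|right].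
have sm := surviving_leaf_mate lW sc; have /and3P[uc _ _] := sc.
have := leaf_mate_coef lW sm; rewrite (leaf_mate_twist lW uc) eK => /(_ isT).
by rewrite (leaf_mateK lW) //; case: ifP; [right|left].
Qed.

(** This bound makes the value [2 ^ size l'] given to the pairs of a negative leaf larger than the
    ranks of all generators left to later leaves. *)
Lemma seq_rank_lt l c : (seq_rank l c < 2 ^ size l)%N.
Proof.
elim: l => [//|[e v] l IH] /=; rewrite expnS.
have := expn_gt0 2 (size l); move: IH; case: ifP => _; case: (neg e) => /=; lia.
Qed.

Lemma seq_rank_decr W l (u w : enhanced b) : good_set W -> eliminates W l -> surviving W u -> surviving W w ->
  kh_coef le u (seq_mate l u) != 0 -> kh_coef le (seq_mate l w) w != 0 ->
  w != seq_mate l u -> kh_coef le u w != 0 -> (seq_rank l w < seq_rank l u)%N.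
Proof.
move=> gW el; elim: el gW u w => {W l} [W _|W e v l /leaf_of_smallest lW el IH] gW u w su sw /=.
  move=> /kh_coef_neq0[f [h _ _]]; exfalso.
  have := congr1 (fun H : {set X} => f \in H) h; rewrite in_toggle eqxx /=.
  by case: (f \in sub u).
have /and3P[uu _ _] := su; have /and3P[uw _ _] := sw.
case: (boolP (leaf_unpaired le T e v u)) => upu; case: (boolP (leaf_unpaired le T e v w)) => upw hu hw uw' h.
- rewrite ltn_add2l; apply: (IH (good_delete gW lW)) => //; exact: unpaired_surviving lW _ _.
(* A path enters the pairs of this leaf. If [e] were absent from [w], the leaf would be isolated in
   both [u] and [w] and keep its label, whereas only [u] has the unpaired label. So [e] is present
   in [w], and as [w] is a target, the twist is positive. *)
- have sm := surviving_leaf_mate lW sw; have /and3P[um _ _] := sm.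
  have [_ _ nE] := kh_coef_leaf_toggle lW um uw hw
    (ltac:(by rewrite (leaf_mate_twist lW uw); case: (_ \in _))).
  rewrite nE (leaf_mate_twist lW uw).
  have [eK|eK] /= := boolP (e \in twist_sub w); first by rewrite add1n.
  case/andP: upu => eKu /eqP lu; move: upw; rewrite /leaf_unpaired eK /=.
  by rewrite -(kh_coef_leaf_label lW su sw h eKu eK) lu eqxx.
- have sm := surviving_leaf_mate lW su; have /and3P[um _ _] := sm.
  have [_ _ nE] := kh_coef_leaf_toggle lW uu um hu
    (ltac:(by rewrite (leaf_mate_twist lW uu); case: (_ \in _))).
  rewrite nE; have [eK|eK] /= := boolP (e \in twist_sub u); first exact: seq_rank_lt.
  case/andP: upw => eKw /eqP lw; move: upu; rewrite /leaf_unpaired eK /=.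
  by rewrite (kh_coef_leaf_label lW su sw h eK eKw) lw eqxx.
(* Both generators belong to pairs of this leaf, one as source and one as target, so [e] is present
   in exactly one of them and [w] would be the partner of [u]. *)
- have sm := surviving_leaf_mate lW su; have /and3P[um _ _] := sm.
  have [_ _ nEu] := kh_coef_leaf_toggle lW uu um hu
    (ltac:(by rewrite (leaf_mate_twist lW uu); case: (_ \in _))).
  have sm' := surviving_leaf_mate lW sw; have /and3P[um' _ _] := sm'.
  have [_ _ nEw] := kh_coef_leaf_toggle lW um' uw hw
    (ltac:(by rewrite (leaf_mate_twist lW uw); case: (_ \in _))).
  rewrite (leaf_mate_twist lW uw) nEu in nEw.
  case/eqP: uw'; apply: (kh_coef_leaf_mate lW) => //.
  by rewrite nEw; case: (_ \in _).
Qed.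

Lemma seq_mate_fixed W l c : good_set W -> eliminates W l -> surviving W c ->
  (seq_mate l c == c) = surviving [set root] c.
Proof.
move=> gW el; elim: el gW c => {W l} [W EW|W e v l /leaf_of_smallest lW el IH] gW c sc /=.
  by rewrite eqxx -EW sc.
have gD := good_delete gW lW.
case: (boolP (leaf_unpaired le T e v c)) => up; first exact: IH (unpaired_surviving gW lW sc up).
rewrite (negPf (leaf_mate_neq e v c)); apply/esym/negP => sr; case/negP: up.
rewrite (unpairedE gW lW sc); have /and3P[uc KR /forall_inP hl] := sr.
have rD : root \in W :\ v by case: gD.
have inS (A B : {set {set dart}}) : A \subset B -> inner_edges A \subset inner_edges B.
  move=> AB; apply/fintype.subsetP => f; rewrite !mem_inner => /andP[-> h] /=.
  exact: fintype.subset_trans AB.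
apply/and3P; split=> //; first by apply: fintype.subset_trans KR (inS _ _ _); rewrite sub1set.
apply/forall_inP => x xf; apply/implyP => xD; have := hl x xf; rewrite inE.
by have -> : x == root = false by apply: contraNF xD => /eqP ->.
Qed.

Lemma tree_matching_mate W l c c' : good_set W -> eliminates W l -> surviving W c ->
  tree_matching le T W c c' -> c' = seq_mate l c /\ c' != c.
Proof.
move=> gW el; elim: el gW c c' => {W l} [W EW|W e v l sl el IH] gW c c' sc h.
  have no e v : smallest_leaf_edge b le T W e v -> False.
    move=> /leaf_of_smallest; rewrite leaf_edgeE EW inE => /and5P[/eqP -> + _ _ _].
    by rewrite eqxx.
  by case: h EW gW sc no => [W' e v ? ? s _|W' e v ? ? s _ _ _] _ _ _ /(_ _ _ s).
have lW := leaf_of_smallest sl.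
case: h gW sl el IH lW sc => {W c c'} [W e' v' c c' s' hp|W e' v' c c' s' up up' hm] gW sl el IH lW sc.
  have [? ?] := smallest_leaf_uniq gW sl s'; subst e' v'.
  have [eK ->] := (leaf_pairP lW c' sc).1 hp.
  by rewrite /= /leaf_unpaired eK /= leaf_mate_neq.
have [? ?] := smallest_leaf_uniq gW sl s'; subst e' v'.
rewrite /= up; apply: IH => //; first exact: good_delete lW.
exact: unpaired_surviving up.
Qed.

Lemma seq_mate_matching W l c : good_set W -> eliminates W l -> surviving W c ->
  seq_mate l c != c ->
  tree_matching le T W c (seq_mate l c) \/ tree_matching le T W (seq_mate l c) c.
Proof.
move=> gW el; elim: el gW c => {W l} [W EW|W e v l sl el IH] gW c sc /=; first by rewrite eqxx.
have lW := leaf_of_smallest sl.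
case: (boolP (leaf_unpaired le T e v c)) => up ne.
  have gD := good_delete gW lW; have sD := unpaired_surviving gW lW sc up.
  have [_ up'] := surviving_delete gW lW (surviving_seq_mate gD el sD).
  by case: (IH gD c sD ne) => h; [left|right]; apply: MatchDelete sl _ _ h.
have [eK|eK] := boolP (e \in twist_sub c).
  by left; apply: MatchLeaf sl _; apply/(leaf_pairP lW _ sc).
right; apply: MatchLeaf sl _; have sm := surviving_leaf_mate lW sc.
have /and3P[uc _ _] := sc.
by apply/(leaf_pairP lW _ sm); rewrite (leaf_mate_twist lW uc) eK (leaf_mateK lW).
Qed.
End Tree.
End Unknot.

(** * The matching on all states *)

Section SpanningTreeComplex.
Variables (L : link_diagram) (b : checkerboard L).
Local Notation X := (crossing L).
Local Notation dart := (half_arc (crossing L)).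
Variable le : rel X.
Hypotheses (le_total : total le) (le_antisym : antisymmetric le) (le_trans : transitive le).
Implicit Types (H K S T U A B : {set X}) (e f g x : X) (d : dart) (c : enhanced b).

Lemma surviving_root T c : spanning_tree b T ->
  surviving le T [set root b le T] c <-> exists s, c = critical b le T s.
Proof.
move=> hT; have E0 : inner_edges b le T [set root b le T] = finset.set0.
  apply/setP => e; rewrite mem_inner in_set0; apply/negP => /andP[eL].
  move/subset_leq_card; rewrite card_twist_ends // cards1 //.
rewrite /surviving E0 subset0.
split=> [/and3P[uc /eqP K0 /forall_inP hl]|[s ->]].
  have Es : sub c = core b le T.
    by move: uc; rewrite in_unknotP K0 state0 => /eqP.
  exists (label c (root b le T)); apply: enhanced_ext => [//|d].
  rewrite /lab Es /= -/(vertex b le T d) /critical /label /ones /= inE circle_in_faces /=.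
  case: eqP => [-> //|/eqP nr].
  by have := hl _ (circle_in_faces b (core b le T) d); rewrite inE nr /= => /eqP.
have Es : sub (critical b le T s) = state b le T finset.set0 by rewrite state0.
have K0 : twist_sub le T (critical b le T s) = finset.set0 by apply: twist_subE; rewrite ?sub0set.
apply/and3P; split; [exact: (in_unknot_of_state (sub0set _) Es)|by rewrite K0|].
apply/forall_inP => v vf; rewrite inE; apply/implyP => nr.
by rewrite /label /ones /critical /= inE vf (negPf nr).
Qed.

(** * Comparing edge sets from the largest edge down *)

Definition edge_rank e : nat := #|[set f | le f e && (f != e)]|.

Lemma edge_rank_lt e f : le f e -> f != e -> (edge_rank f < edge_rank e)%N.
Proof.
move=> fe nfe; apply: proper_card; apply/properP; split.
  apply/fintype.subsetP => g; rewrite !inE => /andP[gf ngf].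
  rewrite (le_trans gf fe); apply: contraNneq ngf => ge.
  by apply/eqP/le_antisym; rewrite gf ge fe.
by exists f; rewrite !inE ?fe ?nfe ?eqxx ?andbF.
Qed.

Lemma edge_rank_inj : injective edge_rank.
Proof.
move=> e f E; apply/eqP/negPn/negP => ef.
case/orP: (le_total e f) => h.
  by have := edge_rank_lt h ef; rewrite E ltnn.
by rewrite eq_sym in ef; have := edge_rank_lt h ef; rewrite E ltnn.
Qed.

(** The binary number with digits indexed by rank: the lexicographic order from the largest edge
    down becomes the order of the natural numbers. *)
Definition edge_weight A : nat := \sum_(x in A) 2 ^ edge_rank x.

Lemma sum_edge_rank_lt n : (\sum_(x | (edge_rank x < n)%N) 2 ^ edge_rank x < 2 ^ n)%N.
Proof.
elim: n => [|n IH]; first by rewrite big_pred0.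
rewrite (bigID (fun x => edge_rank x == n)) /= expnS mul2n -addnn -addnS.
apply: leq_add; last first.
  apply: leq_ltn_trans IH; rewrite [X in (_ <= X)%N]big_mkcond [X in (X <= _)%N]big_mkcond.
  by apply: leq_sum => x _; rewrite ltnS ltn_neqAle andbC.
have [/existsP[x /eqP hx]|/existsPn no] := boolP [exists x, edge_rank x == n].
  rewrite (big_pred1 x) ?hx // => y; rewrite /= -hx (inj_eq edge_rank_inj).
  by case: eqP => [->|]; rewrite ?ltnSn ?andbF.
by rewrite big_pred0 // => x; rewrite (negPf (no x)) andbF.
Qed.

Lemma edge_weight_lt A B e : e \in A -> e \notin B ->
  (forall x, le e x -> x != e -> (x \in A) = (x \in B)) -> (edge_weight B < edge_weight A)%N.
Proof.
move=> eA eB h; rewrite /edge_weight.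
rewrite (bigID (fun x => (edge_rank x < edge_rank e)%N)) /=.
rewrite [X in (_ < X)%N](bigD1 e) //= [X in (_ < _ + X)%N](bigID (fun x => (edge_rank x < edge_rank e)%N)) /=.
rewrite -addSn; apply: leq_add.
  apply: leq_ltn_trans (sum_edge_rank_lt (edge_rank e)).
  rewrite [X in (_ <= X)%N]big_mkcond [X in (X <= _)%N]big_mkcond; apply: leq_sum => x _.
  by case: (x \in B); case: (_ < _)%N.
apply: leq_trans (leq_addl _ _); apply: eq_leq; apply: eq_bigl => x.
have [->|xe] := eqVneq x e; first by rewrite (negPf eB) andbF.
rewrite andbT; case: (ltnP (edge_rank x) (edge_rank e)) => hx; rewrite ?andbF ?andbT //.
case/orP: (le_total e x) => hle; first by rewrite h.
by have := edge_rank_lt hle xe; rewrite ltnNge hx.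
Qed.

Lemma spanning_tree_exists : exists T, spanning_tree b T.
Proof.
have P0 : ncomps b [set: X] == 1%N by rewrite ncompsT.
case: (@arg_minnP _ [set: X] (fun T => ncomps b T == 1%N) (fun T : {set X} => #|T|) P0) => T /eqP kT hmin.
exists T; rewrite /spanning_tree tait_connectedE kT eqxx /=.
apply/forall_inP => C CT; apply/negP => Cc.
have /and3P[/set0Pn[e eC] _ _] := Cc; have eT := fintype.subsetP CT e eC.
have := hmin (T :\ e); rewrite (ncomps_add b (T :\ e) e) setD1K // kT.
rewrite (tait_connS _ (cycle_conn Cc eC)) ?setSD // => /(_ isT).
by rewrite (cardsD1 e T) eT; lia.
Qed.

Lemma not_live T e : spanning_tree b T -> ~~ live b le T e ->
  exists f, [/\ (e \in T) != (f \in T), spanning_tree b (swap T e f), le f e & f != e].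
Proof.
move=> hT nl; have [/existsP[f /and3P[h1 h2 h3]]|/existsPn no] :=
  boolP [exists f, [&& (e \in T) != (f \in T), spanning_tree b (swap T e f) & ~~ le e f]].
  exists f; split=> //; first by have := le_total e f; rewrite (negPf h3).
  by apply: contraNneq h3 => ->; exact: le_refl.
case/negP: nl; apply/(liveP e hT (le_refl le_total)) => f h1 h2.
by have := no f; rewrite h1 h2 /= negbK.
Qed.

(* The tree for which the edges of the symmetric difference with [H] have
   lexicographically the smallest ranks. *)
Lemma unknot_exists c : exists T, spanning_tree b T && in_unknot le T c.
Proof.
have [T0 hT0] := spanning_tree_exists.
case: (@arg_minnP _ T0 (spanning_tree b) (fun T : {set X} => edge_weight (symdiff T (sub c))) hT0) => T hT hmin.
exists T; rewrite hT; apply/forallP => e; apply/implyP => /(not_live hT)[f [ef hS fe nfe]].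
(* A dead edge that disagreed with [sub c] could be exchanged with a smaller [f]. Then [e] would
   leave the symmetric difference and at most the smaller [f] would enter, against minimality. *)
suff : (e \in T) = (e \in sub c) by case: ifP => _ <-.
apply/eqP/negPn/negP => ne; have := hmin _ hS; rewrite leqNgt => /negP; apply.
apply: (edge_weight_lt (e := e)).
- by rewrite inE; move: ne; case: (e \in T); case: (e \in sub c).
- rewrite inE /swap !in_toggle eqxx eq_sym (negPf nfe) /=.
  by move: ne; case: (e \in T); case: (e \in sub c).
move=> x ex nx; rewrite !inE /swap !in_toggle (negPf nx) /=.
have -> // : x == f = false.
by apply: contraNF nx => /eqP xf; apply/eqP/le_antisym; rewrite ex xf fe.
Qed.

(** Exchange provides a partner for [e] that again lies in the difference, hence is smaller than
    [e]; so [e] is dead in both trees. *)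
Lemma largest_difference T T' : spanning_tree b T -> spanning_tree b T' -> T != T' ->
  exists e, [/\ (e \in T) != (e \in T'), forall x, le e x -> x != e -> (x \in T) = (x \in T'),
    ~~ live b le T e & ~~ live b le T' e].
Proof.
move=> hT hT' ne; have [e0 he0] : exists e, e \in symdiff T T'.
  apply/existsP; apply: contraR ne => /existsPn h; apply/eqP/setP => e.
  by have := h e; rewrite inE; case: (e \in T); case: (e \in T').
case: (@arg_maxnP _ e0 (mem (symdiff T T')) edge_rank he0) => e he hmax.
have big x : le e x -> x != e -> (x \in T) = (x \in T').
  move=> ex nx; apply/eqP/negPn/negP => hx; rewrite eq_sym in nx.
  have := hmax x; have := edge_rank_lt ex nx; rewrite ltnNge => /negP h h'; apply: h; apply: h'.
  by rewrite !inE; move: hx; case: (x \in T); case: (x \in T').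
have he' : (e \in T) != (e \in T') by move: he; rewrite !inE; case: (e \in T); case: (e \in T').
have dead U U' : spanning_tree b U -> spanning_tree b U' -> (e \in U) != (e \in U') ->
    (forall x, le e x -> x != e -> (x \in U) = (x \in U')) -> ~~ live b le U e.
  move=> hU hU' hUU bigU; have [f [fU ef hS]] := tree_exchange hU hU' hUU.
  apply/negP => /(liveP e hU (le_refl le_total)) /(_ f ef hS) lef.
  case/eqP: fU; apply: bigU => //; by apply: contraNneq ef => ->.
exists e; split=> //; first exact: (dead T T').
by apply: (dead T' T); rewrite // 1?eq_sym // => x ex nx; rewrite big.
Qed.

Lemma dead_mem T c e : in_unknot le T c -> ~~ live b le T e -> (e \in sub c) = (e \in T).
Proof. by move=> /forallP/(_ e)/implyP h /h; case: (e \in T) => // /negPf. Qed.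

Lemma unknot_uniq T T' c : spanning_tree b T -> spanning_tree b T' ->
  in_unknot le T c -> in_unknot le T' c -> T = T'.
Proof.
move=> hT hT' uc uc'; apply/eqP/negPn/negP => /(largest_difference hT hT')[e [ne _ d d']].
by move: ne; rewrite -(dead_mem uc d) -(dead_mem uc' d') eqxx.
Qed.

Definition tree_weight T : nat := edge_weight (A_edges b T).

Lemma kh_coef_tree_weight T T' c c' : spanning_tree b T -> spanning_tree b T' ->
  in_unknot le T c -> in_unknot le T' c' -> kh_coef le c c' != 0 -> T != T' ->
  (tree_weight T' < tree_weight T)%N.
Proof.
move=> hT hT' uc uc' /kh_coef_neq0[g [Eg gA _]] /(largest_difference hT hT')[e [ne big d d']].
have ge : e = g.
  apply/eqP/negPn/negP => eg; case/negP: ne.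
  by rewrite -(dead_mem uc d) -(dead_mem uc' d') Eg in_toggle (negPf eg).
subst g; have Ae (U : {set X}) x : x \in A_edges b U = (if positive_edge b x then x \in U else x \notin U).
  by rewrite inE.
have eA : e \in A_edges b T by move: gA; rewrite !Ae (dead_mem uc d).
apply: (edge_weight_lt (e := e)) => //.
  move: eA; rewrite !Ae; move: ne; by case: positive_edge; case: (e \in T); case: (e \in T').
by move=> x ex nx; rewrite !Ae big.
Qed.

Definition tree_of c : {set X} := xchoose (unknot_exists c).

Lemma tree_of_spanning c : spanning_tree b (tree_of c).
Proof. by have /andP[] := xchooseP (unknot_exists c). Qed.

Lemma tree_of_unknot c : in_unknot le (tree_of c) c.
Proof. by have /andP[] := xchooseP (unknot_exists c). Qed.

Lemma tree_of_eq T c : spanning_tree b T -> in_unknot le T c -> tree_of c = T.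
Proof.
by move=> hT uc; apply: unknot_uniq uc => //; [exact: tree_of_spanning|exact: tree_of_unknot].
Qed.

(** * One involution and one rank for all generators *)

Definition all_vertices T := faces b (core b le T).
Definition tree_leaves T := leaf_seq b le T #|all_vertices T| (all_vertices T).

Lemma all_vertices_good T : spanning_tree b T -> good_set b le T (all_vertices T).
Proof. exact: good_faces. Qed.

Lemma tree_leaves_eliminates T : spanning_tree b T ->
  eliminates b le T (all_vertices T) (tree_leaves T).
Proof.
by move=> hT; apply: eliminates_leaf_seq => //; exact: all_vertices_good.
Qed.

Definition kh_mate c : enhanced b := seq_mate le (tree_of c) (tree_leaves (tree_of c)) c.

Lemma surviving_tree_of c : surviving le (tree_of c) (all_vertices (tree_of c)) c.
Proof.
by rewrite surviving_faces ?tree_of_unknot //; exact: tree_of_spanning.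
Qed.

Lemma tree_of_mate c : tree_of (kh_mate c) = tree_of c.
Proof.
have hT := tree_of_spanning c; apply: tree_of_eq => //.
have := surviving_seq_mate le_total le_antisym hT (all_vertices_good hT)
  (tree_leaves_eliminates hT) (surviving_tree_of c).
by case/and3P.
Qed.

Lemma kh_mateK : involutive kh_mate.
Proof.
move=> c; rewrite {1}/kh_mate tree_of_mate; have hT := tree_of_spanning c.
exact: seq_mateK (all_vertices_good hT) (tree_leaves_eliminates hT) (surviving_tree_of c).
Qed.

Lemma kh_mate_unit c : kh_mate c != c ->
  kh_coef le c (kh_mate c) ^+ 2 = 1 \/ kh_coef le (kh_mate c) c ^+ 2 = 1.
Proof.
have hT := tree_of_spanning c.
exact: seq_mate_coef (all_vertices_good hT) (tree_leaves_eliminates hT) (surviving_tree_of c).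
Qed.

Definition leaf_rank c : nat := seq_rank le (tree_of c) (tree_leaves (tree_of c)) c.

(** A lexicographic pair: the factor exceeds every leaf rank, so the tree weight decides first. *)
Definition kh_rank c : nat :=
  (tree_weight (tree_of c) * (\max_(c0 : enhanced b) leaf_rank c0).+1 + leaf_rank c)%N.

Lemma leaf_rank_mate c : leaf_rank (kh_mate c) = leaf_rank c.
Proof.
rewrite /leaf_rank tree_of_mate; have hT := tree_of_spanning c.
exact: seq_rank_mate (all_vertices_good hT) (tree_leaves_eliminates hT) (surviving_tree_of c).
Qed.

Lemma kh_rank_mate c : kh_rank (kh_mate c) = kh_rank c.
Proof. by rewrite /kh_rank leaf_rank_mate tree_of_mate. Qed.

Lemma kh_rank_decr (u w : enhanced b) : kh_coef le u (kh_mate u) != 0 ->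
  kh_coef le (kh_mate w) w != 0 -> w != kh_mate u -> kh_coef le u w != 0 ->
  (kh_rank (kh_mate w) < kh_rank u)%N.
Proof.
move=> hu hw wu h; rewrite kh_rank_mate /kh_rank; set B := \max_(_ : enhanced b) _.
have rw : (leaf_rank w <= B)%N by exact: leq_bigmax.
have hT := tree_of_spanning u.
have [E|ne] := eqVneq (tree_of u) (tree_of w).
  have sw := surviving_tree_of w; rewrite /kh_mate /leaf_rank -E in hw sw *.
  rewrite ltn_add2l; apply: (seq_rank_decr le_total le_antisym hT (all_vertices_good hT)
    (tree_leaves_eliminates hT) (surviving_tree_of u) sw) => //.
have := kh_coef_tree_weight hT (tree_of_spanning w) (tree_of_unknot u) (tree_of_unknot w) h ne.
move: (tree_weight _) (tree_weight _) => m n mn.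
apply: leq_trans (leq_addr _ _); apply: (@leq_trans (n.+1 * B.+1)); last by rewrite leq_mul2r mn orbT.
by rewrite mulSn addnC -addSn leq_add2r ltnS.
Qed.

Lemma kh_mate_critical c :
  reflect (exists t : signed_tree b, critical_of le t = c) (kh_mate c == c).
Proof.
have hT := tree_of_spanning c.
have E := seq_mate_fixed le_total le_antisym hT (all_vertices_good hT)
  (tree_leaves_eliminates hT) (surviving_tree_of c).
rewrite /kh_mate E; apply: (iffP idP) => [/(surviving_root c hT)[s ->]|[[[T hT'] s] <-]].
  by exists (exist _ (tree_of c) hT, s).
have sr : surviving le T [set root b le T] (critical b le T s).
  by apply/(surviving_root _ hT'); exists s.
by rewrite /critical_of /= (@tree_of_eq T) //; case/and3P: sr.
Qed.

Lemma critical_of_inj : injective (critical_of le : signed_tree b -> enhanced b).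
Proof.
move=> [[T hT] s] [[T' hT'] s']; rewrite /critical_of /= => E.
have uc (U : {set X}) r (hU : spanning_tree b U) : in_unknot le U (critical b le U r).
  have : surviving le U [set root b le U] (critical b le U r).
    by apply/(surviving_root _ hU); exists r.
  by case/and3P.
have TT : T = T' by apply: (unknot_uniq hT hT' (uc T s hT)); rewrite E; exact: uc.
subst T'; have := congr1 (fun c => label c (root b le T)) E.
rewrite /label /ones /critical /= !inE circle_in_faces eqxx /= => ->.
by congr (_, _); exact: val_inj.
Qed.

Lemma matchedE c c' : (matched le c c' \/ matched le c' c) <-> (c' = kh_mate c /\ c' != c).
Proof.
have aux (x y : enhanced b) : matched le x y -> y = kh_mate x /\ y != x.
  move=> [T [hT ux uy hm]]; have ET := tree_of_eq hT ux; subst T.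
  exact: tree_matching_mate (all_vertices_good hT) (tree_leaves_eliminates hT)
    (surviving_tree_of x) hm.
split=> [[/aux //|/aux[E ne]]|[-> ne]].
  by rewrite E kh_mateK eq_sym -E.
have hT := tree_of_spanning c.
have um := tree_of_unknot (kh_mate c); rewrite tree_of_mate in um.
by case: (seq_mate_matching le_total le_antisym hT (all_vertices_good hT)
  (tree_leaves_eliminates hT) (surviving_tree_of c) ne) => h; [left|right];
  exists (tree_of c); split=> //; exact: tree_of_unknot.
Qed.
End SpanningTreeComplex.

(** * Algebraic discrete Morse theory *)

(* Imported only here since their lemma names shadow those of finset. *)
From mathcomp Require Import boolp classical_sets fsbigop.
Local Open Scope quotient_scope.

(** * Sums over paths of bounded length *)

Section PathSums.
Variables (G : finType) (W : G -> G -> int).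

Fixpoint path_prod (c : G) (p : seq G) : int :=
  if p is c' :: p' then W c c' * path_prod c' p' else 1.

Fixpoint short_seqs (n : nat) : seq (seq G) :=
  if n is m.+1 then [::] :: [seq x :: p | x <- enum G, p <- short_seqs m] else [::].

Lemma mem_short_seqs n p : (p \in short_seqs n) = (size p < n)%N.
Proof.
elim: n p => [|n IH] [|x p] //=; rewrite in_cons /=.
rewrite ltnS -IH; apply/allpairsP/idP => [[[y q] /= [_ hq [_ ->]]] //|hp].
by exists (x, p); rewrite mem_enum.
Qed.

Lemma short_seqs_uniq n : uniq (short_seqs n).
Proof.
elim: n => //= n IH; apply/andP; split; first by apply/negP => /allpairsP[? []].
by apply: allpairs_uniq; rewrite ?enum_uniq // => -[x p] [y q] _ _ [-> ->].
Qed.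

Definition short_sum n c c' : int := \sum_(p <- short_seqs n | last c p == c') path_prod c p.

Lemma short_sumS n c c' :
  short_sum n.+1 c c' = (c == c')%:R + \sum_x W c x * short_sum n x c'.
Proof.
rewrite /short_sum /= big_cons /=.
have -> : \sum_(p <- [seq x :: p | x <- enum G, p <- short_seqs n] | last c p == c')
    path_prod c p = \sum_x W c x * \sum_(p <- short_seqs n | last x p == c') path_prod x p.
  rewrite big_mkcond big_allpairs_dep big_enum /=; apply: eq_bigr => x _.
  rewrite mulr_sumr [RHS]big_mkcond; apply: eq_bigr => p _ /=.
  by case: ifP.
by case: (c == c'); rewrite ?add0r.
Qed.

Definition nonzero_edge := [rel u v | W u v != 0].

Lemma path_prod_neq0 c p : path_prod c p != 0 -> path nonzero_edge c p.
Proof.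
elim: p c => //= x p IH c h; apply/andP; split; first by apply: contraNneq h => ->; rewrite mul0r.
by apply: IH; apply: contraNneq h => ->; rewrite mulr0.
Qed.

Lemma short_sum_neq0 n c c' : short_sum n c c' != 0 ->
  exists2 p, path nonzero_edge c p & last c p = c'.
Proof.
move=> h; have [p] : exists p, (path nonzero_edge c p) && (last c p == c').
  apply: contrapT => hn; move: h; rewrite /short_sum big1 ?eqxx // => p hp.
  by apply/eqP/negPn/negP => /path_prod_neq0 hc; apply: hn; exists p; rewrite hc.
by case/andP => hp /eqP; exists p.
Qed.

(** A sequence that is not a path has a factor 0, so the finite sum may run over all short sequences
    with the right end. *)
Lemma path_sumE n c c' :
  (forall p, path nonzero_edge c p -> last c p = c' -> (size p < n)%N) ->
  \sum_(p \in [set p : seq G | path nonzero_edge c p /\ last c p = c']%classic)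
    path_prod c p = short_sum n c c'.
Proof.
move=> h; rewrite (fsbig_fwiden [seq p <- short_seqs n | last c p == c']).
- by rewrite big_filter.
- move=> p [hp hl] /=; rewrite mem_filter hl eqxx mem_short_seqs; exact: h.
- by rewrite filter_uniq // short_seqs_uniq.
- move=> p [] /=; rewrite mem_filter => /andP[/eqP hl _] hn.
  by apply/eqP/negPn/negP => /path_prod_neq0 hp; apply: hn.
Qed.
End PathSums.

Lemma quot_additive_bijective (U U' : zmodType) (I : zmodClosed U) (I' : zmodClosed U')
    (g : U -> U') :
  {morph g : x y / x - y} -> (forall x, (g x \in I') = (x \in I)) ->
  (forall y, exists x, y - g x \in I') ->
  exists f : {additive Quotient.quot I -> Quotient.quot I'}, bijective f.
Proof.
move=> gB gI g_surj; pose Q := Quotient.quot I; pose Q' := Quotient.quot I'.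
pose f (q : Q) : Q' := \pi_Q' (g (generic_quotient.repr q)).
have f_pi x : f (\pi_Q x) = \pi_Q' (g x).
  by apply/eqP; rewrite -Quotient.idealrBE -gB gI Quotient.idealrBE reprK.
have fB : zmod_morphism f.
  move=> x y; rewrite -[x]reprK -[y]reprK -(raddfB \pi_Q) !f_pi gB.
  exact: (raddfB \pi_Q').
pose k (q : Q') : Q := \pi_Q (xchoose (g_surj (generic_quotient.repr q))).
have f_bij : bijective f.
  exists k => q.
    rewrite -[RHS]reprK; apply/eqP; rewrite -Quotient.idealrBE -gI gB.
    have := xchooseP (g_surj (generic_quotient.repr (f q))); rewrite -rpredN opprB.
    rewrite Quotient.idealrBE reprK -Quotient.idealrBE => h.
    by rewrite Quotient.idealrBE eq_sym -Quotient.idealrBE -opprB rpredN.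
  rewrite f_pi -[RHS]reprK; apply/eqP; rewrite eq_sym -Quotient.idealrBE.
  exact: xchooseP (g_surj (generic_quotient.repr q)).
pose F : {additive Q -> Q'} := HB.pack f (GRing.isZmodMorphism.Build _ _ f fB).
by exists F.
Qed.

Section Chains.
Variable C : bicomplex.
Local Notation G := (gen C).
Local Notation D := (@dcoef C).
Implicit Types (M N : G -> G -> int) (x y z : chain C).

Definition act M x : chain C := [ffun c' => \sum_c x c * M c c'].

Lemma diffE x : Defs.diff x = act D x.
Proof. by []. Qed.

Lemma chainB x y c : (x - y) c = x c - y c.
Proof. by rewrite !ffunE. Qed.

Lemma actB M x y : act M (x - y) = act M x - act M y.
Proof.
apply/ffunP => c; rewrite !ffunE -sumrB; apply: eq_bigr => c' _.
by rewrite !ffunE mulrBl.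
Qed.

Lemma act0 M : act M 0 = 0.
Proof. by have := actB M 0 0; rewrite !subrr. Qed.

Lemma act_act M N x c :
  act N (act M x) c = \sum_c0 x c0 * \sum_c1 M c0 c1 * N c1 c.
Proof.
rewrite ffunE; under eq_bigr do rewrite ffunE mulr_suml.
rewrite exchange_big /=; apply: eq_bigr => c0 _.
by rewrite mulr_sumr; apply: eq_bigr => c1 _; rewrite mulrA.
Qed.

Lemma act_homogeneous M (d : int) i j x :
  (forall c c', M c c' != 0 -> ideg c' = ideg c + d /\ jdeg c' = jdeg c) ->
  homogeneous i j x -> homogeneous (i + d) j (act M x).
Proof.
move=> hM /forallP hx; apply/forallP => c'; apply/implyP; rewrite ffunE => h.
have [c hc] : exists c, x c * M c c' != 0.
  by apply/existsP; apply: contraR h => /existsPn hn; rewrite big1 // => c _; apply/eqP/negPn.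
move: hc; rewrite mulf_eq0 negb_or => /andP[/(implyP (hx c)) /andP[/eqP <- /eqP <-]].
by case/hM => -> ->; rewrite !eqxx.
Qed.

Lemma cocycle_valB i j (z z' : cocycle C i j) : val (z - z') = val z - val z'.
Proof. exact: raddfB. Qed.
End Chains.

(* [upper c] and [lower c] say that [c] is the source, resp. the target, of a
   matched edge; the hypothesis on [rank] makes the gradient paths
   u -> v -> mate v of the matching acyclic. *)
Section Morse.
Variables (C : bicomplex).
Local Notation G := (gen C).
Local Notation D := (@dcoef C).
Hypothesis D_deg : forall c c', D c c' != 0 -> ideg c' = ideg c + 1 /\ jdeg c' = jdeg c.
Hypothesis D_D : forall c c', \sum_c1 D c c1 * D c1 c' = 0.
Variable mate : G -> G.
Hypothesis mateK : involutive mate.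
Hypothesis mate_unit : forall c, mate c != c ->
  D c (mate c) ^+ 2 = 1 \/ D (mate c) c ^+ 2 = 1.
Definition upper c := D c (mate c) != 0.
Definition lower c := D (mate c) c != 0.
Variable rank : G -> nat.
Hypothesis rank_decr : forall u v, upper u -> lower v -> v != mate u -> D u v != 0 ->
  (rank (mate v) < rank u)%N.

Lemma D_deg_i c c' : D c c' != 0 -> ideg c' = ideg c + 1.
Proof. by case/D_deg. Qed.

Lemma upper_lower c : upper c -> lower c -> False.
Proof. by rewrite /upper /lower => /D_deg_i h /D_deg_i h'; lia. Qed.

Lemma upper_mate c : upper (mate c) = lower c.
Proof. by rewrite /upper /lower mateK. Qed.

Lemma lower_mate c : lower (mate c) = upper c.
Proof. by rewrite /upper /lower mateK. Qed.

Lemma D_same c : D c c = 0.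
Proof. by apply/eqP/negPn/negP => /D_deg_i; lia. Qed.

Lemma upper_noncrit c : upper c -> mate c != c.
Proof. by apply: contraTneq => E; rewrite /upper E D_same eqxx. Qed.

Lemma lower_noncrit c : lower c -> mate c != c.
Proof. by apply: contraTneq => E; rewrite /lower E D_same eqxx. Qed.

Lemma trichotomy c : [|| mate c == c, upper c | lower c].
Proof.
have [//|h /=] := eqVneq; have one : (1 : int) != 0 by [].
by case: (mate_unit h) => E; apply/orP; [left|right];
  rewrite /upper /lower -sqrf_eq0 E.
Qed.

Lemma lower_sq v : lower v -> D (mate v) v * D (mate v) v = 1.
Proof.
move=> lv; case: (mate_unit (lower_noncrit lv)) => //; rewrite ?expr2 // => E.
have uv : upper v by rewrite /upper -sqrf_eq0 expr2 E.
by case: (upper_lower uv lv).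
Qed.

(** Solves row [mate v] of the equation [D h = 1] for the entry [h v u]. The diagonal coefficient
    [D (mate v) v] is its own inverse, and the remaining entries have smaller rank; [n] bounds the
    recursion. *)
Fixpoint hrec (n : nat) (v u : G) : int :=
  if n is m.+1 then
    if lower v then D (mate v) v * ((u == mate v)%:R -
      \sum_(v' | lower v' && (v' != v)) D (mate v) v' * hrec m v' u)
    else 0
  else 0.

(* The inverse, up to extension by zero, of the block of the differential which
   leads from upper to lower generators. *)
Definition hinv (v u : G) : int := hrec (rank (mate v)).+1 v u.

Lemma hrec_stable n v u : (rank (mate v) < n)%N -> hrec n v u = hinv v u.
Proof.
rewrite /hinv; elim/ltn_ind: n v => -[//|n] IH v hn /=.
have [->//|neq] := eqVneq n (rank (mate v)).
case: ifP => // lv; congr (_ * (_ - _)); apply: eq_bigr => v' /andP[lv' vv'].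
have [->|Dn] := eqVneq (D (mate v) v') 0; first by rewrite !mul0r.
congr (_ * _); have := @rank_decr (mate v) v'; rewrite upper_mate mateK => /(_ lv lv' vv' Dn) r.
rewrite (IH n) //; last exact: leq_trans r hn.
by rewrite (IH (rank (mate v))).
Qed.

Lemma hinv_lower v u : ~~ lower v -> hinv v u = 0.
Proof. by rewrite /hinv /= => /negPf ->. Qed.

Lemma hinvE v u : lower v -> hinv v u = D (mate v) v * ((u == mate v)%:R -
  \sum_(v' | lower v' && (v' != v)) D (mate v) v' * hinv v' u).
Proof.
move=> lv; rewrite {1}/hinv /= lv; congr (_ * (_ - _)); apply: eq_bigr => v' /andP[lv' vv'].
have [->|Dn] := eqVneq (D (mate v) v') 0; first by rewrite !mul0r.
congr (_ * _); apply: hrec_stable.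
by have := @rank_decr (mate v) v'; rewrite upper_mate mateK; apply.
Qed.

Lemma lower_ind (P : G -> Prop) :
  (forall v, lower v -> (forall v', lower v' -> v' != v -> D (mate v) v' != 0 -> P v') -> P v) ->
  forall v, lower v -> P v.
Proof.
move=> IH v; elim: {v}(rank (mate v)).+1 {-2}v (ltnSn (rank (mate v))) => // n IHn v hn lv.
apply: IH => // v' lv' vv' Dn; apply: IHn => //.
apply: (@leq_trans (rank (mate v))); last by rewrite -ltnS.
by have := @rank_decr (mate v) v'; rewrite upper_mate mateK => /(_ lv lv' vv' Dn).
Qed.

Lemma hinv_supp v u : hinv v u != 0 ->
  [/\ lower v, upper u, ideg u = ideg v - 1 & jdeg u = jdeg v].
Proof.
have [lv|/hinv_lower ->] := boolP (lower v); last by rewrite eqxx.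
move=> h; split=> //; move: h; move: v lv; apply: lower_ind => v lv IH; rewrite hinvE //;
  rewrite mulf_eq0 negb_or => /andP[_ h]; have [->|uv] := eqVneq u (mate v);
  rewrite ?upper_mate //; try by have [] := D_deg lv; lia.
all: move: h; rewrite (negPf uv) sub0r oppr_eq0 => h.
all: have [v' /and3P[lv' vv' hn]] : exists v', [&& lower v', v' != v &
    D (mate v) v' * hinv v' u != 0].
1,3,5: by apply/existsP; apply: contraR h => /existsPn hn; rewrite big1 // => v' /andP[l1 l2];
  apply/eqP/negPn; have := hn v'; rewrite l1 l2.
all: move: hn; rewrite mulf_eq0 negb_or => /andP[Dn hn].
all: have := IH v' lv' vv' Dn hn => //.
all: by have [] := D_deg lv; have [] := D_deg Dn; lia.
Qed.

Lemma hinv_sum (F : G -> int) v : lower v ->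
  \sum_u hinv v u * F u = D (mate v) v * (F (mate v) -
    \sum_(v' | lower v' && (v' != v)) D (mate v) v' * \sum_u hinv v' u * F u).
Proof.
move=> lv; under eq_bigr do rewrite hinvE // -mulrA.
rewrite -mulr_sumr; congr (_ * _); under eq_bigr do rewrite mulrBl.
rewrite sumrB (bigD1 (mate v)) //= eqxx mul1r big1 ?addr0 => [|u /negPf ->]; last by rewrite mul0r.
congr (_ - _); under eq_bigr do rewrite mulr_suml.
rewrite exchange_big /=; apply: eq_bigr => v' _; rewrite mulr_sumr.
by apply: eq_bigr => u _; rewrite mulrA.
Qed.

Lemma D_hinv u u' : upper u -> \sum_v D u v * hinv v u' = (u' == u)%:R.
Proof.
move=> uu; have lv : lower (mate u) by rewrite lower_mate.
rewrite (bigD1 (mate u)) //= hinvE // mateK mulrA.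
have := lower_sq lv; rewrite mateK => ->; rewrite mul1r.
rewrite [X in _ + X](_ : _ = \sum_(v' | lower v' && (v' != mate u)) D u v' * hinv v' u').
  by rewrite subrK.
rewrite [RHS](eq_bigl (fun v' => (v' != mate u) && lower v')); last by move=> v; rewrite andbC.
rewrite [RHS]big_mkcondr; apply: eq_bigr => v _; case: ifPn => // /hinv_lower ->.
by rewrite mulr0.
Qed.

(** By construction [hinv] is a right inverse of the block; that it is also a left inverse is
    obtained by induction along gradient paths. *)
Lemma hinv_D v v' : lower v -> lower v' -> \sum_u hinv v u * D u v' = (v == v')%:R.
Proof.
move=> lv lv'; move: v lv; apply: lower_ind => v lv IH; rewrite hinv_sum //.
have -> : \sum_(w | lower w && (w != v)) D (mate v) w * \sum_u hinv w u * D u v' =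
   \sum_(w | lower w && (w != v)) D (mate v) w * (w == v')%:R.
  apply: eq_bigr => w /andP[lw wv]; have [->|Dn] := eqVneq (D (mate v) w) 0.
    by rewrite !mul0r.
  by rewrite IH.
have [<-|nv] := eqVneq v v'.
  rewrite big1 ?subr0 ?lower_sq // => w /andP[_ /negPf ->]; exact: mulr0.
rewrite (bigD1 v') ?lv' 1?eq_sym ?nv //= eqxx mulr1 big1 ?addr0 ?subrr ?mulr0 //.
by move=> w /andP[_ /negPf ->]; exact: mulr0.
Qed.

Lemma hinv_hinv v w : \sum_u hinv v u * hinv u w = 0.
Proof.
apply: big1 => u _; apply/eqP; rewrite mulf_eq0; apply/norP => -[h h'].
by case: (hinv_supp h) (hinv_supp h') => _ uu _ _ [lu _ _ _]; exact: upper_lower uu lu.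
Qed.

Implicit Types x y z : chain C.
Local Notation h := (act hinv).
Local Notation d := (act D).

Lemma d_d x : d (d x) = 0.
Proof. by apply/ffunP => c; rewrite act_act big1 ?ffunE // => c0 _; rewrite D_D mulr0. Qed.

Lemma h_h x : h (h x) = 0.
Proof. by apply/ffunP => c; rewrite act_act big1 ?ffunE // => c0 _; rewrite hinv_hinv mulr0. Qed.

Definition upper_supported x := forall c, ~~ upper c -> x c = 0.

Lemma h_upper x : upper_supported (h x).
Proof.
move=> c nc; rewrite ffunE big1 // => c0 _; apply/eqP; rewrite mulf_eq0; apply/norP => -[_].
by case/hinv_supp => _ uc; rewrite uc in nc.
Qed.

Lemma h_d_upper x : upper_supported x -> h (d x) = x.
Proof.
move=> hx; apply/ffunP => c; rewrite act_act (bigD1 c) //= [X in _ + X]big1 ?addr0 => [|u /negPf uc].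
  have [uc|/hx ->] := boolP (upper c); last by rewrite mul0r.
  by rewrite D_hinv // eqxx mulr1.
have [uu|/hx ->] := boolP (upper u); last by rewrite mul0r.
by rewrite D_hinv // eq_sym uc mulr0.
Qed.

Lemma d_h_lower x v : lower v -> d (h x) v = x v.
Proof.
move=> lv; rewrite act_act (bigD1 v) //= [X in _ + X]big1 ?addr0 => [|w /negPf wv].
  by rewrite hinv_D // eqxx mulr1.
have [lw|nw] := boolP (lower w); first by rewrite hinv_D // wv mulr0.
by rewrite big1 ?mulr0 // => u _; rewrite hinv_lower ?mul0r.
Qed.

Lemma h_eq0_lower x v : h x = 0 -> lower v -> x v = 0.
Proof. by move=> hx lv; rewrite -(d_h_lower x lv) hx act0 ffunE. Qed.

Lemma h_lower_eq0 x : (forall v, lower v -> x v = 0) -> h x = 0.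
Proof.
move=> hx; apply/ffunP => u; rewrite !ffunE big1 // => v _.
have [/hx ->|nv] := boolP (lower v); first by rewrite mul0r.
by rewrite hinv_lower ?mulr0.
Qed.

(* The image of the projection [1 - h d - d h], which is chain homotopic to the
   identity; a chain of this subcomplex is determined by its critical part. *)
Definition reduced x := h x = 0 /\ h (d x) = 0.

Definition proj x := x - h (d x) - d (h x).

Lemma proj_reduced x : reduced (proj x).
Proof.
have hdh y : h (d (h y)) = h y by apply: h_d_upper; exact: h_upper.
split; rewrite /proj !actB ?h_h ?hdh ?subr0 ?subrr //.
by rewrite d_d act0 subr0.
Qed.

Lemma d_reduced x : reduced x -> reduced (d x).
Proof. by case=> hx hdx; split=> //; rewrite d_d act0. Qed.

Lemma reducedB x y : reduced x -> reduced y -> reduced (x - y).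
Proof. by move=> [h1 h2] [h3 h4]; split; rewrite !actB ?h1 ?h2 ?h3 ?h4 subrr. Qed.

(** [h x = 0] kills the lower part and the hypothesis the critical part, so [x] is supported on
    upper generators, where [h] inverts [d]. *)
Lemma reduced_eq0 x : reduced x -> (forall c, mate c = c -> x c = 0) -> x = 0.
Proof.
move=> [hx hdx] hc; rewrite -hdx h_d_upper // => c nc.
by case/or3P: (trichotomy c) => [/eqP/hc //|uc|/(h_eq0_lower hx) //]; rewrite uc in nc.
Qed.

Lemma h_homogeneous i j x : homogeneous i j x -> homogeneous (i - 1) j (h x).
Proof. by apply: act_homogeneous => c c' /hinv_supp[]. Qed.

Lemma d_homogeneous i j x : homogeneous i j x -> homogeneous (i + 1) j (d x).
Proof. by apply: act_homogeneous => c c'; exact: D_deg. Qed.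

(** * Path weights and the Schur complement *)

Definition morse_weight c c' : int := if c' == mate c then - (D c' c)^-1 else D c c'.
Local Notation W := morse_weight.

Lemma weight_neq0 (x y : G) : W x y != 0 -> (y = mate x /\ lower x) \/ (y != mate x /\ D x y != 0).
Proof.
rewrite /W; have [->|ne] := eqVneq y (mate x); last by right.
by rewrite oppr_eq0 invr_eq0; left.
Qed.

Lemma weight_lower v : lower v -> W v (mate v) = - D (mate v) v.
Proof.
move=> lv; rewrite /W eqxx; have /eqP := lower_sq lv.
by rewrite -expr2 sqrf_eq1 => /orP[] /eqP ->; rewrite ?invrN1 ?invr1.
Qed.

(* Only the reversed edges lower the degree, and they lead out of the lower
   generators. *)
Lemma path_degree c' (x : G) p : mate c' = c' -> path (nonzero_edge W) x p -> last x p = c' ->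
  if lower x then is_true (ideg x <= ideg c') else p = [::] \/ (ideg x + 1 <= ideg c')%R.
Proof.
move=> mc'; elim: p x => [|y p IH] x /=.
  by move=> _ ->; case: ifP => // _; left.
case/andP => /weight_neq0[[-> lx]|[_ Dxy]] hp hl; have := IH _ hp hl.
  rewrite lx ifN; last by apply/negP => lm; move: (lx); rewrite -upper_mate => /upper_lower; apply.
  have hi := D_deg_i lx; case=> [p0|]; last by lia.
  have E : mate x = c' by move: hl; rewrite p0.
  by move: (lower_noncrit lx); rewrite E -mc' -E mateK eqxx.
have := D_deg_i Dxy; case: (lower y); case: (lower x) => hi.
- by move=> h; lia.
- by move=> h; right; lia.
- case=> [p0|h]; last by lia.
  by move: hl; rewrite p0 /= => <-; lia.
- case=> [p0|h]; last by right; lia.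
  by move: hl; rewrite p0 /= => <-; right; lia.
Qed.

(** Each double step [v -> mate v -> y] to a lower [y] reduces the rank of the mate; the additional
    2 stands for the last double step, to [c']. *)
Lemma path_length_lower c' v p : mate c' = c' -> lower v -> ideg c' = ideg v ->
  path (nonzero_edge W) v p -> last v p = c' -> (size p <= (rank (mate v)).*2.+2)%N.
Proof.
move=> mc' lv; move: v lv p; apply: lower_ind => v lv IH p hi.
case: p => [//|x p] /= /andP[/weight_neq0[[-> _]|[_ Dvx]] hp hl]; last first.
  have := path_degree mc' hp hl; have := D_deg_i Dvx; case: (lower x) => hx; first by lia.
  by case=> [->//|]; lia.
case: p hp hl => [//|y p] /= /andP[/weight_neq0[[_ lm]|[ym Dmy]] hp hl].
  by move: (lv); rewrite -upper_mate => /upper_lower; case.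
rewrite mateK in ym; have hm := D_deg_i lv; have hy := D_deg_i Dmy.
have := path_degree mc' hp hl; case: ifP => ly h; last by case: h => [->//|]; lia.
have := IH y ly ym Dmy p _ hp hl; rewrite hi hy hm => /(_ erefl) hs.
have := @rank_decr (mate v) y; rewrite upper_mate mateK => /(_ lv ly ym Dmy); lia.
Qed.

Lemma path_length_crit c c' p : mate c = c -> mate c' = c' -> ideg c' = ideg c + 1 ->
  path (nonzero_edge W) c p -> last c p = c' ->
  (size p <= (\max_w rank w).*2.+3)%N.
Proof.
move=> mc mc' hi; case: p => [//|x p] /= /andP[/weight_neq0[[_ lc]|[_ Dcx]] hp hl].
  by move: (lower_noncrit lc); rewrite mc eqxx.
have hx := D_deg_i Dcx; have := path_degree mc' hp hl; case: ifP => lx h.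
  have hix : ideg c' = ideg x by rewrite hx.
  have := path_length_lower mc' lx hix hp hl; have := @leq_bigmax _ rank (mate x).
  by rewrite !ltnS -leq_double => h1 h2; apply: leq_trans h2 _; rewrite !ltnS.
by case: h => [->//|]; lia.
Qed.

Lemma short_sum_up n c' (x : G) : mate c' = c' -> ~~ lower x -> (ideg c' < ideg x + 1)%R ->
  short_sum W n.+1 x c' = (x == c')%:R.
Proof.
move=> mc' nlx hi; have [xc'|xc'] := eqVneq x c'; last first.
  apply/eqP/negPn/negP => /short_sum_neq0[p hp hl]; have := path_degree mc' hp hl.
  rewrite (negPf nlx) => -[p0|]; last by lia.
  by move: xc'; rewrite -hl p0 eqxx.
rewrite short_sumS xc' eqxx big1 ?addr0 // => y _; apply/eqP; rewrite mulf_eq0.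
apply/norP => -[/weight_neq0[[_ lc]|[_ Dy]] /short_sum_neq0[p hp hl]].
  by move: nlx; rewrite xc' lc.
have := path_degree mc' hp hl; have := D_deg_i Dy; case: (lower y) => h; first by lia.
by case=> [p0|]; [move: hl; rewrite p0 /=|] => *; subst; lia.
Qed.

Lemma short_sum_down n c' v : mate c' = c' -> lower v -> (ideg c' < ideg v)%R ->
  short_sum W n v c' = 0.
Proof.
move=> mc' lv hi; apply/eqP/negPn/negP => /short_sum_neq0[p hp hl].
by have := path_degree mc' hp hl; rewrite lv; lia.
Qed.

Lemma sum_next n c' (x : G) : mate c' = c' -> ideg c' = ideg x + 1 -> (0 < n)%N ->
  \sum_(y : G | y != mate x) W x y * short_sum W n y c' =
  (c' != mate x)%:R * D x c' +
  \sum_(v | lower v && (v != mate x)) D x v * short_sum W n v c'.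
Proof.
case: n => // n mc' hi _; have nl : ~~ lower c' by apply: contraTN isT => /lower_noncrit; rewrite mc' eqxx.
rewrite (eq_bigr (fun y : G => D x y * short_sum W n.+1 y c')); last first.
  by move=> y /negPf ym; rewrite /W ym.
rewrite (bigID lower) /= addrC; congr (_ + _); last by apply: eq_bigl => y; rewrite andbC.
rewrite big_mkcond (bigD1 c') //= nl andbT big1 ?addr0 => [|y yc'].
  case: (c' != mate x); rewrite ?mul0r ?mul1r // short_sum_up ?eqxx ?mulr1 //; lia.
case: ifP => // /andP[_ nly]; have [->|/D_deg_i hy] := eqVneq (D x y) 0; first by rewrite mul0r.
by rewrite short_sum_up ?(negPf yc') ?mulr0 //; lia.
Qed.

(** Degrees force the path to start with [v -> mate v] and to go on to [c'] or to another lower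
    generator. This is the recursion of [hinv_sum], and the weight [- D (mate v) v] of the reversed
    edge gives the sign. *)
Lemma short_sum_lower c' v n : mate c' = c' -> lower v -> ideg c' = ideg v ->
  ((rank (mate v)).*2.+3 <= n)%N ->
  short_sum W n v c' = - \sum_u hinv v u * D u c'.
Proof.
move=> mc' lv; move: v lv n; apply: lower_ind => v lv IH n hi hn.
case: n hn => [//|[//|n]] hn; rewrite short_sumS hinv_sum //.
have -> : v == c' = false by apply: contraTF (lower_noncrit lv) => /eqP ->; rewrite mc' eqxx.
have hm := D_deg_i lv.
rewrite add0r (bigD1 (mate v)) //= weight_lower // big1 ?addr0 => [|x /negPf xm]; last first.
  rewrite {1}/W xm; have [->|/D_deg_i hx] := eqVneq (D v x) 0; first by rewrite mul0r.
  have [lx|nlx] := boolP (lower x); first by rewrite short_sum_down ?mulr0 //; lia.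
  rewrite short_sum_up //; last by lia.
  by case: eqP => [E|]; rewrite ?mulr0 //; move: hi; rewrite -E hx; lia.
rewrite mulNr; congr (- (_ * _)).
have nlm : ~~ lower (mate v) by rewrite lower_mate; apply/negP => uv; exact: upper_lower uv lv.
rewrite short_sumS; have -> : mate v == c' = false.
  by apply: contraTF (lower_noncrit lv) => /eqP E; rewrite -{2}[v]mateK E mc' eqxx.
(* From [mate v] back to [v] the weight is the inverse of the coefficient in the wrong direction,
   which is 0, and [0^-1 = 0]. *)
rewrite add0r (bigD1 v) //= {1}/W mateK eqxx.
have -> : D v (mate v) = 0 by apply/eqP/negPn; move: nlm; rewrite /lower mateK.
rewrite invr0 oppr0 mul0r add0r.
have n0 : (0 < n)%N by move: hn; rewrite !ltnS; apply: leq_trans.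
have := sum_next (x := mate v) mc'; rewrite mateK => ->//; last by rewrite hi.
have -> : c' != v by apply: contraTneq lv => <-; apply/negP => /lower_noncrit; rewrite mc' eqxx.
rewrite mul1r; congr (_ + _); rewrite -sumrN; apply: eq_bigr => w /andP[lw wv].
have [->|Dw] := eqVneq (D (mate v) w) 0; first by rewrite !mul0r oppr0.
rewrite -mulrN IH //; first by rewrite hi hm (D_deg_i Dw).
have := @rank_decr (mate v) w; rewrite upper_mate mateK => /(_ lv lw wv Dw) r.
by move: hn; lia.
Qed.

Lemma path_sum_schur c c' : mate c = c -> mate c' = c' -> ideg c' = ideg c + 1 ->
  \sum_(p \in [set p : seq G | path (nonzero_edge W) c p /\ last c p = c']%classic)
    path_prod W c p =
  D c c' - \sum_v D c v * \sum_u hinv v u * D u c'.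
Proof.
move=> mc mc' hi; pose N := (\max_w rank w).*2.+3.
rewrite (@path_sumE _ _ N.+1) => [|p hp hl]; last first.
  by rewrite ltnS; exact: path_length_crit hp hl.
rewrite short_sumS; have -> : c == c' = false.
  by apply/negP => /eqP E; move: hi; rewrite E; lia.
(* As [c] is its own mate, the loop at [c] gets the reversed weight, which is 0 because
   [D c c = 0]. *)
rewrite add0r (bigD1 c) //= {1}/W mc eqxx D_same invr0 oppr0 mul0r add0r.
have := sum_next (x := c) mc' hi; rewrite mc => -> //.
have -> : c' != c by apply/negP => /eqP E; move: hi; rewrite E; lia.
rewrite mul1r; congr (_ + _); rewrite -sumrN [RHS](bigID lower) /= [X in _ + X]big1 ?addr0.
  apply: eq_big => [v|v /andP[lv vc]].
    by case lv : (lower v) => //=; apply: contraTneq lv => ->; apply/negP => /lower_noncrit; rewrite mc eqxx.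
  have [->|Dv] := eqVneq (D c v) 0; first by rewrite !mul0r oppr0.
  rewrite -mulrN short_sum_lower //; first by rewrite hi (D_deg_i Dv).
  by rewrite !ltnS leq_double; apply: (@leq_bigmax _ rank).
move=> v nlv; rewrite big1 ?mulr0 ?oppr0 // => u _.
by rewrite hinv_lower ?mul0r.
Qed.

(** * The complex of critical generators *)

Section Reduction.
Variables (S : finType) (crit : S -> G).
Hypothesis crit_inj : injective crit.
Hypothesis critP : forall c, reflect (exists s, crit s = c) (mate c == c).
Variable K : S -> S -> int.
Hypothesis K_E : forall s s', K s s' =
  if ideg (crit s') == ideg (crit s) + 1 then
    D (crit s) (crit s') - \sum_v D (crit s) v * \sum_u hinv v u * D u (crit s')
  else 0.

Definition morse : bicomplex :=
  Bicomplex (fun s => ideg (crit s)) (fun s => jdeg (crit s)) K.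

Implicit Types t : chain morse.

Definition ext t : chain C := [ffun c => \sum_s t s * (c == crit s)%:R].
Definition rest x : chain morse := [ffun s => x (crit s)].
(** This is [proj (ext t)], since [h (ext t) = 0]; the correction is supported on upper generators
    and leaves the critical part unchanged. *)
Definition iota t : chain C := ext t - h (d (ext t)).

Lemma mate_crit s : mate (crit s) = crit s.
Proof. by apply/eqP/critP; exists s. Qed.

Lemma crit_not_upper s : ~~ upper (crit s).
Proof. by apply/negP => /upper_noncrit; rewrite mate_crit eqxx. Qed.

Lemma ext_crit t s : ext t (crit s) = t s.
Proof.
rewrite ffunE (bigD1 s) //= eqxx mulr1 big1 ?addr0 // => s' /negPf ns.
by rewrite (inj_eq crit_inj) eq_sym ns mulr0.
Qed.

Lemma ext_noncrit t c : mate c != c -> ext t c = 0.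
Proof.
move=> nc; rewrite ffunE big1 // => s _; case: eqP => [E|]; rewrite ?mulr0 //.
by rewrite E mate_crit eqxx in nc.
Qed.

Lemma h_ext t : h (ext t) = 0.
Proof. by apply: h_lower_eq0 => v /lower_noncrit/ext_noncrit. Qed.

Lemma iota_reduced t : reduced (iota t).
Proof.
have := proj_reduced (ext t); rewrite /proj h_ext.
by rewrite act0 subr0.
Qed.

Lemma rest_iota t : rest (iota t) = t.
Proof.
apply/ffunP => s; rewrite ffunE /iota chainB ext_crit.
by rewrite h_upper ?subr0 // crit_not_upper.
Qed.

Lemma iotaB t t' : iota (t - t') = iota t - iota t'.
Proof.
have extB : ext (t - t') = ext t - ext t'.
  apply/ffunP => c; rewrite !ffunE -sumrB; apply: eq_bigr => s _.
  by rewrite !ffunE mulrBl.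
by rewrite /iota extB !actB !opprB addrACA [RHS]addrACA [X in _ + X]addrC.
Qed.

Lemma iota0 : iota 0 = 0.
Proof. by have := iotaB 0 0; rewrite !subrr. Qed.

Lemma iota_rest x : reduced x -> x = iota (rest x).
Proof.
move=> rx; apply/eqP; rewrite -subr_eq0; apply/eqP.
apply: reduced_eq0; first exact: reducedB (iota_reduced _).
move=> c /eqP/critP[s <-]; have := congr1 (fun t : chain morse => t s) (rest_iota (rest x)).
by rewrite chainB !ffunE => ->; rewrite subrr.
Qed.

Lemma iota_inj : injective iota.
Proof. exact: can_inj rest_iota. Qed.

Lemma ext_homogeneous i j t : homogeneous i j t -> homogeneous i j (ext t).
Proof.
move=> /forallP ht; apply/forallP => c; apply/implyP.
have [/critP[s <-]|/ext_noncrit ->] := boolP (mate c == c); last by rewrite eqxx.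
by rewrite ext_crit; exact: (implyP (ht s)).
Qed.

Lemma iota_homogeneous i j t : homogeneous i j t -> homogeneous i j (iota t).
Proof.
move=> ht; have he := ext_homogeneous ht; apply: homogeneousB => //.
by have := h_homogeneous (d_homogeneous he); rewrite addrK.
Qed.

Lemma rest_homogeneous i j x : homogeneous i j x -> homogeneous i j (rest x).
Proof.
by move=> /forallP hx; apply/forallP => s; rewrite ffunE; exact: hx.
Qed.

Lemma act_ext M t c : act M (ext t) c = \sum_s t s * M (crit s) c.
Proof.
rewrite ffunE; under eq_bigr do rewrite ffunE mulr_suml.
rewrite exchange_big /=; apply: eq_bigr => s _.
rewrite (bigD1 (crit s)) //= eqxx mulr1 big1 ?addr0 // => c0 /negPf ->.
by rewrite mulr0 mul0r.
Qed.

Lemma K_schur s s' : K s s' =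
  D (crit s) (crit s') - \sum_v D (crit s) v * \sum_u hinv v u * D u (crit s').
Proof.
rewrite K_E; case: eqP => // ne; apply/esym/eqP; rewrite subr_eq0; apply/eqP.
have [->|/D_deg_i //] := eqVneq (D (crit s) (crit s')) 0.
rewrite big1 // => v _; apply/eqP; rewrite mulf_eq0; apply/norP => -[Dv].
apply/negP/negPn; rewrite big1 // => u _; apply/eqP; rewrite mulf_eq0; apply/norP => -[hn Du].
apply: ne; rewrite (D_deg_i Du); case/hinv_supp: hn => _ _ -> _.
by rewrite (D_deg_i Dv) subrK.
Qed.

Lemma diff_morse t : Defs.diff t = rest (d (iota t)).
Proof.
apply/ffunP => s'; rewrite /iota actB [RHS]ffunE chainB act_ext act_act.
under [X in _ - X]eq_bigr do rewrite act_ext mulr_suml.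
rewrite exchange_big -sumrB /= ffunE; apply: eq_bigr => s _.
by rewrite /= K_schur mulrBr; congr (_ - _); rewrite mulr_sumr; apply: eq_bigr => v _; rewrite mulrA.
Qed.

(** The differential of a reduced chain is reduced, so it is recovered from its critical part. *)
Lemma iota_diff t : iota (Defs.diff t) = d (iota t).
Proof.
by rewrite diff_morse -iota_rest //; apply/d_reduced/iota_reduced.
Qed.

Lemma morse_complex : cochain_complex morse.
Proof.
split=> [t|i j t ht]; last first.
  by rewrite diff_morse; apply/rest_homogeneous/d_homogeneous/iota_homogeneous.
apply: iota_inj; by rewrite !iota_diff d_d iota0.
Qed.

Lemma iota_cocycle i j (z : cocycle morse i j) : iota (val z) \in @is_cocycle C i j.
Proof.
have /andP[hz /eqP dz] := valP z; apply/andP; split; first exact: iota_homogeneous.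
by rewrite diffE -iota_diff dz iota0.
Qed.

Definition cocycle_map i j (z : cocycle morse i j) : cocycle C i j := Cocycle (iota_cocycle z).

Lemma cocycle_mapB i j : {morph @cocycle_map i j : z z' / z - z'}.
Proof. move=> z z'; apply: val_inj; rewrite cocycle_valB /=.
by rewrite -iotaB -cocycle_valB. Qed.

Lemma cocycle_map_coboundary i j (z : cocycle morse i j) :
  (cocycle_map z \in @is_coboundary C i j) = (z \in @is_coboundary morse i j).
Proof.
apply/asboolP/asboolP => -[y hy E].
  (* The given primitive need not be reduced. Its projection is, and it has the same differential,
     because [h d y = h (iota z) = 0]. *)
  exists (rest (proj y)).
    apply: rest_homogeneous; apply: homogeneousB; first apply: homogeneousB => //.
      by have := h_homogeneous (d_homogeneous hy); rewrite addrK.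
    by have := d_homogeneous (h_homogeneous hy); rewrite subrK.
  apply: iota_inj; rewrite iota_diff -iota_rest; last exact: proj_reduced.
  have [zh zdh] := iota_reduced (val z); move: zh zdh.
  rewrite [iota _]E diffE => zh _.
  by rewrite /proj !actB d_d subr0 zh act0 subr0.
exists (iota y); first exact: iota_homogeneous.
by rewrite /= E iota_diff.
Qed.

(** For a cocycle, [z - proj z] is the coboundary of [h z]. *)
Lemma cocycle_map_surj i j (z : cocycle C i j) :
  exists w : cocycle morse i j, z - cocycle_map w \in @is_coboundary C i j.
Proof.
have /andP[hz /eqP dz] := valP z; rewrite diffE in dz.
have E : iota (rest (proj (val z))) = proj (val z).
  by rewrite -iota_rest //; exact: proj_reduced.
have wP : rest (proj (val z)) \in @is_cocycle morse i j.
  apply/andP; split.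
    apply: rest_homogeneous; apply: homogeneousB; first apply: homogeneousB => //.
      by have := h_homogeneous (d_homogeneous hz); rewrite addrK.
    by have := d_homogeneous (h_homogeneous hz); rewrite subrK.
  by rewrite diff_morse E /proj !actB d_d dz !act0 !subr0; apply/eqP/ffunP => s; rewrite !ffunE.
exists (Cocycle wP); apply/asboolP; exists (h (val z)); first exact: h_homogeneous.
by rewrite cocycle_valB /= E /proj dz act0 subr0 opprB addrC subrK diffE.
Qed.

Theorem morse_cohomology i j :
  exists f : {additive cohomology morse i j -> cohomology C i j}, bijective f.
Proof.
exact: (quot_additive_bijective (@cocycle_mapB i j) (@cocycle_map_coboundary i j)
  (@cocycle_map_surj i j)).
Qed.
End Reduction.
End Morse.

(** * The modified Hasse diagram of the Khovanov complex *)

Section GradientPaths.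
Variables (L : link_diagram) (b : checkerboard L).
Variable le : rel (crossing L).
Hypotheses (le_total : total le) (le_antisym : antisymmetric le) (le_trans : transitive le).
Local Notation mate := (@kh_mate L b le le_total le_antisym le_trans).

Lemma kh_coef_same (c : enhanced b) : kh_coef le c c = 0.
Proof.
apply/eqP/negPn/negP => /kh_coef_neq0[e [/(congr1 (fun H : {set crossing L} => e \in H)) + _ _]].
by rewrite in_toggle eqxx /=; case: (e \in sub c).
Qed.

Lemma weightE : weight (b := b) le = morse_weight (C := CKh b le) mate.
Proof.
apply/funext => c; apply/funext => c'; rewrite /weight /morse_weight.
have [->|ne] := eqVneq c' (mate c); last first.
  by case: asboolP => // /(matchedE le_total le_antisym le_trans)[E]; rewrite E eqxx in ne.
(* A critical generator is its own mate without being matched, so the two definitions take different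
   branches on its loop; both give 0. *)
case: asboolP => // h; have [-> /=|nc] := eqVneq (mate c) c.
  by rewrite kh_coef_same invr0 oppr0.
by case: h; apply/(matchedE le_total le_antisym le_trans).
Qed.

Lemma path_weightE (c : enhanced b) p : path_weight le c p = path_prod (weight le) c p.
Proof. by elim: p c => //= c' p IH c; rewrite IH. Qed.
End GradientPaths.

Theorem theorem1p2 (L : link_diagram) (b : checkerboard L)
    (le : rel (crossing L)) (le_total : total le)
    (le_antisym : antisymmetric le) (le_trans : transitive le) :
  cochain_complex (CST b le) /\
  (forall i j : int,
     exists f : {additive cohomology (CST b le) i j -> cohomology (CKh b le) i j},
       bijective f).
Proof.
pose mate : gen (CKh b le) -> gen (CKh b le) := kh_mate le_total le_antisym le_trans.
have D_deg (c c' : gen (CKh b le)) : dcoef c c' != 0 ->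
    ideg c' = ideg c + 1 /\ jdeg c' = jdeg c by exact: kh_homogeneous.
have D_D (c c' : gen (CKh b le)) : \sum_c1 dcoef c c1 * dcoef c1 c' = 0 by exact: kh_dd.
have mateK : involutive mate by exact: kh_mateK.
have unit (c : gen (CKh b le)) : mate c != c ->
    dcoef c (mate c) ^+ 2 = 1 \/ dcoef (mate c) c ^+ 2 = 1 by exact: kh_mate_unit.
pose rank : gen (CKh b le) -> nat := kh_rank le_total le_antisym le_trans.
have decr (u w : gen (CKh b le)) : upper (C := CKh b le) mate u ->
    lower (C := CKh b le) mate w -> w != mate u -> dcoef u w != 0 ->
    (rank (mate w) < rank u)%N by exact: kh_rank_decr.
have critP := @kh_mate_critical L b le le_total le_antisym le_trans.
have crit_inj := @critical_of_inj L b le le_total le_antisym le_trans.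
have K_E (s s' : signed_tree b) : st_coef le s s' =
    if i_grading (critical_of le s') == i_grading (critical_of le s) + 1 then
      kh_coef le (critical_of le s) (critical_of le s') -
      \sum_v kh_coef le (critical_of le s) v *
        \sum_u hinv (C := CKh b le) mate rank v u * kh_coef le u (critical_of le s')
    else 0.
  rewrite /st_coef; case: eqP => // hi.
  have fixed t : mate (critical_of le t) = critical_of le t.
    by apply/eqP/critP; exists t.
  rewrite -(path_sum_schur D_deg mateK unit decr (fixed s) (fixed s') hi) /Gamma.
  rewrite -weightE; apply: eq_fsbigr => p _; exact: path_weightE.
split; first exact: (morse_complex D_deg D_D mateK unit decr crit_inj critP K_E).
exact: (morse_cohomology D_deg D_D mateK unit decr crit_inj critP K_E).
Qed.
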